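(* Let $k$ be a field of characteristic $\neq2$, $Q$ a quaternion algebra over $k$ with canonical involution, $V$ a right $Q$-module with a nondegenerate anti-hermitian form $h$ and an orthogonal basis $(e_1,\dots,e_r)$, $r\geq2$, giving a diagonalization $h=\langle z_1,\dots,z_r\rangle$ with $z_i\in Q$ invertible pure quaternions. Let $A=\mathrm{End}_Q(V)$ with its orthogonal involution $\sigma=\sigma_h$ adjoint to $h$, and let $B=Cl(A,\sigma)$ be the Clifford algebra of $(A,\sigma)$, with its canonical involution $\tau$. Suppose that the $z_i$ are pairwise $k$-linearly independent. Then there exists a strictly maximal étale subalgebra $L\subset B$ of the form $L=k(\xi_1,\dots,\xi_r)$ with $\xi_i^2=z_i^2$, such that $Z(B)=k(\xi)$ where $\xi=\prod_i\xi_i$. The algebra $L$ is naturally $G$-Galois over $k$ with $G=(\mathbb{Z}/2\mathbb{Z})^r$, the involution $\tau$ acts on $L$ as the element $(1,\dots,1)$, and $Z(B)=L^H$ where $H\subset G$ is the kernel of the morphism $G\to\mathbb{Z}/2\mathbb{Z}$ given by the sum of the components. The group $H$ is generated by the elements $\tau_{p,q}$ for $p\neq q$, whose only nonzero components are those of index $p$ and $q$. Then for all $p\neq q$ there exist $u_{p,q}\in B$ (with $u_{p,q}=u_{q,p}$) such that: (1) conjugation by $u_{p,q}$ induces $\tau_{p,q}$ on $L$; (2) $\tau(u_{p,q})=-u_{p,q}$; (3) if $\{i,j\}\cap\{p,q\}=\emptyset$, then $u_{i,j}$ and $u_{p,q}$ commute; (4) $u_{p,q}^2=\mathrm{Trd}_Q(z_pz_q)-2\xi_p\xi_q$;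 (5) if $i,p,q$ are distinct, then $$u_{i,p}u_{i,q}=(\lambda_0-\xi_i+\lambda_p\xi_p-\lambda_q\xi_q-\lambda_{p,q}\xi_p\xi_q)\,u_{p,q},$$ where $z_i=\lambda_0+\lambda_pz_p+\lambda_qz_q+\lambda_{p,q}z_pz_q$ with $\lambda_0,\lambda_p,\lambda_q,\lambda_{p,q}\in k$.
   Context: The diagonalization means $h(e_i,e_j)=0$ for $i\neq j$ and $h(e_i,e_i)=z_i$, where $h(xa,yb)=\overline a\,h(x,y)\,b$ and $h(y,x)=-\overline{h(x,y)}$. $Cl(A,\sigma)$ is the (even) Clifford algebra of the algebra with orthogonal involution $(A,\sigma)$ of degree $2r$; its center $Z(B)$ is a quadratic étale $k$-algebra, over which $B$ is Azumaya of degree $2^{r-1}$. The notation $k(\xi_1,\dots,\xi_r)$ denotes the étale $k$-algebra generated by commuting elements $\xi_i$; the element $(\epsilon_1,\dots,\epsilon_r)\in G=(\mathbb{Z}/2\mathbb{Z})^r$ acts by $\xi_i\mapsto(-1)^{\epsilon_i}\xi_i$. Strictly maximal means: for each point $\mathfrak p$ of $\mathrm{Spec}(Z(B))$, $\dim_{Z(B)_{\mathfrak p}}L_{\mathfrak p}=\deg B_{\mathfrak p}$. An étale algebra $L$ over a field $k$ is $G$-Galois ($G\subset\mathrm{Aut}_k(L)$) if $[L:k]=|G|$ and $L^G=k$. The independence of $z_p,z_q$ ensures that $(1,z_p,z_q,z_pz_q)$ is a $k$-basis of $Q$, so the decomposition of $z_i$ in (5) exists and is unique. $\mathrm{Trd}_Q$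 is the reduced trace.
   Formalization: In (1), invertibility of u_{p,q} and conjugation by it are claimed only if (1,z_p,z_q,z_pz_q) is a basis of Q, which independence does not ensure for split Q; otherwise only u_{p,q}x = τ_{p,q}(x)u_{p,q} on L is claimed. (5) is stated for every such decomposition of z_i, if one exists. *)

(* Defs.v *)
From HB Require Import structures.
From mathcomp Require Import all_boot all_order all_fingroup all_algebra.
From mathcomp Require Import generic_quotient ring.
From mathcomp Require Import boolp classical_sets functions.

Set Implicit Arguments.
Unset Strict Implicit.
Unset Printing Implicit Defensive.

Import GRing.Theory.

Local Open Scope ring_scope.
Local Open Scope quotient_scope.
Local Open Scope classical_set_scope.

(* Unital associative k-algebras, as rings with a central morphism from k.  The
   ring may be zero, so that (unlike with [algType]) End_Q(V) and algebras given
   by generators and relations need not be proved nonzero beforehand. *)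
Structure algebra (k : comPzRingType) := Algebra {
  alg_ring :> pzRingType;
  alg_map : {rmorphism k -> alg_ring};
  alg_central : forall c x, alg_map c * x = x * alg_map c }.

Notation "c %:sc" := (alg_map _ c)
  (at level 2, left associativity, format "c %:sc").

(* The quaternion algebra (a, b) over k, with k-basis 1, i, j, ij, where
   i^2 = a, j^2 = b and ji = - ij.  In characteristic different from 2, and
   with a and b nonzero, these are all the quaternion algebras over k. *)

Record quat (k : fieldType) (a b : k) :=
  Quat { qre : k; qi : k; qj : k; qij : k }.

Section Quaternions.
Variables (k : fieldType) (a b : k).
Local Notation Q := (quat a b).

Definition quat_code (x : Q) := (qre x, qi x, qj x, qij x).
Definition quat_decode (u : k * k * k * k) : Q :=
  let: (x, y, z, t) := u in Quat a b x y z t.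
Fact quat_codeK : cancel quat_code quat_decode. Proof. by case. Qed.
HB.instance Definition _ := Choice.copy Q (can_type quat_codeK).

Definition qadd (x y : Q) : Q :=
  Quat a b (qre x + qre y) (qi x + qi y) (qj x + qj y) (qij x + qij y).
Definition qopp (x : Q) : Q := Quat a b (- qre x) (- qi x) (- qj x) (- qij x).
Definition qone : Q := Quat a b 1 0 0 0.
Definition qscale (c : k) (x : Q) : Q :=
  Quat a b (c * qre x) (c * qi x) (c * qj x) (c * qij x).
Definition qmul (x y : Q) : Q := Quat a b
  (qre x * qre y + a * (qi x * qi y) + b * (qj x * qj y)
     - a * b * (qij x * qij y))
  (qre x * qi y + qi x * qre y - b * (qj x * qij y) + b * (qij x * qj y))
  (qre x * qj y + qj x * qre y + a * (qi x * qij y) - a * (qij x * qi y))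
  (qre x * qij y + qij x * qre y + qi x * qj y - qj x * qi y).

Local Ltac qring := move=> *; rewrite /qadd /qmul /qscale /=; congr Quat; ring.

Fact qaddA : associative qadd. Proof. qring. Qed.
Fact qaddC : commutative qadd. Proof. qring. Qed.
Fact qadd0 : left_id (Quat a b 0 0 0 0) qadd. Proof. case; qring. Qed.
Fact qaddN : left_inverse (Quat a b 0 0 0 0) qopp qadd. Proof. qring. Qed.
HB.instance Definition _ := GRing.isZmodule.Build Q qaddA qaddC qadd0 qaddN.

Fact qmulA : associative qmul. Proof. qring. Qed.
Fact qmul1l : left_id qone qmul. Proof. case; qring. Qed.
Fact qmul1r : right_id qone qmul. Proof. case; qring. Qed.
Fact qmulDl : left_distributive qmul qadd. Proof. qring. Qed.
Fact qmulDr : right_distributive qmul qadd. Proof. qring. Qed.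
Fact qone_neq0 : qone != 0.
Proof. by apply/eqP => -[] /eqP; rewrite oner_eq0. Qed.
HB.instance Definition _ := GRing.Zmodule_isNzRing.Build Q
  qmulA qmul1l qmul1r qmulDl qmulDr qone_neq0.

Fact qscaleA c d x : qscale c (qscale d x) = qscale (c * d) x.
Proof. qring. Qed.
Fact qscale1 : left_id 1 qscale. Proof. case; qring. Qed.
Fact qscaleDr : right_distributive qscale qadd. Proof. qring. Qed.
Fact qscaleDl x : {morph qscale^~ x : c d / c + d >-> qadd c d}. Proof. qring. Qed.
HB.instance Definition _ := GRing.Zmodule_isLmodule.Build k Q
  qscaleA qscale1 qscaleDr qscaleDl.

Fact qscaleAl c x y : qscale c (qmul x y) = qmul (qscale c x) y.
Proof. qring. Qed.
HB.instance Definition _ := GRing.Lmodule_isLalgebra.Build k Q qscaleAl.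
Fact qscaleAr c x y : qscale c (qmul x y) = qmul x (qscale c y).
Proof. qring. Qed.
HB.instance Definition _ := GRing.Lalgebra_isAlgebra.Build k Q qscaleAr.

Definition qconj (x : Q) : Q := Quat a b (qre x) (- qi x) (- qj x) (- qij x).
Definition qtrd (x : Q) : k := qre x + qre x.

Definition qpure (x : Q) := qtrd x = 0.

Definition qinvertible (x : Q) := exists y : Q, x * y = 1 /\ y * x = 1.

End Quaternions.

(* Right Q-modules are left modules over the converse ring Q^c. *)

Notation rmodType Q := (lmodType Q^c).

Section RightModules.
Variables (k : fieldType) (a b : k).
Local Notation Q := (quat a b).

Definition rscale (V : rmodType Q) (v : V) (x : Q) : V := (x : Q^c) *: v.
Local Notation "v *r x" := (rscale v x) (at level 40).

Section Forms.
Variable V : rmodType Q.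

Definition antihermitian (h : V -> V -> Q) :=
  [/\ forall x y z, h (x + y) z = h x z + h y z,
      forall x y z, h x (y + z) = h x y + h x z,
      forall x y s t, h (x *r s) (y *r t) = qconj s * h x y * t &
      forall x y, h y x = - qconj (h x y)].

Definition nondegenerate_form (h : V -> V -> Q) :=
  forall x, (forall y, h x y = 0) -> x = 0.

Definition rbasis r (e : 'I_r -> V) :=
  forall v, exists! m : {ffun 'I_r -> Q}, v = \sum_i e i *r m i.

Definition coords r (e : 'I_r -> V) (v : V) : {ffun 'I_r -> Q} :=
  xget 0 [set m : {ffun 'I_r -> Q} | v = \sum_i e i *r m i].

Record endo := Endo {
  endo_fun :> V -> V;
  endoD : forall x y, endo_fun (x + y) = endo_fun x + endo_fun y;
  endoZ : forall x s, endo_fun (x *r s) = endo_fun x *r s }.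

Lemma endoP (f g : endo) : (forall x, f x = g x) -> f = g.
Proof.
case: f g => [f fD fZ] [g gD gZ] /= /funext fg; move: fD fZ gD gZ.
rewrite fg => *; congr Endo; exact: Prop_irrelevance.
Qed.

HB.instance Definition _ := gen_eqMixin endo.
HB.instance Definition _ := gen_choiceMixin endo.

Fact rscaleDv (u v : V) s : (u + v) *r s = u *r s + v *r s.
Proof. exact: scalerDr. Qed.
Fact rscaleA (v : V) s t : v *r s *r t = v *r (s * t).
Proof. exact: scalerA. Qed.

Definition endo_zero : endo.
Proof.
exists (fun=> 0) => *; first by rewrite addr0.
by rewrite /rscale scaler0.
Defined.
Definition endo_opp (f : endo) : endo.
Proof.
exists (fun x => - f x) => *; first by rewrite endoD opprD.
by rewrite endoZ /rscale scalerN.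
Defined.
Definition endo_add (f g : endo) : endo.
Proof.
exists (fun x => f x + g x) => *; first by rewrite !endoD addrACA.
by rewrite !endoZ rscaleDv.
Defined.
Definition endo_one : endo. Proof. by exists id. Defined.
Definition endo_mul (f g : endo) : endo.
Proof.
by exists (fun x => f (g x)) => *; rewrite ?(endoD, endoZ).
Defined.
Definition endo_scale (c : k) (f : endo) : endo.
Proof.
exists (fun x => f x *r c%:A) => *; first by rewrite endoD rscaleDv.
by rewrite endoZ !rscaleA mulr_algr mulr_algl.
Defined.

Fact endo_addA : associative endo_add.
Proof. by move=> f g l; apply: endoP => x /=; rewrite addrA. Qed.
Fact endo_addC : commutative endo_add.
Proof. by move=> f g; apply: endoP => x /=; rewrite addrC. Qed.
Fact endo_add0 : left_id endo_zero endo_add.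
Proof. by move=> f; apply: endoP => x /=; rewrite add0r. Qed.
Fact endo_addN : left_inverse endo_zero endo_opp endo_add.
Proof. by move=> f; apply: endoP => x /=; rewrite addNr. Qed.
HB.instance Definition _ :=
  GRing.isZmodule.Build endo endo_addA endo_addC endo_add0 endo_addN.

Fact endo_mulA : associative endo_mul. Proof. by move=> *; apply: endoP. Qed.
Fact endo_mul1l : left_id endo_one endo_mul.
Proof. by move=> *; apply: endoP. Qed.
Fact endo_mul1r : right_id endo_one endo_mul.
Proof. by move=> *; apply: endoP. Qed.
Fact endo_mulDl : left_distributive endo_mul +%R.
Proof. by move=> *; apply: endoP. Qed.
Fact endo_mulDr : right_distributive endo_mul +%R.
Proof. by move=> *; apply: endoP => x /=; rewrite endoD. Qed.
HB.instance Definition _ := GRing.Zmodule_isPzRing.Build endo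
  endo_mulA endo_mul1l endo_mul1r endo_mulDl endo_mulDr.

Definition endo_scalar (c : k) : endo := endo_scale c 1.

Fact endo_scalar_zmod_morphism : zmod_morphism endo_scalar.
Proof.
move=> c d; apply: endoP => x /=; rewrite /rscale scalerBl.
exact: (@scalerBl Q^c).
Qed.
Fact endo_scalar_monoid_morphism : monoid_morphism endo_scalar.
Proof.
split=> [|c d]; apply: endoP => x /=; first by rewrite /rscale !scale1r.
by rewrite rscaleA mulr_algl scalerA mulrC.
Qed.
HB.instance Definition _ :=
  GRing.isZmodMorphism.Build k endo endo_scalar endo_scalar_zmod_morphism.
HB.instance Definition _ :=
  GRing.isMonoidMorphism.Build k endo endo_scalar endo_scalar_monoid_morphism.

Fact endo_scalar_central c (f : endo) : endo_scalar c * f = f * endo_scalar c.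
Proof. by apply: endoP => x /=; rewrite endoZ. Qed.

Definition endo_algebra : algebra k := Algebra endo_scalar_central.

(* The reduced trace of End_Q(V), identified with M_r(Q) by means of the
   basis e, is the composition of the matrix trace with Trd_Q. *)
Definition endo_trd r (e : 'I_r -> V) (f : endo) : k :=
  qtrd (\sum_i coords e (f (e i)) i).

Definition adjoint_involution (h : V -> V -> Q) (sigma : endo -> endo) :=
  forall (f : endo) x y, h (f x) y = h x (sigma f y).

End Forms.
End RightModules.

(* The Clifford algebra of an algebra with orthogonal involution (A, sigma)
   in characteristic different from 2 (Jacobson, Tits; see The Book of
   Involutions, 8.B).  It is the quotient of the tensor algebra of the vector
   space A by the two-sided ideal generated by
   - s - Trd_A(s)/2, for s in A such that sigma(s) = s;
   - u - mu(u)/2, for u in A (x) A such that sigma_2(u) = u, where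
     mu is the multiplication map A (x) A -> A and sigma_2 is defined by
     Sand(sigma_2(u))(x) = Sand(u)(sigma(x)), with Sand(a (x) b)(x) = a x b.
   It is constructed here as the algebra with generators c(a), a in A, subject
   to the linearity of c and to these two families of relations: formal
   expressions modulo the smallest congruence containing the algebra axioms
   and the relations. *)

Section Clifford.
Variables (k : fieldType) (A : algebra k) (sigma : A -> A) (trd : A -> k).

Inductive cl_term :=
  | CGen of A | CScal of k
  | CAdd of cl_term & cl_term | CMul of cl_term & cl_term.

Definition csum (s : seq cl_term) := foldr CAdd (CScal 0) s.

Inductive cl_rel : cl_term -> cl_term -> Prop :=
  | crel_refl x : cl_rel x x
  | crel_sym x y : cl_rel x y -> cl_rel y x
  | crel_trans x y z : cl_rel x y -> cl_rel y z -> cl_rel x z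
  | crel_add x x' y y' :
      cl_rel x x' -> cl_rel y y' -> cl_rel (CAdd x y) (CAdd x' y')
  | crel_mul x x' y y' :
      cl_rel x x' -> cl_rel y y' -> cl_rel (CMul x y) (CMul x' y')
  | crel_addA x y z : cl_rel (CAdd x (CAdd y z)) (CAdd (CAdd x y) z)
  | crel_addC x y : cl_rel (CAdd x y) (CAdd y x)
  | crel_add0 x : cl_rel (CAdd (CScal 0) x) x
  | crel_addN x : cl_rel (CAdd (CMul (CScal (- 1)) x) x) (CScal 0)
  | crel_mulA x y z : cl_rel (CMul x (CMul y z)) (CMul (CMul x y) z)
  | crel_mul1 x : cl_rel (CMul (CScal 1) x) x
  | crel_mulDl x y z :
      cl_rel (CMul (CAdd x y) z) (CAdd (CMul x z) (CMul y z))
  | crel_mulDr x y z :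
      cl_rel (CMul x (CAdd y z)) (CAdd (CMul x y) (CMul x z))
  | crel_scalD c d : cl_rel (CScal (c + d)) (CAdd (CScal c) (CScal d))
  | crel_scalM c d : cl_rel (CScal (c * d)) (CMul (CScal c) (CScal d))
  | crel_scalC c x : cl_rel (CMul (CScal c) x) (CMul x (CScal c))
  | crel_genD s t : cl_rel (CGen (s + t)) (CAdd (CGen s) (CGen t))
  | crel_genZ c s : cl_rel (CGen (c%:sc * s)) (CMul (CScal c) (CGen s))
  | crel_J1 s : sigma s = s -> cl_rel (CGen s) (CScal (trd s / 2%:R))
  | crel_J2 (u : seq (A * A)) :
      (forall x, \sum_(st <- u) st.1 * sigma x * st.2
                 = \sum_(st <- u) st.1 * x * st.2) ->
      cl_rel (csum [seq CMul (CGen st.1) (CGen st.2) | st <- u])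
             (CGen (2%:R^-1%:sc * \sum_(st <- u) st.1 * st.2)).

HB.instance Definition _ := gen_eqMixin cl_term.
HB.instance Definition _ := gen_choiceMixin cl_term.

Definition cl_relb (x y : cl_term) : bool := `[< cl_rel x y >].

Fact cl_relb_refl : reflexive cl_relb.
Proof. by move=> x; apply/asboolP; exact: crel_refl. Qed.
Fact cl_relb_sym : symmetric cl_relb.
Proof. by move=> x y; apply/asboolP/asboolP; exact: crel_sym. Qed.
Fact cl_relb_trans : transitive cl_relb.
Proof.
by move=> y x z /asboolP xy /asboolP yz; apply/asboolP; exact: crel_trans yz.
Qed.

Canonical cl_equiv := EquivRel cl_relb cl_relb_refl cl_relb_sym cl_relb_trans.

Definition clifford := {eq_quot cl_equiv}.

HB.instance Definition _ := Choice.on clifford.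
HB.instance Definition _ := EqQuotient.on clifford.

Local Notation cls := (\pi_clifford : cl_term -> clifford).

Lemma clP x y : reflect (cls x = cls y) `[< cl_rel x y >].
Proof. by apply: (iffP idP) => [xy|/eqmodP//]; apply/eqmodP. Qed.

Fact cl_eq x y : cl_rel x y -> cls x = cls y.
Proof. by move=> xy; apply/clP/asboolP. Qed.

Fact cl_repr x : cl_rel (repr (cls x)) x.
Proof. by apply/asboolP/clP; rewrite reprK. Qed.

Definition cl_add (x y : clifford) := cls (CAdd (repr x) (repr y)).
Definition cl_mul (x y : clifford) := cls (CMul (repr x) (repr y)).
Definition cl_opp (x : clifford) := cl_mul (cls (CScal (- 1))) x.

Fact cl_addE x y : cl_add (cls x) (cls y) = cls (CAdd x y).
Proof. by apply: cl_eq; apply: crel_add; exact: cl_repr. Qed.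
Fact cl_mulE x y : cl_mul (cls x) (cls y) = cls (CMul x y).
Proof. by apply: cl_eq; apply: crel_mul; exact: cl_repr. Qed.

Fact cl_ind (P : clifford -> Prop) : (forall x, P (cls x)) -> forall x, P x.
Proof. by move=> Px x; rewrite -[x]reprK. Qed.

Fact cl_addA : associative cl_add.
Proof.
do 3 elim/cl_ind=> ?; rewrite !cl_addE; apply: cl_eq; exact: crel_addA.
Qed.
Fact cl_addC : commutative cl_add.
Proof. do 2 elim/cl_ind=> ?; rewrite !cl_addE; apply: cl_eq; exact: crel_addC.
Qed.
Fact cl_add0 : left_id (cls (CScal 0)) cl_add.
Proof. elim/cl_ind=> ?; rewrite cl_addE; apply: cl_eq; exact: crel_add0. Qed.
Fact cl_addN : left_inverse (cls (CScal 0)) cl_opp cl_add.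
Proof.
elim/cl_ind=> ?; rewrite /cl_opp cl_mulE cl_addE; apply: cl_eq.
exact: crel_addN.
Qed.
HB.instance Definition _ :=
  GRing.isZmodule.Build clifford cl_addA cl_addC cl_add0 cl_addN.

Fact cl_mulA : associative cl_mul.
Proof.
do 3 elim/cl_ind=> ?; rewrite !cl_mulE; apply: cl_eq; exact: crel_mulA.
Qed.
Fact cl_mul1l : left_id (cls (CScal 1)) cl_mul.
Proof. elim/cl_ind=> ?; rewrite cl_mulE; apply: cl_eq; exact: crel_mul1. Qed.
Fact cl_scalC c x : cl_mul (cls (CScal c)) x = cl_mul x (cls (CScal c)).
Proof.
elim/cl_ind: x => ?; rewrite !cl_mulE; apply: cl_eq; exact: crel_scalC.
Qed.
Fact cl_mul1r : right_id (cls (CScal 1)) cl_mul.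
Proof. by move=> x; rewrite -cl_scalC cl_mul1l. Qed.
Fact cl_mulDl : left_distributive cl_mul +%R.
Proof.
do 3 elim/cl_ind=> ?; rewrite /+%R /= !(cl_addE, cl_mulE); apply: cl_eq.
exact: crel_mulDl.
Qed.
Fact cl_mulDr : right_distributive cl_mul +%R.
Proof.
do 3 elim/cl_ind=> ?; rewrite /+%R /= !(cl_addE, cl_mulE); apply: cl_eq.
exact: crel_mulDr.
Qed.
HB.instance Definition _ := GRing.Zmodule_isPzRing.Build clifford
  cl_mulA cl_mul1l cl_mul1r cl_mulDl cl_mulDr.

Definition cl_scalar (c : k) : clifford := cls (CScal c).

Fact cl_scalarD : {morph cl_scalar : c d / c + d}.
Proof.
move=> c d; rewrite {2}/+%R /= cl_addE; apply: cl_eq; exact: crel_scalD.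
Qed.
Fact cl_scalar_zmod_morphism : zmod_morphism cl_scalar.
Proof.
by move=> c d; apply: (addIr (cl_scalar d)); rewrite -cl_scalarD !subrK.
Qed.
Fact cl_scalar_monoid_morphism : monoid_morphism cl_scalar.
Proof.
split=> // c d; rewrite {2}/*%R /= cl_mulE; apply: cl_eq; exact: crel_scalM.
Qed.
HB.instance Definition _ :=
  GRing.isZmodMorphism.Build k clifford cl_scalar cl_scalar_zmod_morphism.
HB.instance Definition _ :=
  GRing.isMonoidMorphism.Build k clifford cl_scalar cl_scalar_monoid_morphism.

Fact cl_scalar_central c (x : clifford) : cl_scalar c * x = x * cl_scalar c.
Proof. exact: cl_scalC. Qed.

Definition clifford_algebra : algebra k := Algebra cl_scalar_central.

(* The canonical k-linear map from A to its Clifford algebra. *)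
Definition cl_gen (s : A) : clifford_algebra := cls (CGen s).

(* The canonical involution is the unique k-linear anti-automorphism which
   satisfies tau (c a) = c (sigma a). *)
Definition clifford_involution
    (tau : clifford_algebra -> clifford_algebra) :=
  [/\ forall x y, tau (x + y) = tau x + tau y,
      forall x y, tau (x * y) = tau y * tau x,
      forall c : k, tau c%:sc = c%:sc,
      forall x, tau (tau x) = x &
      forall s, tau (cl_gen s) = cl_gen (sigma s)].

End Clifford.

(* Subalgebras of a k-algebra B are sets of elements of B. *)

Section Subalgebras.
Variables (k : fieldType) (B : algebra k).
Implicit Types (L M P S Z : set B).

Definition subalgebra L :=
  [/\ forall c : k, L c%:sc,
      forall x y, L x -> L y -> L (x + y) &
      forall x y, L x -> L y -> L (x * y)].

Definition generated_subalgebra S : set B :=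
  [set x | forall L, subalgebra L -> S `<=` L -> L x].

Definition centre : set B := [set x | forall y, x * y = y * x].

Definition kbasis L n (x : 'I_n -> B) :=
  (forall i, L (x i)) /\
  forall y, L y -> exists! c : {ffun 'I_n -> k}, y = \sum_i (c i)%:sc * x i.

Definition has_dim L n := exists x : 'I_n -> B, kbasis L x.

Definition morphism_on L (K : fieldType) (iota : k -> K) (f : B -> K) :=
  [/\ forall c : k, f c%:sc = iota c,
      forall x y, L x -> L y -> f (x + y) = f x + f y &
      forall x y, L x -> L y -> f (x * y) = f x * f y].

(* L is etale if it is commutative, of finite dimension n, and diagonalised by
   some field extension iota : k -> K, i.e. L (x)_k K is isomorphic to K^n: the
   n components f_j of an isomorphism are k-algebra morphisms L -> K, and
   bijectivity is expressed in the K-basis of L (x)_k K given by a k-basis x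
   of L. *)
Definition etale_subalgebra L :=
  [/\ subalgebra L,
      forall x y, L x -> L y -> x * y = y * x &
      exists n (x : 'I_n -> B), kbasis L x /\
        exists (K : fieldType) (iota : {rmorphism k -> K}) (f : 'I_n -> B -> K),
          (forall j, morphism_on L iota (f j)) /\
          \matrix_(i, j) f j (x i) \in unitmx].

Definition prime_ideal Z P :=
  [/\ P `<=` Z, P 0 /\ ~ P 1,
      forall x y, P x -> P y -> P (x + y),
      forall a x, Z a -> P x -> P (a * x) &
      forall a b, Z a -> Z b -> P (a * b) -> P a \/ P b].

(* For a Z-submodule M of B and a prime P of Z, the localisation M_P is free of
   rank n over Z_P.  Fractions are cleared: the elements of a basis may be taken
   in M, and an element y of M is zero in M_P if and only if s y = 0 for some s
   in Z outside of P. *)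
Definition localized_rank Z P M n :=
  exists x : 'I_n -> B,
  [/\ forall i, M (x i),
      forall a : 'I_n -> B, (forall i, Z (a i)) ->
        (exists s, [/\ Z s, ~ P s & s * \sum_i a i * x i = 0]) ->
        forall i, exists s, [/\ Z s, ~ P s & s * a i = 0] &
      forall y, M y -> exists s (a : 'I_n -> B),
        [/\ Z s, ~ P s, forall i, Z (a i) & s * y = \sum_i a i * x i]].

(* The degree d of B_P is determined by rank(B_P) = d^2. *)
Definition strictly_maximal L :=
  centre `<=` L /\
  forall P, prime_ideal centre P -> exists d,
    localized_rank centre P setT (d ^ 2)%N /\ localized_rank centre P L d.

Definition automorphism_on L (f : B -> B) :=
  [/\ set_bij L L f,
      forall c : k, f c%:sc = c%:sc,
      forall x y, L x -> L y -> f (x + y) = f x + f y &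
      forall x y, L x -> L y -> f (x * y) = f x * f y].

(* The finite group G, acting on L through act, makes it a G-Galois algebra. *)
Definition galois_algebra L (G : finGroupType) (act : G -> B -> B) :=
  [/\ forall g, automorphism_on L (act g),
      forall g g' x, L x -> act (g * g')%g x = act g (act g' x),
      forall g, (forall x, L x -> act g x = x) -> g = 1%g,
      has_dim L #|G| &
      [set x | L x /\ forall g, act g x = x] = range (@alg_map k B)].

Definition inverse_of (u v : B) := u * v = 1 /\ v * u = 1.

End Subalgebras.

Arguments centre {k} B.

(* For pure x and y, linear independence implies this if Q is a division
   algebra but not if Q is split: take x with x^2 = 1 and y = x + n with n != 0,
   n^2 = 0 and xn = n = - nx, so that xy = 1 + y - x.  In that case an element u
   with u^2 = Trd(z_p z_q) - 2 xi_p xi_q as in the theorem is not invertible,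
   and conjugation by it only makes sense as u x = x' u. *)
Definition quat_basis (k : fieldType) (a b : k) (x y : quat a b) :=
  forall w, exists! l : k * k * k * k,
    let: (l0, lx, ly, lxy) := l in
    w = l0 *: 1 + lx *: x + ly *: y + lxy *: (x * y).

Definition flip2 r (p q : 'I_r) : 'rV['Z_2]_r :=
  \row_i ((i == p) || (i == q))%:R.

(* Main.v *)
Require Import Defs.
From HB Require Import structures.
From mathcomp Require Import all_boot all_order all_fingroup all_algebra.
From mathcomp Require Import all_field generic_quotient ring.
From mathcomp Require Import boolp classical_sets functions.

Set Implicit Arguments.
Unset Strict Implicit.
Unset Printing Implicit Defensive.

Import GRing.Theory.

Local Open Scope ring_scope.
Local Open Scope classical_set_scope.

(** For a quaternion [s], let [c i j s] be the image in [B] of the endomorphism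
   [x |-> e_i s h(e_j, x)].  If the quaternion algebra is split, [h] amounts to a
   quadratic form on an orthogonal sum of planes [W_i], [B] is its even Clifford
   algebra, and the [c i j s] are the elements of [W_i W_j].  The defining relations
   of [B] take a form which makes sense without splitting ([clifford_symbols],
   [clifford_symbolsP]): apart from linearity, [c i j s] is symmetric up to the
   canonical involution, [c i i] is scalar on pure quaternions, products with a
   common middle index reduce to those with [t = 1], and distinct middle indices
   can be exchanged.

   The elements of the theorem are [xi i = c i i 1], the volume element of [W_i], and
   [u p q = 2 c p q 1], the vector of [W_p W_q] invariant under [SL_2].  Since
   [xi i c i l s = c i l (z_i s)] ([mul_xi_symb]) and [c i l s xi l = c i l (s z_l)],
   the identities on the [u p q] are computations in the quaternion algebra
   ([symb_comm], [symb_sqr], [symb_triple]).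

   The structure of [B] cannot be read off the [u p q], whose squares may be zero
   divisors.  They are replaced by [v j = c 0 j w] for a quaternion [w] such that [z_0]
   and [w z_j (conj w)] span a nondegenerate plane ([gram_twist]); these are
   invertible, normalise [L], have their squares in [L], and commute up to [L]
   ([symb_crossed]).  So their ordered products span [B] over [L] ([crossed_span]);
   they are independent because commutation with the [xi i] tells them apart
   ([separation], [crossed_indep]).  In the same way [L] is free over [k + k xi], and
   this is the centre ([centreP], [centre_span], [centre_indep]).  Both ranks being
   2^(r-1), [L] is strictly maximal.

   There remains to see that [B] is not too small, that is, that the 2^r square-free
   monomials in the [xi i] are linearly independent over [k] ([xi_multiquadratic]).
   Over an extension [K] containing the square roots of [a] and of the [z_i^2], the
   algebra [B] maps to a Clifford algebra over [K] ([clifford_splitting]), which acts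
   on a tensor product of planes ([clifford_model]).  In the latter algebra some
   element anticommutes with the image of [xi i] and commutes with those of the other
   [xi j], and separation applies again ([mon_indep]). *)

(** * Quaternions *)

Section QuaternionLemmas.
Variables (k : fieldType) (a b : k).
Hypotheses (char_k : (2%:R : k) != 0) (a_neq0 : a != 0) (b_neq0 : b != 0).
Local Notation Q := (quat a b).
Implicit Types (x y z s t w : Q).

Lemma quatP x y : qre x = qre y -> qi x = qi y -> qj x = qj y ->
  qij x = qij y -> x = y.
Proof. by case: x y => ? ? ? ? [] ? ? ? ? /= -> -> -> ->. Qed.

Lemma qreD x y : qre (x + y) = qre x + qre y. Proof. by []. Qed.
Lemma qiD x y : qi (x + y) = qi x + qi y. Proof. by []. Qed.
Lemma qjD x y : qj (x + y) = qj x + qj y. Proof. by []. Qed.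
Lemma qijD x y : qij (x + y) = qij x + qij y. Proof. by []. Qed.
Lemma qreN x : qre (- x) = - qre x. Proof. by []. Qed.
Lemma qiN x : qi (- x) = - qi x. Proof. by []. Qed.
Lemma qjN x : qj (- x) = - qj x. Proof. by []. Qed.
Lemma qijN x : qij (- x) = - qij x. Proof. by []. Qed.
Lemma qreZ c x : qre (c *: x) = c * qre x. Proof. by []. Qed.
Lemma qiZ c x : qi (c *: x) = c * qi x. Proof. by []. Qed.
Lemma qjZ c x : qj (c *: x) = c * qj x. Proof. by []. Qed.
Lemma qijZ c x : qij (c *: x) = c * qij x. Proof. by []. Qed.
Lemma qreM x y : qre (x * y) = qre x * qre y + a * (qi x * qi y)
  + b * (qj x * qj y) - a * b * (qij x * qij y).
Proof. by []. Qed.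
Lemma qiM x y : qi (x * y) = qre x * qi y + qi x * qre y
  - b * (qj x * qij y) + b * (qij x * qj y).
Proof. by []. Qed.
Lemma qjM x y : qj (x * y) = qre x * qj y + qj x * qre y
  + a * (qi x * qij y) - a * (qij x * qi y).
Proof. by []. Qed.
Lemma qijM x y : qij (x * y) = qre x * qij y + qij x * qre y
  + qi x * qj y - qj x * qi y.
Proof. by []. Qed.

Definition quat_coordE := (qreD, qiD, qjD, qijD, qreN, qiN, qjN, qijN,
  qreZ, qiZ, qjZ, qijZ, qreM, qiM, qjM, qijM).

Definition qnrd x : k :=
  qre x * qre x - a * (qi x * qi x) - b * (qj x * qj x) + a * b * (qij x * qij x).

Lemma qpure_re x : qpure x -> qre x = 0.
Proof.
rewrite /qpure /qtrd => /eqP; rewrite -mulr2n -mulr_natl mulf_eq0.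
by rewrite (negPf char_k) /= => /eqP.
Qed.

Lemma qpureP x : qre x = 0 -> qpure x.
Proof. by rewrite /qpure /qtrd => ->; rewrite addr0. Qed.

Lemma qconjD x y : qconj (x + y) = qconj x + qconj y.
Proof. by apply: quatP => //=; rewrite ?opprD. Qed.
Lemma qconjN x : qconj (- x) = - qconj x.
Proof. by apply: quatP. Qed.
Lemma qconjK : involutive (@qconj k a b).
Proof. by move=> x; apply: quatP => //=; rewrite opprK. Qed.
Lemma qconjM x y : qconj (x * y) = qconj y * qconj x.
Proof. by apply: quatP => /=; ring. Qed.
Lemma qconj_pure x : qpure x -> qconj x = - x.
Proof. by move=> /qpure_re x0; apply: quatP => //=; rewrite x0 oppr0. Qed.
Lemma qconj0 : qconj (0 : Q) = 0.
Proof. by apply: quatP => //=; rewrite oppr0. Qed.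
Lemma qconj1 : qconj (1 : Q) = 1.
Proof. by apply: quatP => //=; rewrite oppr0. Qed.
Lemma qmul_conj x : x * qconj x = qnrd x *: 1.
Proof. by apply: quatP => /=; rewrite /qnrd; ring. Qed.

Lemma qtrdD x y : qtrd (x + y) = qtrd x + qtrd y.
Proof. by rewrite /qtrd !quat_coordE; ring. Qed.
Lemma qtrdN x : qtrd (- x) = - qtrd x.
Proof. by rewrite /qtrd !quat_coordE; ring. Qed.
Lemma qtrdC x y : qtrd (x * y) = qtrd (y * x).
Proof. by rewrite /qtrd !quat_coordE; ring. Qed.

Lemma qtrd_nondeg x : (forall y, qtrd (x * y) = 0) -> x = 0.
Proof.
pose E0 : Q := Quat a b 1 0 0 0; pose E1 : Q := Quat a b 0 1 0 0.
pose E2 : Q := Quat a b 0 0 1 0; pose E3 : Q := Quat a b 0 0 0 1.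
move=> x0; apply: quatP => /=.
- by apply: qpure_re; rewrite /qpure -[x]mulr1 x0.
- have /qpure_re := x0 E1; rewrite qreM /= !(mulr0, mulr1, add0r, addr0, subr0).
  by move=> /eqP; rewrite mulf_eq0 (negPf a_neq0) => /eqP.
- have /qpure_re := x0 E2; rewrite qreM /= !(mulr0, mulr1, add0r, addr0, subr0).
  by move=> /eqP; rewrite mulf_eq0 (negPf b_neq0) => /eqP.
- have /qpure_re := x0 E3; rewrite qreM /= !(mulr0, mulr1, add0r, addr0, subr0).
  by move=> /eqP; rewrite oppr_eq0 !mulf_eq0 (negPf a_neq0) (negPf b_neq0) => /eqP.
Qed.

Lemma qpure_sqr z : qpure z -> z * z = qre (z * z) *: 1.
Proof.
by move=> /qpure_re z0; apply: quatP; rewrite !quat_coordE /= ?z0; ring.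
Qed.

Lemma qpure_sqr_neq0 z : qpure z -> qinvertible z -> qre (z * z) != 0.
Proof.
move=> zp [y [zy yz]]; apply/eqP => z0.
have zz : z * z = 0 by rewrite qpure_sqr // z0 scale0r.
have : (1 : Q) = 0 by rewrite -yz -[z]mul1r -yz -mulrA zz !mulr0.
by move/eqP; rewrite oner_eq0.
Qed.

(** The weights are such that the sandwich map of the sum of the tensors
   [qweight m (qbase m (x) qbase m)] is the canonical involution. *)
Definition qbase (m : 'I_4) : Q :=
  tnth [tuple Quat a b 1 0 0 0; Quat a b 0 1 0 0;
              Quat a b 0 0 1 0; Quat a b 0 0 0 1] m.
Definition qweight (m : 'I_4) : k :=
  tnth [tuple - 2%:R^-1; (2%:R * a)^-1; (2%:R * b)^-1; - (2%:R * a * b)^-1] m.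

Lemma sum_qbase (U : nmodType) (F : Q -> k -> U) :
  \sum_m F (qbase m) (qweight m) =
  F (Quat a b 1 0 0 0) (- 2%:R^-1) + F (Quat a b 0 1 0 0) (2%:R * a)^-1
  + F (Quat a b 0 0 1 0) (2%:R * b)^-1
  + F (Quat a b 0 0 0 1) (- (2%:R * a * b)^-1).
Proof. by rewrite !big_ord_recr big_ord0 /= add0r. Qed.

Lemma qconj_sandwich q :
  \sum_m qweight m *: (qbase m * q * qbase m) = qconj q.
Proof.
rewrite (sum_qbase (fun x c => c *: (x * q * x))).
by apply: quatP; rewrite !quat_coordE /=; field; rewrite ?char_k ?a_neq0 ?b_neq0.
Qed.

End QuaternionLemmas.

Section PurePairs.
Variables (k : fieldType) (a b : k).
Hypotheses (char_k : (2%:R : k) != 0) (a_neq0 : a != 0) (b_neq0 : b != 0).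
Local Notation Q := (quat a b).
Implicit Types (x y z s t w : Q).

(** This recovers [z] from the commutators [z t - t z]: they generate the unit ideal. *)
Lemma qweight_commutator z : qpure z ->
  \sum_m qweight a b m *: (qbase a b m * (z * qbase a b m - qbase a b m * z))
  = - (2%:R *: z).
Proof.
move=> zp; under eq_bigr do rewrite mulrBr scalerBr !mulrA.
rewrite sumrB (qconj_sandwich char_k a_neq0 b_neq0) qconj_pure //.
have -> : \sum_m qweight a b m *: (qbase a b m * qbase a b m * z)
    = \sum_m qweight a b m *: (qbase a b m * 1 * qbase a b m) * z.
  by apply: eq_bigr => m _; rewrite mulr1 -scalerAl.
rewrite -mulr_suml qconj_sandwich // qconj1 mul1r.
by rewrite -opprD -mulr2n -scaler_nat.
Qed.

Lemma qweight_norm :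
  \sum_m qweight a b m *: (qconj (qbase a b m) * qbase a b m) = - 2%:R *: 1.
Proof.
rewrite (sum_qbase (fun x c => c *: (qconj x * x))).
by apply: quatP; rewrite !quat_coordE /=; field; rewrite ?char_k ?a_neq0 ?b_neq0.
Qed.

Lemma qweight_conj_commutator z : qpure z ->
  \sum_m qweight a b m *:
    (qconj (qbase a b m) * (z * qbase a b m - qbase a b m * z)) = 2%:R *: z.
Proof.
move=> /(qpure_re char_k) z0.
rewrite (sum_qbase (fun x c => c *: (qconj x * (z * x - x * z)))).
apply: quatP; rewrite !quat_coordE /= z0; field;
  by rewrite ?char_k ?a_neq0 ?b_neq0.
Qed.

Definition qcoord s (u : 'I_4) : k := nth 0 [:: qre s; qi s; qj s; qij s] u.

Lemma qcoordE s : s = \sum_u qcoord s u *: qbase a b u.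
Proof.
rewrite !big_ord_recr big_ord0 /= /qcoord /qbase !(tnth_nth 0) /=.
by apply: quatP; rewrite !quat_coordE /=; ring.
Qed.

(** The sandwich map of this tensor is the composition of the canonical involution
   with itself, hence the tensor is [1 (x) 1]. *)
Lemma qweight_double (u v : 'I_4) :
  \sum_m \sum_n qweight a b m * qweight a b n *
    (qcoord (qconj (qbase a b m) * qbase a b n) u
     * qcoord (qbase a b n * qconj (qbase a b m)) v)
  = ((u == ord0) && (v == ord0))%:R.
Proof.
rewrite (sum_qbase (fun x c => \sum_n c * qweight a b n *
   (qcoord (qconj x * qbase a b n) u * qcoord (qbase a b n * qconj x) v))).
rewrite !(sum_qbase (fun x c => _ * c * (qcoord (_ * x) u * qcoord (x * _) v))).
have qmulE (x0 x1 x2 x3 y0 y1 y2 y3 : k) :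
  Quat a b x0 x1 x2 x3 * Quat a b y0 y1 y2 y3 = Quat a b
    (x0 * y0 + a * (x1 * y1) + b * (x2 * y2) - a * b * (x3 * y3))
    (x0 * y1 + x1 * y0 - b * (x2 * y3) + b * (x3 * y2))
    (x0 * y2 + x2 * y0 + a * (x1 * y3) - a * (x3 * y1))
    (x0 * y3 + x3 * y0 + x1 * y2 - x2 * y1) by [].
rewrite /qconj /= !qmulE.
rewrite !(mulr0, mul0r, oppr0, addr0, add0r, subr0, sub0r, mulr1, mul1r).
case: u => [[|[|[|[|//]]]] lu]; case: v => [[|[|[|[|//]]]] lv]; rewrite /qcoord /=;
  rewrite ?(mulr0, mul0r, addr0) //; field; by rewrite ?char_k ?a_neq0 ?b_neq0.
Qed.

(** If [z] and [z'] commute, then [z z'] is a scalar, and so is [z' / z]. *)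
Lemma pure_indep_comm z z' : qpure z -> qinvertible z -> qpure z' ->
  (forall s t : k, s *: z + t *: z' = 0 -> s = 0 /\ t = 0) ->
  z * z' - z' * z != 0.
Proof.
move=> zp zi zp' ind; apply/eqP => zz'.
have z0 := qpure_re char_k zp; have z0' := qpure_re char_k zp'.
have := ind (qre (z * z')) (- qre (z * z)).
case=> [|_ /eqP]; last by rewrite oppr_eq0 (negPf (qpure_sqr_neq0 char_k zp zi)).
have e1 := congr1 (@qi k a b) zz'; have e2 := congr1 (@qj k a b) zz'.
have e3 := congr1 (@qij k a b) zz'; move: e1 e2 e3.
rewrite !quat_coordE z0 z0' /=.
set x1 := qi z; set x2 := qj z; set x3 := qij z.
set y1 := qi z'; set y2 := qj z'; set y3 := qij z' => e1 e2 e3.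
(* Up to nonzero factors, the commutator is the cross product of two vectors of [k^3]. *)
have h1 : x2 * y3 - x3 * y2 = 0.
  apply/eqP; have : - 2%:R * b * (x2 * y3 - x3 * y2) = 0 by rewrite -[RHS]e1; ring.
  by move/eqP; rewrite !mulf_eq0 oppr_eq0 (negPf char_k) (negPf b_neq0).
have h2 : x1 * y3 - x3 * y1 = 0.
  apply/eqP; have : 2%:R * a * (x1 * y3 - x3 * y1) = 0 by rewrite -[RHS]e2; ring.
  by move/eqP; rewrite !mulf_eq0 (negPf char_k) (negPf a_neq0).
have h3 : x1 * y2 - x2 * y1 = 0.
  apply/eqP; have : 2%:R * (x1 * y2 - x2 * y1) = 0 by rewrite -[RHS]e3; ring.
  by move/eqP; rewrite !mulf_eq0 (negPf char_k).
apply: quatP; rewrite !quat_coordE ?z0 ?z0' /= -/x1 -/x2 -/x3 -/y1 -/y2 -/y3.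
- by ring.
- transitivity (b * x2 * (x1 * y2 - x2 * y1) - a * b * x3 * (x1 * y3 - x3 * y1));
    by [ring | rewrite h2 h3; ring].
- transitivity (- a * x1 * (x1 * y2 - x2 * y1) - a * b * x3 * (x2 * y3 - x3 * y2));
    by [ring | rewrite h1 h3; ring].
- transitivity (- a * x1 * (x1 * y3 - x3 * y1) - b * x2 * (x2 * y3 - x3 * y2));
    by [ring | rewrite h1 h2; ring].
Qed.

(** If the Gram determinant vanishes, the commutator [m] of [z] and [z'] is
   orthogonal to 1, z, z' and zz' for the trace form, hence zero; then [2 zz'] is
   a scalar, against the uniqueness of coordinates. *)
Lemma quat_basis_gram z z' : qpure z -> qinvertible z -> qpure z' ->
  quat_basis z z' ->
  qtrd (z * z') ^+ 2 - 4%:R * (qre (z * z) * qre (z' * z')) != 0.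
Proof.
move=> zp zi zp' bas; apply/eqP => gram.
have z0 := qpure_re char_k zp; have z0' := qpure_re char_k zp'.
have d0 := qpure_sqr_neq0 char_k zp zi.
pose m : Q := z * z' - z' * z.
have m0 : m = 0.
  apply: (qtrd_nondeg char_k a_neq0 b_neq0) => y.
  have [[[[l0 l1] l2] l3] [-> _]] := bas y.
  rewrite -[RHS](_ : l3 * (qtrd (z * z') ^+ 2
     - 4%:R * (qre (z * z) * qre (z' * z'))) = 0); last by rewrite gram mulr0.
  by rewrite /m /qtrd !quat_coordE z0 z0' /=; ring.
have [l [_ uniq_l]] := bas (z * z' + z' * z).
have comm : z * z' = z' * z by apply/eqP; rewrite -subr_eq0 -/m m0.
have e1 := uniq_l (qtrd (z * z'), 0, 0, 0).
have e2 := uniq_l (0, 0, 0, 2%:R).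
suff : (qtrd (z * z'), 0, 0, 0) = (0, 0, 0, 2%:R) :> k * k * k * k.
  by case=> _ /esym/eqP; rewrite (negPf char_k).
rewrite -e1 ?e2 //.
  by rewrite !scale0r !add0r -comm scaler_nat mulr2n.
rewrite !scale0r !addr0; apply: quatP; rewrite /qtrd !quat_coordE z0 z0' /=; ring.
Qed.

(** The case [w = 1] settles a nondegenerate plane.  In a degenerate plane,
   [m = zz' - z'z] is isotropic and orthogonal to [z]; a second isotropic vector
   [p] orthogonal to [z] gives a quaternion [w = 1 + p] of norm 1, and [w z' w^-1]
   is orthogonal to [z] as soon as [(p, m) = (z, z')]. *)
Lemma gram_twist z z' : qpure z -> qinvertible z -> qpure z' -> qinvertible z' ->
  (forall s t : k, s *: z + t *: z' = 0 -> s = 0 /\ t = 0) ->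
  exists w, qtrd (z * (w * z' * qconj w)) ^+ 2
     - 4%:R * (qnrd w ^+ 2 * (qre (z * z) * qre (z' * z'))) != 0.
Proof.
move=> zp zi zp' zi' ind.
have z0 := qpure_re char_k zp; have z0' := qpure_re char_k zp'.
have d0 := qpure_sqr_neq0 char_k zp zi.
have d0' := qpure_sqr_neq0 char_k zp' zi'.
have m0 := pure_indep_comm zp zi zp' ind.
have [gram|] := eqVneq (qtrd (z * z') ^+ 2
    - 4%:R * (qre (z * z) * qre (z' * z'))) 0; last first.
  move=> gram; exists 1; rewrite mul1r qconj1 mulr1.
  by rewrite /qnrd /= !(mulr0, mulr1, subr0, addr0) expr1n mul1r.
pose m : Q := z * z' - z' * z.
have [x x0 xm] : exists2 x, qre x = 0 & qre (x * m) != 0.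
  apply: contrapT => xm; case/eqP: m0.
  apply: (qtrd_nondeg char_k a_neq0 b_neq0) => y; rewrite qtrdC /qtrd.
  have re_m : qre m = 0 by rewrite /m !quat_coordE z0 z0' /=; ring.
  suff y0 : qre ((y - qre y *: 1) * m) = 0.
    move: y0; rewrite mulrBl qreD qreN -scalerAl mul1r qreZ re_m mulr0 subr0.
    by rewrite -/m => ->; rewrite addr0.
  apply/eqP; apply: contrapT => /negP y0; apply: xm; exists (y - qre y *: 1) => //.
  by rewrite !quat_coordE /=; ring.
pose d := qre (z * z); pose mu := qre (x * m).
(* [p1] is the projection of [x] orthogonally to [z], [p2] is isotropic in [p1 + k m]. *)
pose p1 : Q := x - (qre (x * z) / d) *: z.
pose p2 : Q := p1 - (qre (p1 * p1) / (2%:R * mu)) *: m.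
pose p : Q := (qre (z * z') / mu) *: p2.
have m_re : qre m = 0 by rewrite /m !quat_coordE z0 z0' /=; ring.
have mz : qre (m * z) = 0 by rewrite /m !quat_coordE z0 z0' /=; ring.
have mm : qre (m * m) = 0.
  transitivity (qtrd (z * z') ^+ 2 - 4%:R * (qre (z * z) * qre (z' * z'))) => //.
  by rewrite /m /qtrd !quat_coordE z0 z0' /=; ring.
have reC (u v : Q) : qre (u * v) = qre (v * u) by rewrite !quat_coordE; ring.
have p1m : qre (p1 * m) = mu.
  by rewrite /p1 mulrBl qreD qreN -scalerAl qreZ (reC z) mz mulr0 subr0.
have p1z : qre (p1 * z) = 0.
  by rewrite /p1 mulrBl qreD qreN -scalerAl qreZ -/d divfK ?subrr.
have p2z : qre (p2 * z) = 0.
  by rewrite /p2 mulrBl qreD qreN -scalerAl qreZ mz mulr0 p1z subrr.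
have p2m : qre (p2 * m) = mu.
  by rewrite /p2 mulrBl qreD qreN -scalerAl qreZ mm mulr0 subr0.
have p2p2 : qre (p2 * p2) = 0.
  rewrite {2}/p2 mulrBr qreD qreN -scalerAr qreZ p2m /p2 mulrBl qreD qreN.
  rewrite -scalerAl qreZ (reC m) p1m.
  by field; rewrite char_k xm.
have p_re : qre p = 0.
  by rewrite /p qreZ /p2 qreD qreN qreZ m_re /p1 qreD qreN qreZ x0 z0; ring.
have pz : qre (p * z) = 0 by rewrite /p -scalerAl qreZ p2z mulr0.
have pp : qre (p * p) = 0 by rewrite /p -scalerAl -scalerAr !qreZ p2p2 !mulr0.
have pm : qre (p * m) = qre (z * z').
  by rewrite /p -scalerAl qreZ p2m divfK.
clearbody p; clear p1 p2 p1m p1z p2z p2m p2p2; exists (1 + p).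
have -> : qnrd (1 + p) = 1.
  rewrite -[RHS]subr0 -[in RHS]pp /qnrd !quat_coordE p_re /=; ring.
have -> : qtrd (z * ((1 + p) * z' * qconj (1 + p)))
    = 2%:R * ((1 + qre (p * p)) * qre (z * z') - qre (p * m)
        - 2%:R * (qre (p * z') * qre (p * z))).
  by rewrite /m /qtrd /= p_re z0 z0'; ring.
rewrite pp pz pm.
have -> : 2%:R * ((1 + 0) * qre (z * z') - qre (z * z')
                   - 2%:R * (qre (p * z') * 0)) = 0 by ring.
rewrite expr0n /= expr1n mul1r sub0r oppr_eq0.
by rewrite [4%:R](natrM k 2 2) !mulf_neq0.
Qed.

End PurePairs.

(** * Algebras *)

Section AlgebraLemmas.
Variables (k : fieldType) (B : algebra k).
Hypothesis char_k : (2%:R : k) != 0.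
Implicit Types (x y : B) (c : k) (L S M : set B).

Lemma mulr_scC x c : x * c%:sc = c%:sc * x.
Proof. by rewrite alg_central. Qed.

Lemma mulr_scCA x c y : x * (c%:sc * y) = c%:sc * (x * y).
Proof. by rewrite !mulrA mulr_scC. Qed.

Lemma scA c c' x : c%:sc * (c'%:sc * x) = (c * c')%:sc * x.
Proof. by rewrite mulrA -rmorphM. Qed.

Lemma sc_inj c x y : c != 0 -> c%:sc * x = c%:sc * y -> x = y.
Proof.
move=> c0 e; have := congr1 (fun u => (c^-1)%:sc * u) e.
by rewrite !scA mulVf // rmorph1 !mul1r.
Qed.

Lemma alg_double_eq0 x : x + x = 0 -> x = 0.
Proof.
move=> xx; apply: (sc_inj char_k); rewrite mulr0 -xx.
by rewrite rmorph_nat mulr_natl mulr2n.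
Qed.

Lemma eq_opp0 x : x = - x -> x = 0.
Proof. by move=> xN; apply: alg_double_eq0; rewrite {1}xN addNr. Qed.

Lemma scN1 x : (-1)%:sc * x = - x.
Proof. by rewrite rmorphN1 mulN1r. Qed.

Lemma quadratic_unit (X : B) (D t m : k) : X * X = D%:sc -> t ^+ 2 - m ^+ 2 * D != 0 ->
  (t%:sc - m%:sc * X) * (((t ^+ 2 - m ^+ 2 * D)^-1)%:sc * (t%:sc + m%:sc * X)) = 1.
Proof.
move=> XX N0; rewrite mulr_scCA.
have -> : (t%:sc - m%:sc * X) * (t%:sc + m%:sc * X) = (t ^+ 2 - m ^+ 2 * D)%:sc.
  rewrite mulrBl !mulrDr (mulr_scC (m%:sc * X) t) opprD addrA addrK.
  rewrite -[m%:sc * X * _]mulrA mulr_scCA XX -!rmorphM -rmorphB.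
  by congr (alg_map B _); ring.
by rewrite -rmorphM mulVf // rmorph1.
Qed.

Lemma sub_generated S : S `<=` generated_subalgebra S.
Proof. by move=> x Sx M _ SM; exact: SM. Qed.

Lemma generated_is_subalgebra S : subalgebra (generated_subalgebra S).
Proof.
split=> [c M [sc _ _] _|x y xS yS M MP SM|x y xS yS M MP SM]; first exact: sc.
  by have [_ add _] := MP; apply: add; [exact: xS | exact: yS].
by have [_ _ mul] := MP; apply: mul; [exact: xS | exact: yS].
Qed.

Section Closure.
Variable L : set B.
Hypothesis L_alg : subalgebra L.

Lemma subalg_sc c : L c%:sc. Proof. by have [] := L_alg. Qed.
Lemma subalgD x y : L x -> L y -> L (x + y).
Proof. by have [_ + _] := L_alg; apply. Qed.
Lemma subalgM x y : L x -> L y -> L (x * y).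
Proof. by have [_ _] := L_alg; apply. Qed.
Lemma subalg1 : L 1. Proof. by rewrite -(rmorph1 (@alg_map k B)); exact: subalg_sc. Qed.
Lemma subalg0 : L 0. Proof. by rewrite -(rmorph0 (@alg_map k B)); exact: subalg_sc. Qed.
Lemma subalgN x : L x -> L (- x).
Proof. by move=> Lx; rewrite -scN1; apply: subalgM => //; exact: subalg_sc. Qed.
Lemma subalgB x y : L x -> L y -> L (x - y).
Proof. by move=> Lx Ly; apply: subalgD => //; exact: subalgN. Qed.
Lemma subalg_sum I (s : seq I) (P : pred I) (F : I -> B) :
  (forall i, P i -> L (F i)) -> L (\sum_(i <- s | P i) F i).
Proof. by move=> LF; elim/big_ind: _ => //; [exact: subalg0 | exact: subalgD]. Qed.
Lemma subalg_prod I (s : seq I) (P : pred I) (F : I -> B) :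
  (forall i, P i -> L (F i)) -> L (\prod_(i <- s | P i) F i).
Proof. by move=> LF; elim/big_ind: _ => //; [exact: subalg1 | exact: subalgM]. Qed.
End Closure.

Lemma comm_subalgebra y : subalgebra [set x | GRing.comm y x].
Proof.
split=> [c|x x'|x x'] /=; first by rewrite /GRing.comm alg_central.
- exact: commrD.
- exact: commrM.
Qed.

End AlgebraLemmas.

(** * Consequences of the defining relations *)

(** The relations between the elements [c i j s] of the Clifford algebra which
   are the images of the endomorphisms [x |-> e_i s h(e_j, x)]. *)
Record clifford_symbols (k : fieldType) (a b : k) r (z : 'I_r -> quat a b)
    (B : algebra k) (c : 'I_r -> 'I_r -> quat a b -> B) : Prop := CliffordSymbols {
  symbD : forall i j s t, c i j (s + t) = c i j s + c i j t;
  symbZ : forall i j l s, c i j (l *: s) = l%:sc * c i j s;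
  symbC : forall i j s, i != j -> c i j s = c j i (qconj s);
  symb_pure : forall i s, qpure s -> c i i s = (qre (s * z i))%:sc;
  symb_mid : forall i j l s t, c i j s * c j l t =
    c i j (s * t) * c j l 1 + (2%:R^-1)%:sc * c i l (s * (z j * t - t * z j));
  symb_swap : forall i j j' l s t, j != j' -> c i j s * c j' l t =
    \sum_m (qweight a b m)%:sc * (c i j' (s * qbase a b m) * c j l (qbase a b m * t));
  symb_gen : forall M, subalgebra M -> (forall i j s, M (c i j s)) -> forall x, M x }.

Section Symbols.
Variables (k : fieldType) (a b : k).
Hypotheses (char_k : (2%:R : k) != 0) (a_neq0 : a != 0) (b_neq0 : b != 0).
Local Notation Q := (quat a b).
Variables (r : nat) (z : 'I_r -> Q).
Hypotheses (z_pure : forall i, qpure (z i)) (z_inv : forall i, qinvertible (z i)).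
Variables (B : algebra k) (c : 'I_r -> 'I_r -> Q -> B).
Hypothesis c_symb : clifford_symbols z c.
Implicit Types (i j l p q : 'I_r) (s t w : Q).

Local Notation cD := (symbD c_symb).
Local Notation cZ := (symbZ c_symb).
Local Notation cC := (symbC c_symb).
Local Notation cmid := (symb_mid c_symb).
Local Notation cswap := (symb_swap c_symb).
Local Notation E := (qbase a b).
Local Notation kap := (qweight a b).

Local Notation d i := (qre (z i * z i)).
Local Notation xi i := (c i i 1).
Local Notation half := (2%:R^-1 : k).

Let z_re i : qre (z i) = 0. Proof. exact: qpure_re. Qed.
Let d_neq0 i : d i != 0. Proof. exact: qpure_sqr_neq0. Qed.
Let z_sqr i : z i * z i = d i *: 1. Proof. exact: qpure_sqr. Qed.

Lemma symb0 i j : c i j 0 = 0.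
Proof. by rewrite -[0 in LHS](scale0r 0) cZ rmorph0 mul0r. Qed.
Lemma symbN i j s : c i j (- s) = - c i j s.
Proof. by rewrite -scaleN1r cZ scN1. Qed.
Lemma symbB i j s t : c i j (s - t) = c i j s - c i j t.
Proof. by rewrite cD symbN. Qed.
Lemma symb_sum i j I (u : seq I) (F : I -> Q) :
  c i j (\sum_(m <- u) F m) = \sum_(m <- u) c i j (F m).
Proof. exact: (big_morph _ (cD i j) (symb0 i j)). Qed.

Lemma symb_diag i s :
  c i i s = (qre s)%:sc * xi i + (qre (s * z i))%:sc.
Proof.
rewrite -{1}[s](subrK (qre s *: 1)) cD (symb_pure c_symb); last first.
  by apply: qpureP; rewrite !quat_coordE /=; ring.
rewrite cZ addrC; congr (_ + alg_map _ _).
by rewrite mulrBl -scalerAl mul1r qreD qreN qreZ z_re mulr0 subr0.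
Qed.

Lemma symb_mulzz i l j s : c i l (s * (z j * z j)) = (d j)%:sc * c i l s.
Proof. by rewrite -cZ {1}z_sqr -scalerAr mulr1. Qed.

(** Take [s = t = z i] in [symb_mid]: the left side is the square of the scalar
   [c i i (z i) = d i], the right side is [d i] times the square of [xi i]. *)
Lemma xi_sqr i : xi i * xi i = (d i)%:sc.
Proof.
have := cmid i i i (z i) (z i).
rewrite subrr mulr0 symb0 mulr0 addr0 symb_diag z_re rmorph0 mul0r add0r.
by rewrite -[X in c i i X * _]mul1r symb_mulzz -mulrA => /(sc_inj (d_neq0 i)).
Qed.

(** [symb_mid] reduces the general case to [s = 1], which follows from
   [symb_mid] for [t = z i], multiplied by [xi i]. *)
Lemma mul_xi_symb i l s : xi i * c i l s = c i l (z i * s).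
Proof.
have xi1 : xi i * c i l 1 = c i l (z i).
  have /(congr1 (fun u => xi i * u)) := cmid i i l 1 (z i).
  rewrite mul1r subrr mulr0 symb0 mulr0 addr0.
  rewrite [c i i (z i)]symb_diag z_re rmorph0 mul0r add0r mulrA xi_sqr mulr_scCA.
  by move/(sc_inj (d_neq0 i)).
rewrite cmid !mul1r symb_diag mulrDl -mulrA xi1 -!cZ -!cD; congr c.
by apply: quatP; rewrite !quat_coordE /= z_re; field.
Qed.

Lemma symb_mul_xi i l s : c i l s * xi l = c i l (s * z l).
Proof.
have := cmid i l l (s * z l) (z l).
rewrite subrr mulr0 symb0 mulr0 addr0 symb_diag z_re rmorph0 mul0r add0r.
rewrite mulr_scC -mulrA symb_mulzz -mulrA.
by move/(sc_inj (d_neq0 l)).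
Qed.

Lemma xi_symb_anticommr i l s : i != l -> xi l * c i l s = - (c i l s * xi l).
Proof.
move=> il; rewrite symb_mul_xi [c i l s]cC // mul_xi_symb cC 1?eq_sym //.
by rewrite qconjM qconjK qconj_pure // mulrN symbN.
Qed.

Lemma xi_symb_anticomml i l s : i != l -> xi i * c i l s = - (c i l s * xi i).
Proof. by move=> il; rewrite [c i l s]cC // xi_symb_anticommr // eq_sym. Qed.

(** As the commutators with [z j] generate the unit ideal, [symb_mid] expresses every
   symbol [c i l] by products through an arbitrary index [j]. *)
Lemma symb_via i j l s : c i l (s * z j) = \sum_m (kap m)%:sc *
  (c i j (s * E m * E m) * c j l 1 - c i j (s * E m) * c j l (E m)).
Proof.
have cc m : c i j (s * E m * E m) * c j l 1 - c i j (s * E m) * c j l (E m)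
    = - (half%:sc * c i l (s * (E m * (z j * E m - E m * z j)))).
  by rewrite [X in _ - X]cmid opprD addrA subrr add0r !mulrA.
under eq_bigr do rewrite cc mulrN mulr_scCA -cZ scalerAr.
rewrite sumrN -mulr_sumr -symb_sum -mulr_sumr qweight_commutator //.
by rewrite mulrN symbN mulrN opprK -scalerAr cZ scA mulVf // rmorph1 mul1r.
Qed.

Lemma symb_ind i j l (M : set B) : subalgebra M ->
  (forall s t, M (c i j s * c j l t)) -> forall s, M (c i l s).
Proof.
move=> M_alg Mc s.
have -> : c i l s = c i l ((d j)^-1 *: s * z j * z j).
  by rewrite -(mulrA _ (z j) (z j)) symb_mulzz cZ scA mulfV // rmorph1 mul1r.
rewrite symb_via; apply: subalg_sum => // m _; apply: subalgM => //.
  exact: subalg_sc.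
exact: subalgB.
Qed.

(** [c i l s] is a combination of products [c i j _ * c j l _], whose factors both
   anticommute with [xi j]. *)
Lemma xi_symb_comm i j l s : i != j -> j != l -> xi j * c i l s = c i l s * xi j.
Proof.
move=> ij jl; move: s; apply: (symb_ind (j := j) (comm_subalgebra (xi j))).
move=> s t /=; rewrite /GRing.comm mulrA xi_symb_anticommr // mulNr -mulrA.
by rewrite xi_symb_anticomml // mulrN opprK mulrA.
Qed.

Lemma xi_comm i j : xi i * xi j = xi j * xi i.
Proof.
have [->//|ij] := eqVneq i j.
by rewrite xi_symb_comm // eq_sym.
Qed.

Lemma symb_qi i : c i i (Quat a b 0 1 0 0) = (a * qi (z i))%:sc.
Proof. by rewrite symb_diag rmorph0 mul0r add0r qreM /= z_re; congr (alg_map B _); ring. Qed.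
Lemma symb_qj i : c i i (Quat a b 0 0 1 0) = (b * qj (z i))%:sc.
Proof. by rewrite symb_diag rmorph0 mul0r add0r qreM /= z_re; congr (alg_map B _); ring. Qed.
Lemma symb_qij i : c i i (Quat a b 0 0 0 1) = (- (a * b * qij (z i)))%:sc.
Proof. by rewrite symb_diag rmorph0 mul0r add0r qreM /= z_re; congr (alg_map B _); ring. Qed.

Lemma symb_sqr i j : i != j ->
  c i j 1 * c i j 1
  = (2%:R^-1 * qre (z i * z j))%:sc - (2%:R^-1)%:sc * (xi i * xi j).
Proof.
move=> ij; rewrite cswap 1?eq_sym //.
under eq_bigr do rewrite mul1r mulr1.
rewrite (sum_qbase (fun x e => e%:sc * (c i i x * c j j x))).
rewrite !symb_qi !symb_qj !symb_qij rmorphN mulNr -!addrA addrC; congr (_ - _).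
rewrite -!rmorphM -!rmorphD; congr (alg_map B _); rewrite qreM !z_re /=; field.
by rewrite char_k a_neq0 b_neq0.
Qed.

(** The exchange of the middle indices in [xi i * c p q 1] leads to products
   [c p i _ * c i q _], which [symb_mid] reduces to [c p i 1 * c i q 1]. *)
Lemma symb_triple i p q : i != p -> i != q -> p != q ->
  2%:R * (c i p 1 * c i q 1) = c p q (z i) - xi i * c p q 1.
Proof.
move=> ip iq pq; rewrite [xi i * c p q 1]cswap //.
under eq_bigr do rewrite mul1r mulr1 [c i p _]cC // cmid mulrDr scA.
rewrite big_split /=.
have -> : \sum_m (kap m)%:sc * (c p i (qconj (E m) * E m) * c i q 1)
    = (- 2%:R) * (c i p 1 * c i q 1).
  under eq_bigr do rewrite mulrA -cZ.
  rewrite -mulr_suml -symb_sum qweight_norm // cZ rmorphN rmorph_nat.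
  by rewrite [c i p 1]cC // qconj1 mulrA.
have -> : \sum_m (kap m / 2%:R)%:sc *
      c p q (qconj (E m) * (z i * E m - E m * z i)) = c p q (z i).
  under eq_bigr do rewrite mulrC -scA -cZ.
  rewrite -mulr_sumr -symb_sum qweight_conj_commutator // cZ scA.
  by rewrite mulVf // rmorph1 mul1r.
by rewrite opprD addrCA subrr addr0 mulNr opprK.
Qed.

Lemma symb_coord p q s :
  c p q s = \sum_(u < 4) (qcoord s u)%:sc * c p q (E u).
Proof. by under eq_bigr do rewrite -cZ; rewrite -symb_sum -qcoordE. Qed.

(** Exchanging the middle indices, reversing both symbols and exchanging again
   leads from [c i j * c p q] to [c i p * c j q], [c p i * c q j] and [c p q * c i j]. *)
Lemma symb_comm i j p q : i != j -> p != q ->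
  i != p -> i != q -> j != p -> j != q ->
  c i j 1 * c p q 1 = c p q 1 * c i j 1.
Proof.
move=> ij pq ip iq jp jq.
transitivity (\sum_m \sum_n \sum_u \sum_v (kap m * kap n *
  (qcoord (qconj (E m) * E n) u * qcoord (E n * qconj (E m)) v))%:sc
  * (c p q (E u) * c i j (E v))).
  rewrite cswap //; apply: eq_bigr => m _.
  rewrite mul1r mulr1 [c i p _]cC // [c j q _]cC // cswap //.
  rewrite mulr_sumr; apply: eq_bigr => n _.
  rewrite scA [c p q _]symb_coord mulr_suml mulr_sumr; apply: eq_bigr => u _.
  rewrite [c i j _]symb_coord !mulr_sumr; apply: eq_bigr => v _.
  rewrite -[(_%:sc * c p q _) * _]mulrA [c p q _ * _]mulr_scCA !scA.
  by congr (alg_map B _ * _); ring.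
under eq_bigr do rewrite exchange_big /=.
rewrite exchange_big /=.
under eq_bigr do under eq_bigr do rewrite exchange_big /=.
under eq_bigr do rewrite exchange_big /=.
have e u v : \sum_m \sum_n (kap m * kap n *
  (qcoord (qconj (E m) * E n) u * qcoord (E n * qconj (E m)) v))%:sc
  * (c p q (E u) * c i j (E v)) =
  ((u == ord0) && (v == ord0))%:R * (c p q (E u) * c i j (E v)).
  under eq_bigr do rewrite -mulr_suml -rmorph_sum.
  by rewrite -mulr_suml -rmorph_sum qweight_double // rmorph_nat.
under eq_bigr do under eq_bigr do rewrite e.
rewrite (bigD1 ord0) //= (bigD1 ord0) //= mul1r !big1 ?addr0 //.
  move=> u /negPf u0; apply: big1 => v _; by rewrite u0 mul0r.
by move=> v /negPf v0; rewrite v0 mul0r.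
Qed.

(** The exchange of the middle indices leads to products [c i i _ * c j j _]. *)
Lemma symb_mul_same (L : set B) i j s t : subalgebra L ->
  (forall l, L (xi l)) -> i != j -> L (c i j s * c i j t).
Proof.
move=> L_alg L_xi ij; rewrite cswap 1?eq_sym //; apply: subalg_sum => // m _.
have Lc l w : L (c l l w).
  rewrite symb_diag; apply: subalgD => //; last exact: subalg_sc.
  by apply: subalgM => //; exact: subalg_sc.
apply: subalgM => //; first exact: subalg_sc.
by apply: subalgM.
Qed.

(** This is [symb_sqr] for [e_j (conj w)] instead of [e_j]: the form takes the value
   [w (z j) (conj w)] there, and [c i j w] takes the place of [c i j 1]. *)
Lemma symb_sqr_twist i j w : i != j -> c i j w * c i j w =
  (2%:R^-1)%:sc *
    ((qre (z i * (w * z j * qconj w)))%:sc - (qnrd w)%:sc * (xi i * xi j)).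
Proof.
move=> ij; rewrite {2}[c i j w]cC // cmid qmul_conj cZ -mulrA.
rewrite [c j i 1]cC 1?eq_sym // qconj1 symb_sqr //.
rewrite (_ : w * (z j * qconj w - qconj w * z j)
  = w * z j * qconj w - qnrd w *: z j); last first.
  by rewrite mulrBr !mulrA qmul_conj -scalerAl mul1r.
rewrite symbB cZ [c i i (_ * _)]symb_diag [c i i (z j)]symb_diag.
have -> : qre (w * z j * qconj w) = 0 by rewrite !qreM /= z_re; ring.
rewrite z_re !(rmorph0, mul0r, add0r) ![_%:sc * (_ - _)]mulrBr !scA -!rmorphM.
rewrite addrAC (mulrC half (qnrd w)); congr (_ - _).
rewrite -rmorphB -rmorphD; congr (alg_map B _).
by rewrite !qreM /= !z_re; ring.
Qed.

(** [c l i t] is reversed before the middle indices are exchanged. *)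
Lemma symb_exchange (M : set B) i j l s t : i != j -> l != j -> l != i ->
  (forall x y, M x -> M y -> M (x + y)) -> M 0 ->
  (forall u x, M x -> M (u%:sc * x)) ->
  (forall s t, M (c l i s * c l j t)) -> M (c l j s * c l i t).
Proof.
move=> ij lj li MD M0 MZ Mc; rewrite [c l i t]cC // cswap 1?eq_sym //.
elim/big_ind: _ => // m _; apply: MZ; rewrite [c j l _]cC 1?eq_sym //.
Qed.

Lemma symb_gen_star l (M : set B) : subalgebra M ->
  (forall i, M (xi i)) -> (forall j s, j != l -> M (c l j s)) -> forall x, M x.
Proof.
move=> M_alg M_xi M_c; apply: (symb_gen c_symb) => // i j s.
have M_lj t q : M (c l q t).
  have [->|ql] := eqVneq q l; last exact: M_c.
  rewrite symb_diag; apply: subalgD => //; last exact: subalg_sc.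
  by apply: subalgM => //; exact: subalg_sc.
have [->//|il] := eqVneq i l.
apply: (symb_ind (j := l)) => // t t'; apply: subalgM => //.
by rewrite cC.
Qed.

End Symbols.

(** * Square-free monomials and separation of gradings *)

Definition toggle (I : finType) (i : I) (S : {set I}) : {set I} :=
  if i \in S then S :\ i else i |: S.

Lemma mem_toggle (I : finType) (i j : I) (S : {set I}) :
  (j \in toggle i S) = (j \in S) (+) (j == i).
Proof.
rewrite /toggle; case: ifP => iS; rewrite !inE.
  by have [->|] := eqVneq j i; rewrite ?iS ?addbF.
by have [->|] := eqVneq j i; rewrite ?iS ?addbF.
Qed.

Lemma toggleK (I : finType) (i : I) : involutive (toggle i).
Proof. by move=> S; apply/setP => j; rewrite !mem_toggle -addbA addbb addbF. Qed.

Definition mon (R : pzRingType) (I : finType) (y : I -> R) (S : {set I}) : R :=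
  \prod_i (if i \in S then y i else 1).

Section Monomials.
Variables (R : pzRingType) (I : finType) (y : I -> R).

Lemma mon0 : mon y finset.set0 = 1.
Proof. by rewrite /mon big1 // => i _; rewrite inE. Qed.

Let monseq (s : seq I) (S : {set I}) := \prod_(i <- s) (if i \in S then y i else 1).

Let monseq_toggle s i S : i \notin s -> monseq s (toggle i S) = monseq s S.
Proof.
move=> is_; apply: eq_big_seq => j js; rewrite mem_toggle.
by rewrite (_ : (j == i) = false) ?addbF //; apply: contraNF is_ => /eqP <-.
Qed.

Lemma mul_mon_sqr (q : I -> R) i S :
  (forall j, y i * y j = y j * y i) -> (forall j, q i * y j = y j * q i) ->
  y i * y i = q i ->
  y i * mon y S = (if i \in S then q i else 1) * mon y (toggle i S).
Proof.
move=> yC qC yq; rewrite /mon.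
have : uniq (index_enum I) by exact: index_enum_uniq.
have : i \in index_enum I by rewrite mem_index_enum.
elim: (index_enum I) => //= x s IHs; rewrite inE => + /andP[xs us].
have [ix|ix /= is_] := eqVneq i x; rewrite !big_cons.
  rewrite -{}ix in xs * => _; rewrite mulrA (_ : \prod_(j <- s) _ = monseq s S) // -(monseq_toggle S xs).
  by rewrite mem_toggle eqxx addbT; case: ifP => _ /=; rewrite ?mulr1 ?yq ?mul1r.
rewrite mulrA mem_toggle eq_sym (negPf ix) addbF.
have -> u : y i * (if u then y x else 1) = (if u then y x else 1) * y i.
  by case: u; rewrite ?yC ?mulr1 ?mul1r.
rewrite -mulrA IHs // !mulrA; congr (_ * _).
by case: ifP; case: ifP => // _ _; rewrite ?mul1r ?mulr1 ?qC.
Qed.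

(** [y i] moves past the preceding factors at the cost of coefficients, which in turn
   move to the left. *)
Lemma mul_mon_coef (L : set R) i S : L 1 ->
  (forall l l', L l -> L l' -> L (l * l')) ->
  (forall j l, L l -> exists2 l', L l' & y j * l = l' * y j) ->
  L (y i * y i) ->
  (forall j, j != i -> exists2 l, L l & y i * y j = l * (y j * y i)) ->
  exists2 l, L l & y i * mon y S = l * mon y (toggle i S).
Proof.
move=> L1 LM Ly yi yij; rewrite /mon.
have : uniq (index_enum I) by exact: index_enum_uniq.
have : i \in index_enum I by rewrite mem_index_enum.
elim: (index_enum I) => //= x s IHs; rewrite inE => + /andP[xs us].
have [ix|ix /= is_] := eqVneq i x; rewrite !big_cons.
  rewrite -{}ix in xs * => _; rewrite mulrA (_ : \prod_(j <- s) _ = monseq s S) // -(monseq_toggle S xs).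
  rewrite mem_toggle eqxx addbT.
  case: ifP => _ /=; [exists (y i * y i) => // | exists 1 => //]; rewrite ?mul1r ?mulr1 //.
rewrite mem_toggle eq_sym (negPf ix) addbF; have [l Ll e] := IHs is_ us.
case: ifP => _; last by exists l; rewrite // !mul1r.
have xi : x != i by rewrite eq_sym.
have [l1 Ll1 e1] := yij x xi.
have [l2 Ll2 e2] := Ly x l Ll.
exists (l1 * l2); first exact: LM.
by rewrite mulrA e1 -!mulrA e (mulrA _ l) e2 !mulrA.
Qed.

(** Commutation with [s i] up to sign shows that in a vanishing sum the terms with
   [i \in S] and those with [i \notin S] have sum zero separately; doing this for
   every [i] isolates each term. *)
Lemma separation (s : I -> R) (x : {set I} -> R) :
  (forall u : R, u + u = 0 -> u = 0) ->
  (forall i u, u * s i = 0 -> u = 0) ->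
  (forall i S, s i * x S = (-1) ^+ (i \in S) * (x S * s i)) ->
  \sum_S x S = 0 -> forall S, x S = 0.
Proof.
move=> two_reg s_reg sx sum0 S.
suff sep (t : seq I) : \sum_(T : {set I} | all (fun i => (i \in T) == (i \in S)) t) x T = 0.
  rewrite -(sep (index_enum I)) (bigD1 S) /=; last by apply/allP.
  rewrite big1 ?addr0 // => T /andP[/allP TS /negP[]].
  by apply/eqP/setP => i; apply/eqP/TS; rewrite mem_index_enum.
elim: t => [|i t IHt] //=.
pose P (T : {set I}) := all (fun j => (j \in T) == (j \in S)) t.
rewrite -/(P _) in IHt *.
move: (IHt); rewrite (bigID (fun T : {set I} => (i \in T) == (i \in S))) /=.
set X := \sum_(T | _ && _) _; set Y := \sum_(T | _ && ~~ _) _ => XY.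
have -> : \sum_(T : {set I} | ((i \in T) == (i \in S)) && P T) x T = X.
  by apply: eq_bigl => T; rewrite andbC.
have eX : s i * X = (-1) ^+ (i \in S) * (X * s i).
  rewrite mulr_sumr mulr_suml mulr_sumr; apply: eq_bigr => T /andP[_ /eqP <-].
  exact: sx.
have eY : s i * Y = - ((-1) ^+ (i \in S) * (Y * s i)).
  rewrite mulr_sumr mulr_suml mulr_sumr -sumrN; apply: eq_bigr => T /andP[_ e].
  rewrite sx; have -> : (i \in T) = ~~ (i \in S) by case: (i \in T) (i \in S) e => [] [].
  by case: (i \in S); rewrite /= ?expr0 ?expr1 ?mulN1r ?mul1r ?opprK.
have : s i * (X + Y) = 0 by rewrite XY mulr0.
rewrite mulrDr eX eY -mulrBr -mulrBl => /(congr1 (fun u => (-1) ^+ (i \in S) * u)).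
rewrite !mulrA mulr0 -expr2 sqrr_sign mul1r => /s_reg /eqP; rewrite subr_eq0 => /eqP e.
by move: XY; rewrite -e => /two_reg.
Qed.

Lemma sign_mon (s : R) i (S : {set I}) :
  (forall j, s * y j = (-1) ^+ (i == j) * (y j * s)) ->
  s * mon y S = (-1) ^+ (i \in S) * (mon y S * s).
Proof.
move=> sy; rewrite /mon; have : uniq (index_enum I) by exact: index_enum_uniq.
rewrite (_ : (i \in S) = (i \in index_enum I) && (i \in S)); last first.
  by rewrite mem_index_enum.
elim: (index_enum I) => [|j u IHu] /=; first by rewrite big_nil expr0 mulr1 !mul1r.
case/andP=> ju /IHu{}IHu; rewrite !big_cons mulrA inE.
have -> : s * (if j \in S then y j else 1) =
    (-1) ^+ ((i == j) && (j \in S)) * ((if j \in S then y j else 1) * s).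
  by case: ifP => _; rewrite ?andbT ?andbF ?sy // expr0 mulr1 !mul1r.
rewrite -!mulrA IHu !mulrA; congr (_ * _).
rewrite [LHS](_ : _ = (-1) ^+ ((i == j) && (j \in S)) *
   (-1) ^+ ((i \in u) && (i \in S)) * (if j \in S then y j else 1) *
   \prod_(l <- u) (if l \in S then y l else 1)); last first.
  rewrite -!mulrA; congr (_ * _); rewrite !mulrA; congr (_ * _).
  by case: (_ && _); rewrite ?expr0 ?expr1 ?mulr1 ?mul1r ?mulN1r ?mulrN1.
congr (_ * _ * _); rewrite -signr_addb; congr (_ ^+ _).
have [->|//] := eqVneq i j.
by rewrite (negPf ju) /= addbF.
Qed.

Lemma mon_reg (S : {set I}) :
  (forall i u, u * y i = 0 -> u = 0) -> forall u, u * mon y S = 0 -> u = 0.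
Proof.
move=> y_reg; rewrite /mon; elim: (index_enum I) => [|i s IHs] u.
  by rewrite big_nil mulr1.
by rewrite big_cons mulrA => /IHs; case: ifP => _; [exact: y_reg | rewrite mulr1].
Qed.

End Monomials.

Lemma rmorph_mon (R R' : pzRingType) (f : {rmorphism R -> R'}) (I : finType)
    (y : I -> R) S : f (mon y S) = mon (f \o y) S.
Proof.
rewrite /mon rmorph_prod; apply: eq_bigr => i _.
by case: ifP => //= _; rewrite rmorph1.
Qed.

(** * Multiquadratic algebras *)

Lemma kbasis_enum (k : fieldType) (B : algebra k) (L : set B) (F : finType)
    (x : F -> B) : (forall f, L (x f)) ->
  (forall y, L y -> exists c : F -> k, y = \sum_f (c f)%:sc * x f) ->
  (forall c : F -> k, \sum_f (c f)%:sc * x f = 0 -> forall f, c f = 0) ->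
  kbasis L (fun i : 'I_#|F| => x (enum_val i)).
Proof.
move=> Lx span ind; split=> [i|y /span[c ->]]; first exact: Lx.
have reidx (c' : 'I_#|F| -> k) : \sum_i (c' i)%:sc * x (enum_val i) =
    \sum_f (c' (enum_rank f))%:sc * x f.
  rewrite [RHS](reindex_onto enum_val enum_rank) => [|f _]; last exact: enum_rankK.
  by apply: eq_big => i; rewrite enum_valK ?eqxx.
exists [ffun i => c (enum_val i)]; split=> [|c' e].
  by rewrite reidx; apply: eq_bigr => f _; rewrite ffunE enum_rankK.
apply/ffunP => i; rewrite ffunE; apply/eqP; rewrite -subr_eq0; apply/eqP.
move: e; rewrite reidx => /eqP; rewrite -subr_eq0 -sumrB => /eqP.
under eq_bigr do rewrite -mulrBl -rmorphB.
by move=> /(ind (fun f => c f - c' (enum_rank f)))/(_ (enum_val i)); rewrite enum_valK.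
Qed.

Lemma gen_ind (k : fieldType) (B : algebra k) (S : set B) (P : B -> Prop) :
  let L := generated_subalgebra S in
  (forall c, P c%:sc) -> (forall x, S x -> P x) ->
  (forall x y, L x -> L y -> P x -> P y -> P (x + y)) ->
  (forall x y, L x -> L y -> P x -> P y -> P (x * y)) ->
  forall x, L x -> P x.
Proof.
move=> L Psc PS PD PM x Lx; have L_alg := generated_is_subalgebra S.
suff LP : subalgebra [set y | L y /\ P y].
  suff SP : S `<=` [set y | L y /\ P y] by have [] := Lx _ LP SP.
  by move=> y Sy; split; [exact: sub_generated | exact: PS].
split=> [c|y y' [Ly Py] [Ly' Py']|y y' [Ly Py] [Ly' Py']].
- by split; [exact: (subalg_sc L_alg) | exact: Psc].
- by split; [exact: (subalgD L_alg) | exact: PD].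
- by split; [exact: (subalgM L_alg) | exact: PM].
Qed.

(** The [s i] separate the terms [c S * mon xi S]; multiplication by the [xi i] for
   [i] in [S] then turns [mon xi S] into a nonzero scalar. *)
Lemma mon_indep (k : fieldType) (B : algebra k) (char_k : (2%:R : k) != 0)
    (I : finType) (xi s : I -> B) (d : I -> k) :
  (1 : B) <> 0 -> (forall i, d i != 0) ->
  (forall i j, xi i * xi j = xi j * xi i) -> (forall i, xi i * xi i = (d i)%:sc) ->
  (forall i j, s i * xi j = (-1) ^+ (i == j) * (xi j * s i)) ->
  (forall i u, u * s i = 0 -> u = 0) ->
  forall c : {set I} -> k,
  \sum_S (c S)%:sc * mon xi S = 0 -> forall S, c S = 0.
Proof.
move=> B1 d0 xiC xi_sq s_xi s_reg c sum0 S.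
have smon i T : s i * mon xi T = (-1) ^+ (i \in T) * (mon xi T * s i).
  exact: sign_mon.
have := separation (x := fun T => (c T)%:sc * mon xi T) (@alg_double_eq0 k B char_k) s_reg.
move=> /(_ _ sum0 S) sep.
have {sep} xS : (c S)%:sc * mon xi S = 0.
  apply: sep => i T; rewrite mulr_scCA smon -!mulrA.
  by case: (i \in T); rewrite ?expr0 ?expr1 ?mul1r ?mulN1r ?mulrN.
(* Removing the factors of [mon xi S] one at a time leaves the scalar. *)
apply: contrapT => cS; apply: B1.
have {}xS : mon xi S = 0.
  by apply: (sc_inj (c := c S)); [exact/eqP | rewrite mulr0].
elim: {S cS}#|S| {-2}S (erefl #|S|) xS => [|m IHm] S cardS xS.
  by move: xS; rewrite (cards0_eq cardS) mon0.
have /card_gt0P[i iS] : (0 < #|S|)%N by rewrite cardS.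
apply: (IHm (toggle i S)); first by move: cardS; rewrite /toggle iS (cardsD1 i) iS => -[].
have := mul_mon_sqr (q := fun i => (d i)%:sc) S (xiC i) _ (xi_sq i).
rewrite xS mulr0 iS => e; apply: (sc_inj (d0 i)).
by rewrite mulr0 -e // => j; rewrite alg_central.
Qed.

Record multiquadratic (k : fieldType) (B : algebra k) r (xi : 'I_r -> B)
    (d : 'I_r -> k) : Prop := Multiquadratic {
  mq_neq0 : forall i, d i != 0;
  mq_comm : forall i j, xi i * xi j = xi j * xi i;
  mq_sqr : forall i, xi i * xi i = (d i)%:sc;
  mq_ind : forall c : {set 'I_r} -> k,
    \sum_S (c S)%:sc * mon xi S = 0 -> forall S, c S = 0 }.

Section Multiquadratic.
Variables (k : fieldType) (B : algebra k) (r : nat).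
Hypothesis char_k : (2%:R : k) != 0.
Variables (xi : 'I_r -> B) (d : 'I_r -> k).
Hypothesis xi_mq : multiquadratic xi d.
Let d_neq0 := mq_neq0 xi_mq.
Let xi_comm := mq_comm xi_mq.
Let xi_sqr := mq_sqr xi_mq.
Let xi_ind := mq_ind xi_mq.

Local Notation L := (generated_subalgebra (range xi)).

Let L_alg : subalgebra L. Proof. exact: generated_is_subalgebra. Qed.
Let L_xi i : L (xi i). Proof. by apply: sub_generated; exists i. Qed.
Let L_mon S : L (mon xi S).
Proof. by apply: (subalg_prod L_alg) => // i _; case: ifP => // _; exact: (subalg1 L_alg). Qed.

Lemma mul_xi_mon (C : algebra k) (y : 'I_r -> C) i S :
  (forall i j, y i * y j = y j * y i) -> (forall i, y i * y i = (d i)%:sc) ->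
  y i * mon y S = (if i \in S then d i else 1)%:sc * mon y (toggle i S).
Proof.
move=> yC y2; rewrite (mul_mon_sqr (q := fun i => (d i)%:sc)) //.
  by case: ifP => // _; rewrite rmorph1.
by move=> j; rewrite alg_central.
Qed.

Lemma multiquad_comm x y : L x -> L y -> x * y = y * x.
Proof.
move=> Lx Ly; suff : L `<=` [set x | GRing.comm y x] by move/(_ x Lx).
move=> u Lu; apply: Lu; first exact: comm_subalgebra.
move=> _ [i _ <-]; rewrite /= /GRing.comm; symmetry.
apply: (Ly [set v | GRing.comm (xi i) v]); first exact: comm_subalgebra.
by move=> _ [j _ <-]; exact: xi_comm.
Qed.

Lemma multiquad_span x : L x -> exists c : {set 'I_r} -> k,
  x = \sum_S (c S)%:sc * mon xi S.
Proof.
pose N := [set x : B | exists c : {set 'I_r} -> k, x = \sum_S (c S)%:sc * mon xi S].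
have ND u v : N u -> N v -> N (u + v).
  move=> [c ->] [c' ->]; exists (fun S => c S + c' S); rewrite -big_split.
  by apply: eq_bigr => S _; rewrite rmorphD mulrDl.
have Nsc l u : N u -> N (l%:sc * u).
  move=> [c ->]; exists (fun S => l * c S); rewrite mulr_sumr.
  by apply: eq_bigr => S _; rewrite scA.
have Nxi i u : N u -> N (xi i * u).
  move=> [c ->]; rewrite mulr_sumr.
  exists (fun S => c (toggle i S) * (if i \in S then 1 else d i)).
  rewrite (reindex_inj (inv_inj (toggleK i))); apply: eq_bigr => S _.
  rewrite mulr_scCA mul_xi_mon // toggleK scA mem_toggle eqxx addbT.
  by case: (i \in S).
have N1 : N 1.
  exists (fun S => (S == finset.set0)%:R); rewrite (bigD1 finset.set0) //=.
  rewrite mon0 eqxx rmorph1 mulr1 big1 ?addr0 // => S /negPf ->.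
  by rewrite rmorph0 mul0r.
move=> Lx; rewrite -[x]mulr1.
apply: (Lx [set u | forall v, N v -> N (u * v)]) => // [|_ [i _ <-] v /Nxi//].
split=> [l v /Nsc//|u v Nu Nv w Nw|u v Nu Nv w Nw].
  by rewrite mulrDl; apply: ND; [exact: Nu | exact: Nv].
by rewrite -mulrA; apply: Nu; exact: Nv.
Qed.

Definition mqcoord (x : B) : {set 'I_r} -> k :=
  xget (fun=> 0) [set c | x = \sum_S (c S)%:sc * mon xi S].

Lemma mqcoordE x : L x -> x = \sum_S (mqcoord x S)%:sc * mon xi S.
Proof.
move=> /multiquad_span[c xc]; rewrite /mqcoord.
by case: xgetP => [c' _ //|/(_ c)].
Qed.

Lemma mqcoord_lin c S : mqcoord (\sum_S (c S)%:sc * mon xi S) S = c S.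
Proof.
have Lc : L (\sum_S (c S)%:sc * mon xi S).
  by apply: (subalg_sum L_alg) => // T _; apply: (subalgM L_alg) => //; exact: (subalg_sc L_alg).
apply/eqP; rewrite eq_sym -subr_eq0; apply/eqP.
apply: (xi_ind (c := fun S => c S - _)).
under eq_bigr do rewrite rmorphB mulrBl.
by rewrite sumrB -mqcoordE // subrr.
Qed.

Lemma mqcoord_inj x y : L x -> L y -> (forall S, mqcoord x S = mqcoord y S) -> x = y.
Proof.
by move=> Lx Ly xy; rewrite (mqcoordE Lx) (mqcoordE Ly); under eq_bigr do rewrite xy.
Qed.

(** [L] is the universal algebra generated by commuting square roots of the [d i]. *)
Section Extension.
Variables (C : algebra k) (y : 'I_r -> C).
Hypotheses (y_comm : forall i j, y i * y j = y j * y i)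
  (y_sqr : forall i, y i * y i = (d i)%:sc).

Definition ext (x : B) : C := \sum_S (mqcoord x S)%:sc * mon y S.

Lemma ext_lin c :
  ext (\sum_S (c S)%:sc * mon xi S) = \sum_S (c S)%:sc * mon y S.
Proof. by apply: eq_bigr => S _; rewrite mqcoord_lin. Qed.

Lemma extD x x' : L x -> L x' -> ext (x + x') = ext x + ext x'.
Proof.
move=> /mqcoordE -> /mqcoordE ->; rewrite -big_split /=.
under eq_bigr do rewrite -mulrDl -rmorphD.
by rewrite !ext_lin -big_split /=; apply: eq_bigr => S _; rewrite rmorphD mulrDl.
Qed.

Lemma extZ c x : L x -> ext (c%:sc * x) = c%:sc * ext x.
Proof.
move=> /mqcoordE ->; rewrite mulr_sumr; under eq_bigr do rewrite scA.
by rewrite !ext_lin mulr_sumr; apply: eq_bigr => S _; rewrite scA.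
Qed.

Lemma ext_mon S : ext (mon xi S) = mon y S.
Proof.
rewrite (_ : mon xi S = \sum_T ((T == S)%:R)%:sc * mon xi T); last first.
  rewrite (bigD1 S) //= eqxx rmorph1 mul1r big1 ?addr0 // => T /negPf ->.
  by rewrite rmorph0 mul0r.
rewrite ext_lin (bigD1 S) //= eqxx rmorph1 mul1r big1 ?addr0 // => T /negPf ->.
by rewrite rmorph0 mul0r.
Qed.

Lemma ext1 : ext 1 = 1.
Proof. by rewrite -(mon0 xi) ext_mon mon0. Qed.

Lemma ext_sc c : ext c%:sc = c%:sc.
Proof. by rewrite -[c%:sc in LHS]mulr1 extZ ?ext1 ?mulr1 //; exact: (subalg1 L_alg). Qed.

Lemma ext_sum (F : {set 'I_r} -> B) : (forall S, L (F S)) ->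
  ext (\sum_S F S) = \sum_S ext (F S).
Proof.
move=> LF; suff [] : ext (\sum_S F S) = \sum_S ext (F S) /\ L (\sum_S F S) by [].
apply: (big_ind2 (fun u v => ext u = v /\ L u)) => //.
  split; last exact: (subalg0 L_alg).
  by rewrite -(rmorph0 (@alg_map k B)) ext_sc rmorph0.
by move=> u _ u' _ [<- Lu] [<- Lu']; split; [exact: extD | exact: (subalgD L_alg)].
Qed.

Lemma ext_xiM i x : L x -> ext (xi i * x) = y i * ext x.
Proof.
move=> Lx; rewrite [in LHS](mqcoordE Lx) mulr_sumr ext_sum; last first.
  by move=> S; apply: (subalgM L_alg) => //; apply: (subalgM L_alg) => //; exact: (subalg_sc L_alg).
rewrite mulr_sumr; apply: eq_bigr => S _; rewrite mulr_scCA extZ; last exact: (subalgM L_alg).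
rewrite mulr_scCA !mul_xi_mon // extZ ?ext_mon //.
Qed.

Lemma ext_xi i : ext (xi i) = y i.
Proof. by rewrite -[xi i]mulr1 ext_xiM ?ext1 ?mulr1 //; exact: (subalg1 L_alg). Qed.

Lemma extM x x' : L x -> L x' -> ext (x * x') = ext x * ext x'.
Proof.
move=> Lx Lx'; move: x Lx x' Lx'.
apply: gen_ind => [c|_ [i _ <-]|u v Lu Lv uP vP|u v Lu Lv uP vP] x' Lx'.
- by rewrite extZ // ext_sc.
- by rewrite ext_xiM // ext_xi.
- rewrite mulrDl !extD //; try exact: (subalgM L_alg).
  by rewrite uP // vP // mulrDl.
- by rewrite -mulrA !uP ?vP ?mulrA //; exact: (subalgM L_alg).
Qed.

End Extension.

Lemma multiquad_kbasis :
  kbasis L (fun i : 'I_#|{: {set 'I_r}}| => mon xi (enum_val i)).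
Proof. exact: (kbasis_enum (x := mon xi)) L_mon multiquad_span xi_ind. Qed.

(** The characters of [L] send each [xi i] to one of the square roots of [d i];
   their values on the monomials satisfy orthogonality relations. *)
Lemma multiquad_etale (K : fieldType) (iota : {rmorphism k -> K}) (rt : 'I_r -> K) :
  (forall i, rt i * rt i = iota (d i)) -> etale_subalgebra L.
Proof.
move=> rt_sqr; split; [exact: L_alg | exact: multiquad_comm |].
have KC (c : k) (x : K) : iota c * x = x * iota c by rewrite mulrC.
pose C : algebra k := Algebra KC.
exists #|{: {set 'I_r}}|, (fun i => mon xi (enum_val i)).
split; first exact: multiquad_kbasis.
exists K, iota.
pose y (T : {set 'I_r}) (i : 'I_r) : C := (-1) ^+ (i \in T) * rt i.
have y_comm T i j : y T i * y T j = y T j * y T i by exact: (@mulrC K).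
have y_sqr T i : y T i * y T i = (d i)%:sc.
  rewrite -[RHS]rt_sqr /y; case: (i \in T); rewrite ?expr0 ?mul1r // expr1.
  by rewrite mulN1r mulrNN.
exists (fun j => @ext C (y (enum_val j))); split=> [j|].
  split; [move=> c; exact: (ext_sc (y (enum_val j)) c) | exact: (extD (y (enum_val j))) |].
  by move=> u v Lu Lv; exact: (extM (y_comm (enum_val j)) (y_sqr (enum_val j)) Lu Lv).
set A := \matrix_(i, j) _.
have AE i j : A i j = \prod_l (if l \in enum_val i then
   (-1) ^+ (l \in enum_val j) * rt l else 1) by rewrite mxE ext_mon.
pose D := \row_(i < #|{: {set 'I_r}}|)
  \prod_l (2%:R * (if l \in enum_val i then iota (d l) else 1)) : 'rV[K]_#|{: {set 'I_r}}|.
have AAT : A *m A^T = diag_mx D.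
  apply/matrixP => i i'; rewrite !mxE.
  pose F (s : bool) (l : 'I_r) : K :=
    (if l \in enum_val i then (-1) ^+ s * rt l else 1)
    * (if l \in enum_val i' then (-1) ^+ s * rt l else 1).
  transitivity (\sum_(T : {set 'I_r}) \prod_l (if l \in T then F true l else F false l)).
    rewrite [RHS](reindex_onto enum_val enum_rank) => [|T _]; last exact: enum_rankK.
    apply: eq_big => [j|j _]; first by rewrite enum_valK eqxx.
    rewrite [A^T j i']mxE !AE -big_split /=; apply: eq_bigr => l _.
    by rewrite /F; case: (l \in enum_val j).
  rewrite -bigA_distr; have [e|ii'] := eqVneq i i'.
    rewrite mulr1n; apply: eq_bigr => l _; rewrite /F e /=.
    case: ifP => _; last by rewrite !mulr1.
    by rewrite expr0 expr1 mulN1r mulrNN mul1r rt_sqr mulr_natl mulr2n.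
  have [l li] : exists l, (l \in enum_val i) != (l \in enum_val i').
    apply: contrapT => nl; case/eqP: ii'; apply: enum_val_inj; apply/setP => l.
    by apply/eqP/negPn/negP => li; apply: nl; exists l.
  rewrite mulr0n (bigD1 l) //= /F.
  case: (l \in enum_val i) (l \in enum_val i') li => [] [] // _;
    by rewrite expr0 expr1 ?mulr1 ?mul1r mulN1r addNr mul0r.
have : \det (A *m A^T) != 0.
  rewrite AAT det_diag prodf_seq_neq0; apply/allP => i _; rewrite mxE /=.
  rewrite prodf_seq_neq0; apply/allP => l _ /=.
  rewrite mulf_neq0 //; first by rewrite -(rmorph_nat iota) fmorph_eq0.
  by case: ifP; rewrite ?oner_eq0 // fmorph_eq0.
by rewrite det_mulmx mulf_eq0 negb_or unitmxE unitfE => /andP[].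
Qed.

(** * Galois action *)

(** The values outside [L], where [mqcoord] is a default value, have no meaning. *)
Definition twist (e : 'I_r -> k) : B -> B := ext (fun i => (e i)%:sc * xi i).

Section Twist.
Variable e : 'I_r -> k.
Hypothesis e_sqr : forall i, e i * e i = 1.

Let y_comm i j : (e i)%:sc * xi i * ((e j)%:sc * xi j) = (e j)%:sc * xi j * ((e i)%:sc * xi i).
Proof. by rewrite -!mulrA !(mulr_scCA (xi _)) !scA xi_comm mulrC. Qed.
Let y_sqr i : (e i)%:sc * xi i * ((e i)%:sc * xi i) = (d i)%:sc.
Proof. by rewrite -!mulrA mulr_scCA !scA e_sqr rmorph1 mul1r xi_sqr. Qed.

Lemma twist_sc c : twist e c%:sc = c%:sc. Proof. exact: ext_sc. Qed.
Lemma twist_xi i : twist e (xi i) = (e i)%:sc * xi i. Proof. exact: ext_xi. Qed.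
Lemma twistD x x' : L x -> L x' -> twist e (x + x') = twist e x + twist e x'.
Proof. exact: extD. Qed.
Lemma twistM x x' : L x -> L x' -> twist e (x * x') = twist e x * twist e x'.
Proof. exact: extM. Qed.

Lemma twist_conj y : (forall i, y * xi i = (e i)%:sc * (xi i * y)) ->
  forall x, L x -> y * x = twist e x * y.
Proof.
move=> y_xi; apply: gen_ind => [c|_ [i _ <-]|x x' Lx Lx' xP x'P|x x' Lx Lx' xP x'P].
- by rewrite twist_sc mulr_scC.
- by rewrite twist_xi y_xi mulrA.
- by rewrite twistD // mulrDr xP x'P mulrDl.
- by rewrite twistM // mulrA xP -mulrA x'P mulrA.
Qed.

Lemma twist_in x : L x -> L (twist e x).
Proof.
move=> _; apply: (subalg_sum L_alg) => // S _; apply: (subalgM L_alg) => //; first exact: (subalg_sc L_alg).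
apply: (subalg_prod L_alg) => // i _; case: ifP => _; last exact: (subalg1 L_alg).
by apply: (subalgM L_alg) => //; exact: (subalg_sc L_alg).
Qed.

Lemma twist_mon (S : {set 'I_r}) : twist e (mon xi S) = (\prod_(i in S) e i)%:sc * mon xi S.
Proof.
rewrite /twist ext_mon // /mon big_mkcond /=.
elim: (index_enum _) => [|i s IHs]; first by rewrite !big_nil rmorph1 mulr1.
rewrite !big_cons IHs; case: ifP => _; rewrite ?mul1r //.
by rewrite -!mulrA mulr_scCA scA !mulrA.
Qed.

Lemma mqcoord_twist x (S : {set 'I_r}) : L x ->
  mqcoord (twist e x) S = (\prod_(i in S) e i) * mqcoord x S.
Proof.
move=> Lx; rewrite /twist /ext.
rewrite -[RHS](mqcoord_lin (fun S => (\prod_(i in S) e i) * mqcoord x S)).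
congr mqcoord; apply: eq_bigr => T _.
by rewrite -(ext_mon (fun i => _)) -/(twist e _) twist_mon scA mulrC.
Qed.

Lemma twist_fixed x (S : {set 'I_r}) : L x -> twist e x = x -> \prod_(i in S) e i = -1 ->
  mqcoord x S = 0.
Proof.
move=> Lx fx eS; have := mqcoord_twist S Lx; rewrite fx eS mulN1r => /eqP.
rewrite -subr_eq0 opprK -mulr2n -mulr_natl mulf_eq0 (negPf char_k) /=.
by move/eqP.
Qed.

End Twist.

Lemma twist_twist e e' x : (forall i, e i * e i = 1) -> (forall i, e' i * e' i = 1) ->
  L x -> twist e (twist e' x) = twist (fun i => e i * e' i) x.
Proof.
move=> e2 e'2 Lx; have ee2 i : e i * e' i * (e i * e' i) = 1.
  by rewrite mulrACA e2 e'2 mulr1.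
apply: mqcoord_inj => [||S]; first by do 2!apply: twist_in.
  exact: twist_in.
rewrite !mqcoord_twist //; last exact: twist_in.
by rewrite mulrA -big_split.
Qed.

End Multiquadratic.

(** * Crossed products over a multiquadratic algebra *)

Lemma localized_rank_free (k : fieldType) (B : algebra k) (Z P M : set B)
    (F : finType) (x : F -> B) :
  Z 1 -> ~ P 1 -> (forall a c, Z a -> Z c -> Z (a * c)) ->
  (forall f, M (x f)) ->
  (forall y, M y -> exists2 a : F -> B, forall f, Z (a f) & y = \sum_f a f * x f) ->
  (forall a : F -> B, (forall f, Z (a f)) ->
     \sum_f a f * x f = 0 -> forall f, a f = 0) ->
  localized_rank Z P M #|F|.
Proof.
move=> Z1 P1 ZM Mx span ind; exists (fun i => x (enum_val i)).
have reidx (a : 'I_#|F| -> B) : \sum_i a i * x (enum_val i) =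
    \sum_f a (enum_rank f) * x f.
  rewrite [RHS](reindex_onto enum_val enum_rank) => [|f _]; last exact: enum_rankK.
  by apply: eq_big => i; rewrite enum_valK ?eqxx.
split=> [i|a Za [s [Zs Ps sa]] i|y /span[a Za ya]]; first exact: Mx.
  exists s; split=> //; rewrite -[i]enum_valK.
  apply: (ind (fun f => s * a (enum_rank f))) => [f|]; first exact: ZM.
  by under eq_bigr do rewrite -mulrA; rewrite -mulr_sumr -reidx.
exists 1, (fun i => a (enum_val i)); split=> //.
by rewrite mul1r reidx ya; apply: eq_bigr => f _; rewrite enum_rankK.
Qed.

Lemma centre_subalgebra (k : fieldType) (B : algebra k) : subalgebra (centre B).
Proof.
split=> [c y|x y xC yC u|x y xC yC u]; first exact: alg_central.
  by rewrite mulrDl mulrDr xC yC.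
by rewrite -mulrA yC mulrA xC mulrA.
Qed.

Section CrossedProduct.
Variables (k : fieldType) (B : algebra k) (n : nat).
Hypothesis char_k : (2%:R : k) != 0.
Variables (xi : 'I_n.+1 -> B) (d : 'I_n.+1 -> k).
Hypothesis xi_mq : multiquadratic xi d.
Let d_neq0 := mq_neq0 xi_mq.
Let xi_comm := mq_comm xi_mq.
Let xi_sqr := mq_sqr xi_mq.
Let xi_ind := mq_ind xi_mq.

Local Notation L := (generated_subalgebra (range xi)).

Variables (v v' : 'I_n -> B).

(** Conjugation by [v j] changes the signs of [xi 0] and of [xi (j + 1)]. *)
Definition star_sign (j : 'I_n) (i : 'I_n.+1) : k :=
  (-1) ^+ ((i == ord0) (+) (i == lift ord0 j)).

Hypotheses (v_xi : forall j i, v j * xi i = (star_sign j i)%:sc * (xi i * v j))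
  (vV : forall j, v j * v' j = 1)
  (v_sqr : forall j, L (v j * v j))
  (v_comm : forall i j, j != i -> exists2 l, L l & v i * v j = l * (v j * v i))
  (gen : forall M : set B, subalgebra M -> (forall i, M (xi i)) ->
     (forall j, M (v j)) -> forall x, M x).

Local Notation Z := (centre B).
Local Notation Xi := (mon xi finset.setT).

Let L_alg : subalgebra L. Proof. exact: generated_is_subalgebra. Qed.
Let L_xi i : L (xi i). Proof. by apply: sub_generated; exists i. Qed.

Let e_sqr j i : star_sign j i * star_sign j i = 1.
Proof. by rewrite -expr2 sqrr_sign. Qed.

Let v_reg j x : x * v j = 0 -> x = 0.
Proof. by move=> xv; rewrite -[x]mulr1 -(vV j) mulrA xv mul0r. Qed.

Let xi_reg i x : x * xi i = 0 -> x = 0.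
Proof.
move=> x0; apply: (sc_inj (d_neq0 i)).
by rewrite mulr0 -mulr_scC -xi_sqr mulrA x0 mul0r.
Qed.

Lemma v_twist j x : L x -> v j * x = twist xi (star_sign j) x * v j.
Proof. exact: (twist_conj xi_mq (e_sqr j) (v_xi j)). Qed.

(** The sum of the [L * mon v T] is stable under left multiplication by [L] and by
   the [v j], which generate the algebra. *)
Lemma crossed_span x : exists2 l : {set 'I_n} -> B,
  forall T, L (l T) & x = \sum_T l T * mon v T.
Proof.
pose N := [set x : B | exists2 l : {set 'I_n} -> B,
  forall T, L (l T) & x = \sum_T l T * mon v T].
have ND y y' : N y -> N y' -> N (y + y').
  move=> [l Ll ->] [l' Ll' ->]; exists (fun T => l T + l' T).
    by move=> T; exact: (subalgD L_alg).
  by rewrite -big_split; apply: eq_bigr => T _; rewrite mulrDl.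
have NL u y : L u -> N y -> N (u * y).
  move=> Lu [l Ll ->]; exists (fun T => u * l T).
    by move=> T; exact: (subalgM L_alg).
  by rewrite mulr_sumr; apply: eq_bigr => T _; rewrite mulrA.
have N0 : N 0 by exists (fun=> 0) => [T|]; [exact: subalg0 | rewrite big1 // => T _; rewrite mul0r].
have N1T u T : L u -> N (u * mon v T).
  move=> Lu; exists (fun T' => if T' == T then u else 0).
    by move=> T'; case: ifP => // _; exact: subalg0.
  rewrite (bigD1 T) //= eqxx big1 ?addr0 // => T' /negPf ->; exact: mul0r.
have Nv j y : N y -> N (v j * y).
  move=> [l Ll ->]; rewrite mulr_sumr; elim/big_ind: _ => // T _.
  have [l' Ll' e] : exists2 l', L l' & v j * mon v T = l' * mon v (toggle j T).
    apply: mul_mon_coef => //; first exact: subalg1.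
      by move=> u u'; exact: (subalgM L_alg).
    by move=> i u Lu; exists (twist xi (star_sign i) u); [exact: twist_in | exact: v_twist].
    exact: v_comm.
  rewrite mulrA v_twist // -mulrA e mulrA; apply: N1T.
  by apply: (subalgM L_alg) => //; exact: twist_in.
suff NP : N x by [].
rewrite -[x]mulr1; apply: (gen (M := [set y | forall z, N z -> N (y * z)])).
- split=> [c y|y y' Ny Ny' z Nz|y y' Ny Ny' z Nz] /=.
  + by move=> Ny; apply: NL => //; exact: subalg_sc.
  + by rewrite mulrDl; apply: ND; [exact: Ny | exact: Ny'].
  + by rewrite -mulrA; apply: Ny; exact: Ny'.
- by move=> i z Nz; exact: NL.
- by move=> j z Nz; exact: Nv.
- by rewrite -(mon0 v) -[mon _ _]mul1r; apply: N1T; exact: subalg1.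
Qed.

Let star_sign_lift i j : star_sign j (lift ord0 i) = (-1) ^+ (i == j).
Proof. by rewrite /star_sign eq_sym (negPf (neq_lift _ _)) (inj_eq lift_inj). Qed.

Let xi_mon_v j T :
  xi (lift ord0 j) * mon v T = (-1) ^+ (j \in T) * (mon v T * xi (lift ord0 j)).
Proof.
apply: sign_mon => i; rewrite v_xi star_sign_lift rmorphXn rmorphN1 !mulrA.
by rewrite -expr2 sqrr_sign mul1r.
Qed.

(** Commutation with [xi (j + 1)] detects whether [j] is in [T]. *)
Lemma crossed_indep l : (forall T, L (l T)) ->
  \sum_T l T * mon v T = 0 -> forall T, l T = 0.
Proof.
move=> Ll sum0 T; apply: (mon_reg (S := T) v_reg).
apply: (separation (s := fun j => xi (lift ord0 j)) (x := fun T => l T * mon v T)) => //.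
- exact: alg_double_eq0.
- by move=> j u; exact: xi_reg.
- move=> j S; rewrite mulrA (multiquad_comm xi_mq (L_xi _) (Ll S)) -mulrA xi_mon_v.
  by case: (j \in S); rewrite ?expr0 ?expr1 ?mul1r ?mulN1r ?mulrN !mulrA.
Qed.

Let sign_Xi j : \prod_(i in (finset.setT : {set 'I_n.+1})) star_sign j i = 1.
Proof.
rewrite (eq_bigl xpredT) => [|i]; last by rewrite inE.
rewrite big_ord_recl /= (bigD1 j) //= big1 => [|i ij].
  by rewrite star_sign_lift eqxx /star_sign eqxx mulr1 expr1 mulrNN mulr1.
by rewrite star_sign_lift (negPf ij).
Qed.

Let L_mon S : L (mon xi S).
Proof. by apply: (subalg_prod L_alg) => // i _; case: ifP => // _; exact: subalg1. Qed.

Lemma Xi_central : Z Xi.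
Proof.
apply: (gen (M := [set y | GRing.comm Xi y])); first exact: comm_subalgebra.
  by move=> i; exact: (multiquad_comm xi_mq).
move=> j /=; rewrite /GRing.comm v_twist // (twist_mon xi_mq).
by rewrite sign_Xi rmorph1 mul1r.
Qed.

(** The component of a central element on [mon v T] commutes and anticommutes with
   [xi (j + 1)] if [j] is in [T], hence vanishes. *)
Lemma central_in x : Z x -> L x.
Proof.
move=> xZ; have [l Ll xl] := crossed_span x.
suff l0 (T : {set 'I_n}) : T != finset.set0 -> l T = 0.
  rewrite xl (bigD1 finset.set0) //= big1 => [|T /l0 ->]; last exact: mul0r.
  by rewrite addr0 mon0 mulr1.
case/set0Pn => j jT.
have : \sum_(T : {set 'I_n}) (if j \in T then xi (lift ord0 j) * l T else 0) * mon v T = 0.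
  apply: (alg_double_eq0 char_k).
  transitivity (xi (lift ord0 j) * x - x * xi (lift ord0 j)).
    rewrite xl mulr_sumr mulr_suml -sumrB -big_split; apply: eq_bigr => S _ /=.
    have := xi_mon_v j S; case: (j \in S); rewrite ?expr0 ?expr1 ?mulN1r ?mul1r => e.
      rewrite -[l S * mon v S * _]mulrA -[mon v S * _]opprK -e mulrN opprK.
      by rewrite [l S * (_ * _)]mulrA -(multiquad_comm xi_mq (L_xi _) (Ll S)) !mulrA.
    rewrite -[l S * mon v S * _]mulrA -e mul0r addr0 mulrA [l S * (_ * _)]mulrA.
    by rewrite -(multiquad_comm xi_mq (L_xi _) (Ll S)) subrr.
  by rewrite xZ subrr.
move=> /(crossed_indep (l := fun T : {set 'I_n} => if j \in T then xi (lift ord0 j) * l T else 0)).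
move=> e; apply: (xi_reg (i := lift ord0 j)).
have := e _ T; rewrite jT (multiquad_comm xi_mq (L_xi _) (Ll T)); apply.
by move=> S; case: ifP => _; [apply: (subalgM L_alg) | exact: subalg0].
Qed.

(** A nonempty proper subset [S] is separated by some pair [{0, j + 1}], and then
   [star_sign j] changes the sign of [mon xi S]. *)
Lemma star_fixed x : L x -> (forall j, twist xi (star_sign j) x = x) ->
  x = (mqcoord xi x finset.set0)%:sc + (mqcoord xi x finset.setT)%:sc * Xi.
Proof.
move=> Lx fx; rewrite [LHS](mqcoordE xi_mq Lx).
have T0 : (finset.setT : {set 'I_n.+1}) != finset.set0 by apply/set0Pn; exists ord0; rewrite inE.
rewrite (bigD1 finset.set0) //= (bigD1 finset.setT) //= big1 ?addr0 ?mon0 ?mulr1 //.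
move=> S /andP[S0 ST]; rewrite [mqcoord _ _ _](_ : _ = 0) ?rmorph0 ?mul0r //.
have [j jS] : exists j, (lift ord0 j \in S) != (ord0 \in S).
  apply: contrapT => nj; have {nj} S0j j : (lift ord0 j \in S) = (ord0 \in S).
    by apply/eqP/negPn/negP => jS; apply: nj; exists j.
  have Sall i : (i \in S) = (ord0 \in S) by case: (unliftP ord0 i) => [j|] ->.
  case: (boolP (ord0 \in S)) => o; first by case/eqP: ST; apply/setP => i; rewrite Sall o inE.
  by case/eqP: S0; apply/setP => i; rewrite Sall (negPf o) inE.
apply: (twist_fixed char_k xi_mq Lx (fx j)).
rewrite big_mkcond big_ord_recl /= (bigD1 j) //= big1 => [|i ij].
  rewrite mulr1 star_sign_lift eqxx /star_sign eqxx (_ : ord0 == lift ord0 j = false) //.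
  by case: (ord0 \in S) (lift ord0 j \in S) jS => [] [] //= _; rewrite ?mulr1 ?mul1r.
by case: ifP => // _; rewrite star_sign_lift (negPf ij).
Qed.

Lemma central_fixed x : Z x -> forall j, twist xi (star_sign j) x = x.
Proof.
move=> xZ j; have Lx := central_in xZ.
apply/eqP; rewrite -subr_eq0; apply/eqP; apply: (v_reg (j := j)).
by rewrite mulrBl -v_twist // xZ subrr.
Qed.

Lemma centreP x : Z x <-> exists c c' : k, x = c%:sc + c'%:sc * Xi.
Proof.
split=> [xZ|[c [c' ->]]].
  by do 2!eexists; apply: star_fixed; [exact: central_in | exact: central_fixed].
have Z_alg := centre_subalgebra B.
apply: (subalgD Z_alg); first exact: (subalg_sc Z_alg).
by apply: (subalgM Z_alg); [exact: (subalg_sc Z_alg) | exact: Xi_central].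
Qed.

Lemma centre_generated : Z = generated_subalgebra [set \prod_i xi i].
Proof.
have -> : \prod_i xi i = Xi by apply: eq_bigr => i _; rewrite inE.
apply/seteqP; split=> [x /centreP[c [c' ->]] M M_alg XiM|x xM].
  apply: (subalgD M_alg); first exact: (subalg_sc M_alg).
  by apply: (subalgM M_alg); [exact: (subalg_sc M_alg) | exact: XiM].
by apply: xM; [exact: centre_subalgebra | move=> _ ->; exact: Xi_central].
Qed.

Local Notation xi1 := (fun j => xi (lift ord0 j)).

Lemma centre_span x : L x -> exists2 c : {set 'I_n} -> B,
  forall S, Z (c S) & x = \sum_S c S * mon xi1 S.
Proof.
have Z_alg := centre_subalgebra B.
pose N := [set x : B | exists2 c : {set 'I_n} -> B,
  forall S, Z (c S) & x = \sum_S c S * mon xi1 S].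
have ND y y' : N y -> N y' -> N (y + y').
  move=> [l Ll ->] [l' Ll' ->]; exists (fun T => l T + l' T).
    by move=> T; exact: (subalgD Z_alg).
  by rewrite -big_split; apply: eq_bigr => T _; rewrite mulrDl.
have NZ u y : Z u -> N y -> N (u * y).
  move=> Zu [l Ll ->]; exists (fun T => u * l T).
    by move=> T; exact: (subalgM Z_alg).
  by rewrite mulr_sumr; apply: eq_bigr => T _; rewrite mulrA.
have N1 : N 1.
  exists (fun T => if T == finset.set0 then 1 else 0).
    by move=> T'; case: ifP => // _; [exact: subalg1 | exact: subalg0].
  rewrite (bigD1 finset.set0) //= eqxx mon0 mulr1 big1 ?addr0 // => T' /negPf ->.
  exact: mul0r.
have Nxi1 j y : N y -> N (xi1 j * y).
  move=> [c Zc ->]; rewrite mulr_sumr.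
  exists (fun S => c (toggle j S) * (if j \in S then 1 else d (lift ord0 j))%:sc).
    by move=> S; apply: (subalgM Z_alg) => //; exact: (subalg_sc Z_alg).
  rewrite (reindex_inj (inv_inj (toggleK j))); apply: eq_bigr => S _.
  rewrite mulrA -[_ * c _]Zc -mulrA.
  rewrite (mul_xi_mon (d := d \o lift ord0) (y := xi1)) // toggleK mem_toggle eqxx addbT.
  by rewrite mulrA; case: (j \in S).
(* [xi 0] is the product of the central element [Xi] and of the other [xi i], up to a scalar. *)
have xi0 : (\prod_j d (lift ord0 j))%:sc * xi ord0 = Xi * \prod_j xi1 j.
  have sq : (\prod_j xi1 j) * (\prod_j xi1 j) = (\prod_j d (lift ord0 j))%:sc.
    rewrite rmorph_prod; elim: (index_enum _) => [|j s IHs]; first by rewrite !big_nil mulr1.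
    rewrite !big_cons -IHs -xi_sqr -!mulrA; congr (_ * _); rewrite !mulrA; congr (_ * _).
    by symmetry; apply: commr_prod => i _; exact: xi_comm.
  have -> : Xi = xi ord0 * \prod_j xi1 j.
    rewrite /mon big_ord_recl inE; congr (_ * _); apply: eq_bigr => i _.
    by rewrite inE.
  by rewrite -mulrA sq mulr_scC.
have Nxi i y : N y -> N (xi i * y).
  move=> Ny; case: (unliftP ord0 i) => [j|] ->; first exact: Nxi1.
  have d1 : \prod_j d (lift ord0 j) != 0 by apply/prodf_neq0 => j _.
  have -> : xi ord0 * y = ((\prod_j d (lift ord0 j))^-1)%:sc * (Xi * (\prod_j xi1 j * y)).
    by rewrite (mulrA Xi) -xi0 -!mulrA scA mulVf // rmorph1 mul1r.
  apply: (NZ); first exact: (subalg_sc Z_alg).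
  apply: NZ; first exact: Xi_central.
  elim: (index_enum _) => [|j s IHs]; first by rewrite big_nil mul1r.
  by rewrite big_cons -mulrA; exact: Nxi1.
move=> Lx; suff NP : N x by [].
rewrite -[x]mulr1; apply: (Lx [set y | forall z, N z -> N (y * z)]) => //.
- split=> [c y|y y' Ny Ny' z Nz|y y' Ny Ny' z Nz] /=.
  + by move=> Ny; apply: NZ => //; exact: (subalg_sc Z_alg).
  + by rewrite mulrDl; apply: ND; [exact: Ny | exact: Ny'].
  + by rewrite -mulrA; apply: Ny; exact: Ny'.
- by move=> _ [i _ <-] z Nz; exact: Nxi.
Qed.

(** Commutation with [v j] fixes the centre and detects whether [j] is in [S]. *)
Lemma centre_indep (c : {set 'I_n} -> B) : (forall S, Z (c S)) ->
  \sum_S c S * mon xi1 S = 0 -> forall S, c S = 0.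
Proof.
move=> Zc sum0 S.
have xi1_reg j u : u * xi1 j = 0 -> u = 0 by exact: xi_reg.
apply: (mon_reg (S := S) xi1_reg).
apply: (separation (s := v) (x := fun S => c S * mon xi1 S)) => //.
  exact: alg_double_eq0.
move=> j T; rewrite mulrA -(Zc T) -mulrA (sign_mon (i := j)).
  by case: (j \in T); rewrite ?expr0 ?expr1 ?mul1r ?mulN1r ?mulrN !mulrA.
by move=> i; rewrite v_xi star_sign_lift rmorphXn rmorphN1 eq_sym.
Qed.

(** The algebra is free of rank 2^n over [L], with basis the [mon v T], and [L] is free
   of rank 2^n over the centre. *)
Lemma crossed_strictly_maximal : strictly_maximal L.
Proof.
have Z_alg := centre_subalgebra B.
split=> [x|P [PZ [P0 P1] PD PM Pprime]]; first exact: central_in.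
exists (2 ^ n)%N; have card_setn : #|{: {set 'I_n}}| = (2 ^ n)%N.
  by rewrite -cardsT -powersetT card_powerset cardsT card_ord.
have L_xi1 S : L (mon xi1 S).
  by apply: (subalg_prod L_alg) => // i _; case: ifP => // _; exact: subalg1.
split; last first.
  rewrite -card_setn; apply: (localized_rank_free (x := mon xi1)) => //.
  - exact: subalg1.
  - by move=> a c; exact: (subalgM Z_alg).
  - exact: centre_span.
  - exact: centre_indep.
rewrite expnS expn1 -card_setn -card_prod.
apply: (localized_rank_free (x := fun ST => mon xi1 ST.1 * mon v ST.2)) => //.
- exact: subalg1.
- by move=> a c; exact: (subalgM Z_alg).
- move=> y _; have [l Ll ->] := crossed_span y.
  have ex T : exists c : {set 'I_n} -> B,
      (forall S, Z (c S)) /\ l T = \sum_S c S * mon xi1 S.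
    by have [c Zc lc] := centre_span (Ll T); exists c.
  have [c cP] := choice ex.
  exists (fun ST => c ST.2 ST.1) => [[S T]|]; first by case: (cP T).
  rewrite /= -(pair_bigA _ (fun S T => c T S * (mon xi1 S * mon v T))) /=.
  rewrite exchange_big; apply: eq_bigr => T _; have [_ ->] := cP T.
  by rewrite mulr_suml; apply: eq_bigr => S _; rewrite mulrA.
move=> a Za; have -> : \sum_f a f * (mon xi1 f.1 * mon v f.2) =
    \sum_S \sum_T a (S, T) * (mon xi1 S * mon v T).
  by rewrite pair_bigA; apply: eq_bigr => -[S T] _.
rewrite exchange_big => sum0 [S T].
apply: (centre_indep (c := fun S => a (S, T))) => //.
apply: (crossed_indep (l := fun T => \sum_S a (S, T) * mon xi1 S)).
  move=> T'; apply: (subalg_sum L_alg) => // S' _; apply: (subalgM L_alg) => //.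
  exact: central_in.
rewrite -[RHS]sum0; apply: eq_bigr => T' _; rewrite mulr_suml.
by apply: eq_bigr => S' _; rewrite mulrA.
Qed.

End CrossedProduct.

(** * The Clifford algebra of an anti-hermitian form *)

Section CliffordQuotient.
Local Open Scope quotient_scope.
Variables (k : fieldType) (A : algebra k) (sigma : A -> A) (trd : A -> k).
Local Notation B := (clifford_algebra sigma trd).
Local Notation cls := (\pi_(clifford sigma trd) : cl_term A -> B).
Local Notation gen := (cl_gen sigma trd).

Lemma cls_add x y : cls (CAdd x y) = cls x + cls y.
Proof. by rewrite [RHS]cl_addE. Qed.
Lemma cls_mul x y : cls (CMul x y) = cls x * cls y.
Proof. by rewrite [RHS]cl_mulE. Qed.

Lemma cl_genD s t : gen (s + t) = gen s + gen t.
Proof. by rewrite -[RHS]cls_add; apply: cl_eq; exact: crel_genD. Qed.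
Lemma cl_genZ c s : gen (c%:sc * s) = c%:sc * gen s.
Proof. by rewrite -[RHS]cls_mul; apply: cl_eq; exact: crel_genZ. Qed.
Lemma cl_gen0 : gen 0 = 0.
Proof. by apply: (addrI (gen 0)); rewrite -cl_genD !addr0. Qed.
Lemma cl_genN s : gen (- s) = - gen s.
Proof. by apply: (addrI (gen s)); rewrite -cl_genD !subrr cl_gen0. Qed.
Lemma cl_gen_sum I (u : seq I) (F : I -> A) :
  gen (\sum_(i <- u) F i) = \sum_(i <- u) gen (F i).
Proof. exact: (big_morph _ cl_genD cl_gen0). Qed.

Lemma cl_J1 s : sigma s = s -> gen s = (trd s / 2%:R)%:sc.
Proof. by move=> ss; apply: cl_eq; exact: crel_J1. Qed.

Lemma cl_J2 (u : seq (A * A)) :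
  (forall x, \sum_(st <- u) st.1 * sigma x * st.2 = \sum_(st <- u) st.1 * x * st.2) ->
  \sum_(st <- u) gen st.1 * gen st.2 = (2%:R^-1)%:sc * gen (\sum_(st <- u) st.1 * st.2).
Proof.
move=> /(crel_J2 trd)/cl_eq e; rewrite -cl_genZ [RHS](esym e) {e}.
elim: u => [|st u IHu]; first by rewrite big_nil -(rmorph0 (@alg_map k B)).
by rewrite big_cons [RHS]cls_add IHu; congr (_ + _); rewrite [RHS]cls_mul.
Qed.

Lemma cl_gen_ind (M : set B) : subalgebra M -> (forall s, M (gen s)) -> forall x, M x.
Proof.
move=> M_alg Mgen; elim/cl_ind; elim=> [s|c|x Mx y My|x Mx y My].
- exact: Mgen.
- exact: (subalg_sc M_alg c).
- by rewrite cls_add; exact: (subalgD M_alg).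
- by rewrite cls_mul; exact: (subalgM M_alg).
Qed.

End CliffordQuotient.

Section Endomorphisms.
Variables (k : fieldType) (a b : k).
Hypotheses (char_k : (2%:R : k) != 0) (a_neq0 : a != 0) (b_neq0 : b != 0).
Local Notation Q := (quat a b).
Variables (V : rmodType Q) (h : V -> V -> Q).
Hypotheses (h_antiherm : antihermitian h) (h_nondeg : nondegenerate_form h).
Variables (r : nat) (e : 'I_r -> V) (e_basis : rbasis e) (z : 'I_r -> Q).
Hypotheses (h_diag : forall i j, h (e i) (e j) = if i == j then z i else 0)
  (z_pure : forall i, qpure (z i)) (z_inv : forall i, qinvertible (z i)).
Variable sigma : endo_algebra V -> endo_algebra V.
Hypothesis sigma_adj : adjoint_involution h sigma.

Local Notation "v *r x" := (rscale v x) (at level 40).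
Local Notation A := (endo_algebra V).

Lemma rscaleDr (v : V) s t : v *r (s + t) = v *r s + v *r t.
Proof. exact: (@scalerDl (Q^c) V v s t). Qed.
Lemma rscale1 (v : V) : v *r 1 = v.
Proof. exact: scale1r. Qed.
Lemma rscale0 (v : V) : v *r 0 = 0.
Proof. exact: scale0r. Qed.
Lemma rscaleN (v : V) s : v *r (- s) = - (v *r s).
Proof. exact: (@scaleNr (Q^c)). Qed.
Lemma rscale_suml I (u : seq I) (F : I -> V) s :
  (\sum_(i <- u) F i) *r s = \sum_(i <- u) F i *r s.
Proof. exact: scaler_sumr. Qed.

Let hDl x y w : h (x + y) w = h x w + h y w. Proof. by case: h_antiherm. Qed.
Let hDr x y w : h x (y + w) = h x y + h x w. Proof. by case: h_antiherm. Qed.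
Let hZ x y s t : h (x *r s) (y *r t) = qconj s * h x y * t.
Proof. by case: h_antiherm. Qed.
Let hC x y : h y x = - qconj (h x y). Proof. by case: h_antiherm. Qed.
Let hZr x y t : h x (y *r t) = h x y * t.
Proof. by rewrite -[x in LHS]rscale1 hZ qconj1 mul1r. Qed.
Let hZl x y s : h (x *r s) y = qconj s * h x y.
Proof. by rewrite -[y in LHS]rscale1 hZ mulr1. Qed.
Let h0r x : h x 0 = 0.
Proof. by apply: (addrI (h x 0)); rewrite -hDr !addr0. Qed.
Let hNr x y : h x (- y) = - h x y.
Proof. by apply: (addrI (h x y)); rewrite -hDr !subrr h0r. Qed.
Let h_sumr I (u : seq I) (F : I -> V) x :
  h x (\sum_(i <- u) F i) = \sum_(i <- u) h x (F i).
Proof. exact: (big_morph _ (hDr x) (h0r x)). Qed.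

Lemma adjoint_uniq (f g : A) : (forall x y, h (f x) y = h x (g y)) -> sigma f = g.
Proof.
move=> fg; apply: endoP => y; apply/eqP; rewrite -subr_eq0; apply/eqP.
apply: h_nondeg => x; rewrite hC hDr hNr -fg -sigma_adj subrr.
by rewrite qconj0 oppr0.
Qed.

Lemma adjointB (f g : A) : sigma (f - g) = sigma f - sigma g.
Proof.
apply: adjoint_uniq => x y /=; rewrite hDr hNr -!sigma_adj hDl; congr (_ + _).
by apply: (addrI (h (g x) y)); rewrite -hDl !subrr [LHS]hC h0r qconj0 oppr0.
Qed.

Lemma h_adjoint (f : A) x y : h x (sigma f y) = - qconj (h y (f x)).
Proof. by rewrite -sigma_adj hC. Qed.

Definition rank1 (i j : 'I_r) (s : Q) : A.
Proof.
exists (fun x => e i *r (s * h (e j) x)) => [x y|x t].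
  by rewrite hDr mulrDr rscaleDr.
by rewrite hZr rscaleA mulrA.
Defined.

Lemma rank1E i j s x : rank1 i j s x = e i *r (s * h (e j) x).
Proof. by []. Qed.
Lemma rank1D i j s t : rank1 i j (s + t) = rank1 i j s + rank1 i j t.
Proof. by apply: endoP => x /=; rewrite mulrDl rscaleDr. Qed.
Lemma rank1Z i j c s : rank1 i j (c *: s) = c%:sc * rank1 i j s.
Proof. by apply: endoP => x /=; rewrite rscaleA mulr_algr scalerAl. Qed.
Lemma rank1_0 i j : rank1 i j 0 = 0.
Proof. by apply: endoP => x /=; rewrite mul0r rscale0. Qed.
Lemma rank1N i j s : rank1 i j (- s) = - rank1 i j s.
Proof. by apply: endoP => x /=; rewrite mulNr rscaleN. Qed.
Lemma rank1_sum i j I (u : seq I) (F : I -> Q) :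
  rank1 i j (\sum_(m <- u) F m) = \sum_(m <- u) rank1 i j (F m).
Proof. exact: (big_morph _ (rank1D i j) (rank1_0 i j)). Qed.

Lemma rank1_sandwich i j j' l s t (f : A) :
  rank1 i j s * f * rank1 j' l t = rank1 i l (s * h (e j) (f (e j')) * t).
Proof. by apply: endoP => x /=; rewrite endoZ hZr !mulrA. Qed.

Lemma rank1M i j j' l s t : rank1 i j s * rank1 j' l t =
  if j == j' then rank1 i l (s * z j * t) else 0.
Proof.
rewrite -[rank1 i j s]mulr1 rank1_sandwich /= h_diag.
by case: eqP => // _; rewrite mulr0 mul0r rank1_0.
Qed.

Lemma adjoint_rank1 i j s : sigma (rank1 i j s) = - rank1 j i (qconj s).
Proof.
apply: adjoint_uniq => x y /=; rewrite hZl qconjM hNr hZr [h (e j) x in LHS]hC.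
by rewrite qconjN qconjK !mulNr mulrA.
Qed.

Lemma coords_lin (m : {ffun 'I_r -> Q}) : coords e (\sum_i e i *r m i) = m.
Proof.
have [m0 [m0P uniq]] := e_basis (\sum_i e i *r m i).
rewrite /coords; case: xgetP => [m' _ m'P|/(_ m0)//].
by rewrite -(uniq _ m'P); exact: uniq.
Qed.

Lemma coordsE v : v = \sum_i e i *r coords e v i.
Proof. by have [m [vm _]] := e_basis v; rewrite [in coords _ _]vm coords_lin. Qed.

Lemma h_coords j v : h (e j) v = z j * coords e v j.
Proof.
rewrite [v in LHS]coordsE h_sumr (bigD1 j) //= big1 ?addr0 => [|i /negPf ij].
  by rewrite hZr h_diag eqxx.
by rewrite hZr h_diag eq_sym ij mul0r.
Qed.

Let coordsD (u v : V) i : coords e (u + v) i = coords e u i + coords e v i.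
Proof.
rewrite (_ : coords e (u + v) = [ffun i => coords e u i + coords e v i]) ?ffunE //.
rewrite -[RHS]coords_lin; congr coords.
rewrite [u in LHS]coordsE [v in LHS]coordsE -big_split; apply: eq_bigr => l _.
by rewrite ffunE rscaleDr.
Qed.
Let coordsZ (u : V) s i : coords e (u *r s) i = coords e u i * s.
Proof.
rewrite (_ : coords e (u *r s) = [ffun i => coords e u i * s]) ?ffunE //.
rewrite -[RHS]coords_lin; congr coords.
rewrite [u in LHS]coordsE rscale_suml; apply: eq_bigr => l _.
by rewrite ffunE rscaleA.
Qed.
Let coords_sum I (u : seq I) (F : I -> V) i :
  coords e (\sum_(m <- u) F m) i = \sum_(m <- u) coords e (F m) i.
Proof.
apply: (big_morph (fun v => coords e v i)) => [v v'|]; first exact: coordsD.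
by apply: (addrI (coords e 0 i)); rewrite -coordsD !addr0.
Qed.
Let coordsB (u v : V) i : coords e (u - v) i = coords e u i - coords e v i.
Proof.
by apply: (addIr (coords e v i)); rewrite -coordsD !subrK.
Qed.

Let coords_e i s l : coords e (e i *r s) l = if l == i then s else 0.
Proof.
rewrite (_ : coords e (e i *r s) = [ffun l => if l == i then s else 0]) ?ffunE //.
rewrite -[RHS]coords_lin; congr coords.
rewrite (bigD1 i) //= ffunE eqxx big1 ?addr0 // => l' /negPf l'i.
by rewrite ffunE l'i rscale0.
Qed.

Lemma trdB (f g : A) : endo_trd e (f - g) = endo_trd e f - endo_trd e g.
Proof.
rewrite /endo_trd -qtrdN -qtrdD -sumrN -big_split /=; congr qtrd.
by apply: eq_bigr => i _; rewrite coordsB.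
Qed.

Lemma trd_rank1 i j s : endo_trd e (rank1 i j s) = if i == j then qtrd (s * z i) else 0.
Proof.
rewrite /endo_trd (bigD1 i) //= big1 => [|l /negPf li]; last by rewrite coords_e li.
rewrite addr0 coords_e eqxx h_diag eq_sym; case: eqP => [->//|_].
by rewrite mulr0 /qtrd addr0.
Qed.

(** The coefficients of [f] on the [rank1 i j]; as [h(e_j, e_j) = z_j], they are the
   coordinates of the [f (e_j)] divided by [z_j] on the right. *)
Definition endo_coef (f : A) i j : Q :=
  (qre (z j * z j))^-1 *: (coords e (f (e j)) i * z j).
Local Notation coef := endo_coef.

Let z_cancel i x y : z i * x = z i * y -> x = y.
Proof.
have [z' [_ z'z]] := z_inv i.
by move=> /(congr1 (fun x => z' * x)); rewrite !mulrA z'z !mul1r.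
Qed.
Let z_cancelr i x y : x * z i = y * z i -> x = y.
Proof.
have [z' [zz' _]] := z_inv i.
by move=> /(congr1 (fun x => x * z')); rewrite -!mulrA zz' !mulr1.
Qed.

Lemma endo_coef_coords (f : A) i j : coords e (f (e j)) i = coef f i j * z j.
Proof.
rewrite /endo_coef -scalerAl -mulrA {2}qpure_sqr // -scalerAr mulr1 scalerA.
by rewrite mulVf ?scale1r //; exact: qpure_sqr_neq0.
Qed.

Lemma endo_rank1 (f : A) : f = \sum_i \sum_j rank1 i j (coef f i j).
Proof.
have endo_sumE (I : Type) (u : seq I) (F : I -> A) x :
    (\sum_(i <- u) F i) x = \sum_(i <- u) F i x.
  by elim: u => [|i u IHu]; rewrite ?big_nil // !big_cons -IHu.
apply: endoP => v; rewrite endo_sumE {1}[v]coordsE.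
have f_sum (u : seq 'I_r) (F : 'I_r -> V) : f (\sum_(i <- u) F i) = \sum_(i <- u) f (F i).
  apply: (big_morph _ (endoD f)).
  by apply: (addrI (f 0)); rewrite -endoD !addr0.
rewrite f_sum; under [RHS]eq_bigr do rewrite endo_sumE.
rewrite exchange_big; apply: eq_bigr => j _.
rewrite endoZ [f (e j) in LHS]coordsE rscale_suml; apply: eq_bigr => i _.
by rewrite [RHS]rank1E rscaleA h_coords endo_coef_coords mulrA.
Qed.

Lemma endo_coefD (f g : A) i j : coef (f + g) i j = coef f i j + coef g i j.
Proof. by apply: (@z_cancelr j); rewrite mulrDl -!endo_coef_coords; exact: coordsD. Qed.

Lemma endo_coefZ (c : k) (f : A) i j : coef (c%:sc * f) i j = c *: coef f i j.
Proof.
by apply: (@z_cancelr j); rewrite -[RHS]scalerAl -!endo_coef_coords [LHS]coordsZ mulr_algr.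
Qed.

Lemma endo_coefM (f g : A) i j : coef (f * g) i j = \sum_l coef f i l * z l * coef g l j.
Proof.
have f_sum (u : seq 'I_r) (F : 'I_r -> V) : f (\sum_(i <- u) F i) = \sum_(i <- u) f (F i).
  apply: (big_morph _ (endoD f)).
  by apply: (addrI (f 0)); rewrite -endoD !addr0.
apply: (@z_cancelr j); rewrite -endo_coef_coords mulr_suml /= [g (e j)]coordsE f_sum coords_sum.
by apply: eq_bigr => l _; rewrite endoZ coordsZ !endo_coef_coords -!mulrA.
Qed.

Lemma endo_coef_adjoint (f : A) i j : coef (sigma f) i j = - qconj (coef f j i).
Proof.
apply: (@z_cancelr j); apply: (@z_cancel i).
rewrite -endo_coef_coords -h_coords h_adjoint h_coords endo_coef_coords !qconjM.
by rewrite !(qconj_pure _ (z_pure _)) // !(mulrN, mulNr, opprK) mulrA.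
Qed.

Lemma endo_coef_trd (f : A) : endo_trd e f = qtrd (\sum_i coef f i i * z i).
Proof. by congr qtrd; apply: eq_bigr => i _; rewrite endo_coef_coords. Qed.

Lemma endo_coef_rank1 i j s i' j' :
  coef (rank1 i j s) i' j' = if (i' == i) && (j' == j) then s else 0.
Proof.
apply: (@z_cancelr j'); rewrite -endo_coef_coords rank1E coords_e h_diag eq_sym.
have [->|_] := eqVneq j' j; last by rewrite andbF mul0r mulr0; case: ifP.
by rewrite andbT; case: ifP => _; rewrite ?mul0r.
Qed.

(** The hypothesis for [x = rank1 j m (z_j q z_m)] compares the coefficients of
   both sides, up to the scalar [z_j^2 z_m^2]. *)
Lemma endo_coef_sandwich (u : seq (A * A)) :
  (forall x, \sum_(st <- u) st.1 * sigma x * st.2 = \sum_(st <- u) st.1 * x * st.2) ->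
  forall i j m l q, \sum_(st <- u) coef st.1 i j * q * coef st.2 m l =
    - \sum_(st <- u) coef st.1 i m * qconj q * coef st.2 j l.
Proof.
move=> sand i j m l q.
have coef_sum (F : A * A -> A) : coef (\sum_(st <- u) F st) i l = \sum_(st <- u) coef (F st) i l.
  apply: (big_morph (fun f => coef f i l)) => [f g|]; first exact: endo_coefD.
  by apply: (addrI (coef 0 i l)); rewrite -endo_coefD !addr0.
have coef3 (s t : A) i' j' q' :
    coef (s * rank1 i' j' q' * t) i l = coef s i i' * z i' * q' * (z j' * coef t j' l).
  rewrite endo_coefM (bigD1 j') //= big1 ?addr0 => [|m' m'j]; last first.
    rewrite endo_coefM big1 ?mul0r // => i'' _; rewrite endo_coef_rank1 (negPf m'j) andbF mulr0 //.
  rewrite endo_coefM (bigD1 i') //= big1 ?addr0 => [|i'' i''i]; last first.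
    by rewrite endo_coef_rank1 (negPf i''i) mulr0.
  by rewrite endo_coef_rank1 !eqxx -!mulrA.
pose dd := qre (z j * z j) * qre (z m * z m).
have dd0 : dd != 0 by rewrite mulf_neq0 //; exact: qpure_sqr_neq0.
have zz x i' : x * z i' * z i' = qre (z i' * z i') *: x.
  by rewrite -mulrA {1}qpure_sqr // -scalerAr mulr1.
have coef_zz (s t : A) i' j' q' :
    coef (s * rank1 i' j' (z i' * q' * z j') * t) i l =
    (qre (z i' * z i') * qre (z j' * z j')) *: (coef s i i' * q' * coef t j' l).
  by rewrite coef3 !mulrA !zz -!scalerAl scalerA mulrC.
apply: (scalerI (a := qre (z j * z j) * qre (z m * z m))).
  by rewrite mulf_neq0 //; exact: qpure_sqr_neq0.
have := congr1 (fun f : A => coef f i l) (sand (rank1 j m (z j * q * z m))).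
rewrite adjoint_rank1 !qconjM !(qconj_pure _ (z_pure _)) // !(mulNr, mulrN, opprK) mulrA -rank1N !coef_sum => e1.
rewrite scaler_sumr; under eq_bigr do rewrite -coef_zz.
rewrite -e1 scalerN scaler_sumr -sumrN; apply: eq_bigr => st _.
rewrite -[in LHS]mulNr -[in LHS]mulrN coef_zz mulrN mulNr scalerN.
by congr (- (_ *: _)); rewrite mulrC.
Qed.

Local Notation trd := (endo_trd e).
Local Notation gen := (cl_gen sigma trd).

(** A combination of tensors [rank1 i j s (x) rank1 j l t] is symmetric if the
   corresponding sandwich map [q |-> s q t] kills the scalars: this gives
   [symb_mid].  If [j] and [j'] are distinct, symmetrising the tensor
   [rank1 i j s (x) rank1 j' l t] exchanges [j] and [j'] and conjugates the middle
   factor: this gives [symb_swap]. *)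
Lemma clifford_symbolsP : clifford_symbols z (fun i j s => gen (rank1 i j s)).
Proof.
split.
- by move=> i j s t; rewrite rank1D cl_genD.
- by move=> i j c s; rewrite rank1Z cl_genZ.
- move=> i j s ij; apply/eqP; rewrite -subr_eq0 -cl_genN -cl_genD; apply/eqP.
  rewrite cl_J1; last by rewrite adjointB !adjoint_rank1 qconjK opprK addrC.
  rewrite trdB !trd_rank1 (negPf ij) eq_sym (negPf ij) subrr mul0r.
  exact: rmorph0.
- move=> i s sp; rewrite cl_J1; last first.
    by rewrite adjoint_rank1 qconj_pure // rank1N opprK.
  congr (alg_map _ _); rewrite trd_rank1 eqxx /qtrd -mulr2n -[X in X / _]mulr_natl.
  by rewrite mulrAC divff // mul1r.
- move=> i j l s t.
  have := @cl_J2 _ _ sigma trd [:: (rank1 i j s, rank1 j l t); (rank1 i j (- (s * t)), rank1 j l 1)].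
  rewrite !big_cons !big_nil /= !addr0 !rank1M eqxx => J2.
  rewrite rank1N cl_genN mulNr mulr1 mulNr -rank1D in J2.
  rewrite mulrBr !mulrA -J2; first by rewrite [RHS]addrC subrK.
  move=> f; rewrite !big_cons !big_nil /= !addr0 -rank1N !rank1_sandwich h_adjoint -!rank1D.
  congr rank1; set q := h (e j) _.
  have trdq : q + qconj q = qtrd q *: 1.
    by apply: quatP; rewrite !quat_coordE /= ?mulr0 ?mulr1 ?subrr.
  apply/eqP; rewrite -subr_eq0 -oppr_eq0 opprB; apply/eqP.
  transitivity (s * (q + qconj q) * t - s * t * (q + qconj q)).
    by rewrite !mulrDr !mulrDl !mulr1 !(mulrN, mulNr, opprD, opprK) addrACA.
  by rewrite trdq -!scalerAr -scalerAl !mulr1 subrr.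
- move=> i j j' l s t jj'.
  have := @cl_J2 _ _ sigma trd ((rank1 i j s, rank1 j' l t) ::
    [seq (rank1 i j' (- qweight a b m *: (s * qbase a b m)),
          rank1 j l (qbase a b m * t)) | m : 'I_4]).
  rewrite !big_cons !big_image /= rank1M (negPf jj') add0r.
  rewrite [X in alg_map _ _ * gen X]big1 => [|m _]; last by rewrite rank1M eq_sym (negPf jj').
  rewrite cl_gen0 mulr0 => J2.
  apply/eqP; rewrite -subr_eq0; apply/eqP; rewrite -[RHS]J2.
    rewrite -sumrN; congr (_ + _); apply: eq_bigr => m _.
    by rewrite rank1Z cl_genZ rmorphN !mulNr mulrA.
  (* Both sides are [s q t - s (conj q') t] for [q = h e_j (f e_j')] and [q' = h e_j' (f e_j)]. *)
  move=> f; rewrite !big_cons !big_image /= !rank1_sandwich.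
  have sandw (g : A) : \sum_m rank1 i j' (- qweight a b m *: (s * qbase a b m)) * g
      * rank1 j l (qbase a b m * t) = rank1 i l (- (s * qconj (h (e j') (g (e j))) * t)).
    under eq_bigr do rewrite rank1_sandwich.
    rewrite -rank1_sum; congr rank1; rewrite -(qconj_sandwich char_k a_neq0 b_neq0).
    rewrite mulr_sumr mulr_suml -sumrN; apply: eq_bigr => m _.
    by rewrite -!scalerAl scaleNr -!scalerAr -scalerAl !mulrA.
  rewrite !sandw !h_adjoint qconjN qconjK -!rank1D; congr rank1.
  by rewrite !(mulrN, mulNr, opprK) addrC.
- move=> M M_alg Mc; apply: (cl_gen_ind M_alg) => f.
  rewrite [f]endo_rank1 cl_gen_sum; apply: (subalg_sum M_alg) => i _.
  by rewrite cl_gen_sum; apply: (subalg_sum M_alg) => j _; exact: Mc.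
Qed.

End Endomorphisms.

(** * Nonvanishing of Clifford algebras *)

Lemma sqrt_extension1 (k : fieldType) (x : k) :
  exists (K : fieldType) (iota : {rmorphism k -> K}) (y : K), y * y = iota x.
Proof.
have [[y yx]|no_sqrt] := pselect (exists y : k, y * y = x).
  by exists k, idfun, y.
have sz : size ('X^2 - x%:P : {poly k}) = 3%N by rewrite size_XnsubC.
have irr : irreducible_poly ('X^2 - x%:P : {poly k}).
  apply: cubic_irreducible => [|y]; first by rewrite sz.
  apply/negP; rewrite rootE !hornerE subr_eq0 => /eqP yx.
  by apply: no_sqrt; exists y; rewrite -yx expr2.
have [K _ [y + _]] := irredp_FAdjoin irr.
rewrite rootE rmorphB /= map_polyXn map_polyC !hornerE subr_eq0 => /eqP yx.
by exists K, (in_alg K), y; rewrite -yx expr2.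
Qed.

Lemma sqrt_extension (k : fieldType) (s : seq k) :
  exists (K : fieldType) (iota : {rmorphism k -> K}),
  forall x, x \in s -> exists y : K, y * y = iota x.
Proof.
elim: s => [|x s [K [iota IHs]]]; first by exists k, idfun.
have [K' [iota' [y yx]]] := sqrt_extension1 (iota x).
exists K', (iota' \o iota) => x'; rewrite inE => /predU1P[->|/IHs[y' y'x]].
  by exists y.
by exists (iota' y'); rewrite -rmorphM y'x.
Qed.

Section Matrices2.
Variables (K : fieldType) (R : algebra K).

Definition mx2 (x y u v : R) : 'M[R]_2 :=
  \matrix_(i, j) if i == ord0 then (if j == ord0 then x else y)
                 else (if j == ord0 then u else v).

Lemma mx2M x y u v x' y' u' v' : mx2 x y u v * mx2 x' y' u' v' =
  mx2 (x * x' + y * u') (x * y' + y * v') (u * x' + v * u') (u * y' + v * v').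
Proof.
apply/matrixP => i j; rewrite !mxE !big_ord_recl big_ord0 !mxE /= addr0.
by case: (i == ord0); case: (j == ord0).
Qed.
Lemma mx2D x y u v x' y' u' v' : mx2 x y u v + mx2 x' y' u' v' =
  mx2 (x + x') (y + y') (u + u') (v + v').
Proof.
by apply/matrixP => i j; rewrite !mxE; case: (i == ord0); case: (j == ord0).
Qed.
Lemma mx2N x y u v : - mx2 x y u v = mx2 (- x) (- y) (- u) (- v).
Proof.
by apply/matrixP => i j; rewrite !mxE; case: (i == ord0); case: (j == ord0).
Qed.
Lemma mx2_surj (M : 'M[R]_2) : exists x y u v, M = mx2 x y u v.
Proof.
exists (M ord0 ord0), (M ord0 ord_max), (M ord_max ord0), (M ord_max ord_max).
apply/matrixP => i j; rewrite !mxE.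
have ordP (l : 'I_2) : l = if l == ord0 then ord0 else ord_max.
  by apply: val_inj; case: l => [[|[|m]] lm].
by rewrite [i in LHS]ordP [j in LHS]ordP; case: (i == ord0); case: (j == ord0).
Qed.
Lemma mx2_1 : mx2 1 0 0 1 = 1.
Proof.
apply/matrixP => i j; rewrite !mxE.
by case: i => [[|[|m]] lm]; case: j => [[|[|m']] lm'].
Qed.
Definition mx2_scalar (c : K) : 'M[R]_2 := mx2 c%:sc 0 0 c%:sc.
Fact mx2_scalar_zmod_morphism : zmod_morphism mx2_scalar.
Proof. by move=> c d; rewrite /mx2_scalar mx2N mx2D !oppr0 !addr0 rmorphB. Qed.
Fact mx2_scalar_monoid_morphism : monoid_morphism mx2_scalar.
Proof.
split=> [|c d]; first by rewrite /mx2_scalar rmorph1 mx2_1.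
by rewrite /mx2_scalar mx2M !(mulr0, mul0r, addr0, add0r) rmorphM.
Qed.
HB.instance Definition _ :=
  GRing.isZmodMorphism.Build K 'M[R]_2 mx2_scalar mx2_scalar_zmod_morphism.
HB.instance Definition _ :=
  GRing.isMonoidMorphism.Build K 'M[R]_2 mx2_scalar mx2_scalar_monoid_morphism.
Fact mx2_scalar_central c (x : 'M[R]_2) : mx2_scalar c * x = x * mx2_scalar c.
Proof.
have [x1 [x2 [x3 [x4 ->]]]] := mx2_surj x.
by rewrite /mx2_scalar !mx2M !(mulr0, mul0r, addr0, add0r) !alg_central.
Qed.
Definition mx2_algebra : algebra K := Algebra mx2_scalar_central.

End Matrices2.

(** The Clifford algebra of an orthogonal sum of products of linear forms
   [(g f X + g t Y) (g' f X + g' t Y)] acts on a tensor product of planes: the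
   vectors of a new plane act on the first factor by antidiagonal matrices, and the
   others by [diag(gam, - gam)].  The element [eta i] exchanges the two basis vectors
   of the [i]-th factor, on which the volume element is diagonal of trace zero. *)
Lemma clifford_model (K : fieldType) n (g g' : 'I_n -> bool -> K) :
  exists (R : algebra K) (gam : 'I_n -> bool -> R) (eta : 'I_n -> R),
  [/\ (1 : R) <> 0,
      forall i j p q, gam i p * gam j q + gam j q * gam i p =
        (if i == j then g i p * g' i q + g i q * g' i p else 0)%:sc,
      forall i, eta i * eta i = 1 &
      forall i j, let w := gam j false * gam j true - gam j true * gam j false in
        eta i * w = (-1) ^+ (i == j) * (w * eta i)].
Proof.
elim: n => [|n IHn] in g g' *.
  have KC (c x : K) : idfun c * x = x * idfun c by rewrite mulrC.
  exists (Algebra KC), (fun=> fun=> 0), (fun=> 0).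
  by split=> [|[]|[]|[]] //; apply/eqP; exact: oner_neq0.
have [R [gam [eta [R1 gamC eta1 etaC]]]] :=
  IHn (fun i => g (lift ord0 i)) (fun i => g' (lift ord0 i)).
exists (mx2_algebra R),
  (fun i p => if unlift ord0 i is Some j then mx2 (gam j p) 0 0 (- gam j p)
              else mx2 0 (g i p)%:sc (g' i p)%:sc 0),
  (fun i => if unlift ord0 i is Some j then mx2 (eta j) 0 0 (eta j)
            else mx2 0 1 1 0).
split.
- by rewrite -mx2_1 => /matrixP/(_ ord0 ord0); rewrite !mxE.
- move=> i j p q; rewrite [RHS]/= /mx2_scalar.
  case: (unliftP ord0 i) => [i'|] ->; case: (unliftP ord0 j) => [j'|] ->;
    rewrite !mx2M mx2D !(mulr0, mul0r, addr0, add0r).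
  + by rewrite mulrNN mulrNN gamC (inj_eq lift_inj).
  + rewrite eq_sym (negPf (neq_lift _ _)) rmorph0 !mulrN !mulNr !alg_central.
    by rewrite subrr addNr.
  + rewrite (negPf (neq_lift _ _)) rmorph0 !mulrN !mulNr !alg_central.
    by rewrite subrr addNr.
  + by rewrite eqxx -!rmorphM -!rmorphD; congr (mx2 _%:sc 0 0 _%:sc); ring.
- move=> i; case: (unliftP ord0 i) => [i'|] _; rewrite mx2M !(mulr0, mul0r, addr0, add0r).
    by rewrite eta1 mx2_1.
  by rewrite mulr1 mx2_1.
- move=> i j w; rewrite {}/w.
  have sgn (s : bool) x y u v : ((-1) ^+ s * mx2 x y u v : mx2_algebra R) =
      mx2 ((-1) ^+ s * x) ((-1) ^+ s * y) ((-1) ^+ s * u) ((-1) ^+ s * v).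
    by case: s; rewrite ?expr0 ?mul1r // expr1 !mulN1r mx2N.
  have [s es] : exists s, s = (i == j) by exists (i == j).
  rewrite -es; move: es.
  case: (unliftP ord0 i) => [i'|] ->; case: (unliftP ord0 j) => [j'|] -> es /=;
    rewrite !mx2M !(mulr0, mul0r, addr0, add0r) mx2N mx2D !mx2M sgn;
    rewrite !(mulr0, mul0r, addr0, add0r, subr0, oppr0).
  + by rewrite es !mulrNN !etaC (inj_eq lift_inj).
  + rewrite es eq_sym (negPf (neq_lift _ _)) expr0 !mul1r.
    by rewrite -!rmorphM -!rmorphB !alg_central.
  + rewrite es (negPf (neq_lift _ _)) expr0 !mul1r !mulr1.
    by rewrite !mulrNN.
  + rewrite es eqxx expr1 !mulN1r !mulr1 !mul1r.
    rewrite -!rmorphM -!rmorphB -!rmorphN; congr (mx2 0 _%:sc _%:sc 0); ring.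
Qed.

Section Universal.
Local Open Scope quotient_scope.
Variables (k : fieldType) (A : algebra k) (sigma : A -> A) (trd : A -> k).
Local Notation B := (clifford_algebra sigma trd).
Local Notation cls := (\pi_(clifford sigma trd) : cl_term A -> B).
Local Notation gen := (cl_gen sigma trd).
Variables (C : algebra k) (f : A -> C).
Hypotheses (fD : forall s t, f (s + t) = f s + f t)
  (fZ : forall c s, f (c%:sc * s) = c%:sc * f s)
  (fJ1 : forall s, sigma s = s -> f s = (trd s / 2%:R)%:sc)
  (fJ2 : forall u : seq (A * A),
     (forall x, \sum_(st <- u) st.1 * sigma x * st.2 = \sum_(st <- u) st.1 * x * st.2) ->
     \sum_(st <- u) f st.1 * f st.2 = (2%:R^-1)%:sc * f (\sum_(st <- u) st.1 * st.2)).

Fixpoint cl_eval (t : cl_term A) : C :=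
  match t with
  | CGen s => f s
  | CScal c => c%:sc
  | CAdd x y => cl_eval x + cl_eval y
  | CMul x y => cl_eval x * cl_eval y
  end.

Lemma cl_eval_rel x y : cl_rel sigma trd x y -> cl_eval x = cl_eval y.
Proof.
elim=> {x y} //=.
- by move=> x y z _ -> _ ->.
- by move=> x x' y y' _ -> _ ->.
- by move=> x x' y y' _ -> _ ->.
- by move=> x y z; rewrite addrA.
- by move=> x y; rewrite addrC.
- by move=> x; rewrite rmorph0 add0r.
- by move=> x; rewrite rmorphN1 mulN1r addNr rmorph0.
- by move=> x y z; rewrite mulrA.
- by move=> x; rewrite rmorph1 mul1r.
- by move=> x y z; rewrite mulrDl.
- by move=> x y z; rewrite mulrDr.
- by move=> c d; rewrite rmorphD.
- by move=> c d; rewrite rmorphM.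
- by move=> c x; rewrite alg_central.
- move=> u /fJ2; rewrite fZ => <-.
  elim: u => [|st u IHu] /=; first by rewrite big_nil rmorph0.
  by rewrite big_cons IHu.
Qed.

Definition cl_lift (x : B) : C := cl_eval (repr (x : clifford sigma trd)).

Lemma cl_lift_cls t : cl_lift (cls t) = cl_eval t.
Proof. exact: (cl_eval_rel (cl_repr sigma trd t)). Qed.

Fact cl_lift_zmod_morphism : zmod_morphism cl_lift.
Proof.
suff add x y : cl_lift (x + y) = cl_lift x + cl_lift y.
  by move=> x y; apply: (addIr (cl_lift y)); rewrite -add !subrK.
move: y; elim/cl_ind: x => x; elim/cl_ind => y.
by rewrite -cls_add !cl_lift_cls.
Qed.
Fact cl_lift_monoid_morphism : monoid_morphism cl_lift.
Proof.
split=> [|x y]; first by rewrite -(rmorph1 (@alg_map k C)); exact: (cl_lift_cls (CScal A 1)).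
move: y; elim/cl_ind: x => x; elim/cl_ind => y.
by rewrite -cls_mul !cl_lift_cls.
Qed.

Lemma cl_universal : exists phi : {rmorphism B -> C},
  (forall s, phi (gen s) = f s) /\ (forall c : k, phi c%:sc = c%:sc).
Proof.
pose i1 := GRing.isZmodMorphism.Build B C cl_lift cl_lift_zmod_morphism.
pose i2 := GRing.isMonoidMorphism.Build B C cl_lift cl_lift_monoid_morphism.
pose phi : {rmorphism B -> C} := HB.pack cl_lift i1 i2.
exists phi; split=> [s|c]; [exact: (cl_lift_cls (CGen s)) | exact: (cl_lift_cls (CScal A c))].
Qed.

End Universal.

Definition restrict_scalars (k K : fieldType) (iota : {rmorphism k -> K}) (R : algebra K) :
  algebra k := @Algebra k R (@alg_map K R \o iota) (fun c x => alg_central (iota c) x).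

(** Over a field [K] which splits [A], the elements of [A] are matrices [co s], and
   [beta] is the bilinear form to which [sigma] is adjoint; a matrix becomes the
   corresponding combination of products of two vectors [gam p]. *)
Section Splitting.
Variables (k K : fieldType) (iota : {rmorphism k -> K}).
Hypothesis char_k : (2%:R : k) != 0.
Variables (A : algebra k) (sigma : A -> A) (trd : A -> k).
Variables (P : finType) (co : A -> P -> P -> K) (beta : P -> P -> K).
Hypotheses (coD : forall s t p q, co (s + t) p q = co s p q + co t p q)
  (coZ : forall c s p q, co (c%:sc * s) p q = iota c * co s p q)
  (co_sigma : forall s p q, co (sigma s) p q = co s q p)
  (coM : forall s t p q, co (s * t) p q = \sum_u \sum_v co s p u * beta u v * co t v q)
  (co_trd : forall s, iota (trd s) = \sum_p \sum_q co s p q * beta p q)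
  (co_sandwich : forall u : seq (A * A),
     (forall x, \sum_(st <- u) st.1 * sigma x * st.2 = \sum_(st <- u) st.1 * x * st.2) ->
     forall p q v w, \sum_(st <- u) co st.1 p q * co st.2 v w =
       \sum_(st <- u) co st.1 p v * co st.2 q w).
Variables (R : algebra K) (gam : P -> R).
Hypothesis gamC : forall p q, gam p * gam q + gam q * gam p = (beta p q)%:sc.

Let f (s : A) : R := \sum_p \sum_q (co s p q)%:sc * (gam p * gam q).

Let half : iota (2%:R^-1) = 2%:R^-1. Proof. by rewrite fmorphV rmorph_nat. Qed.
Let char_K : (2%:R : K) != 0. Proof. by rewrite -(rmorph_nat iota) fmorph_eq0. Qed.

Let f_sum I (u : seq I) (F : I -> A) : f (\sum_(i <- u) F i) = \sum_(i <- u) f (F i).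
Proof.
have f0 : f 0 = 0.
  rewrite /f big1 // => p _; rewrite big1 // => q _.
  have -> : co 0 p q = 0 by apply: (addrI (co 0 p q)); rewrite -coD !addr0.
  by rewrite rmorph0 mul0r.
apply: (big_morph f _ f0) => s t; rewrite /f -big_split; apply: eq_bigr => p _ /=.
by rewrite -big_split; apply: eq_bigr => q _; rewrite coD rmorphD mulrDl.
Qed.

(** If the coefficients are symmetric in two consecutive vectors, these can be
   replaced by half of [gam p gam q + gam q gam p], which is a scalar: both families
   of relations follow. *)
Lemma clifford_splitting :
  exists phi : {rmorphism clifford_algebra sigma trd -> R},
  (forall s, phi (cl_gen sigma trd s) = \sum_p \sum_q (co s p q)%:sc * (gam p * gam q))
  /\ forall c : k, phi c%:sc = (iota c)%:sc.
Proof.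
apply: (@cl_universal k A sigma trd (restrict_scalars iota R) f).
- by move=> s t; have := f_sum [:: s; t] id; rewrite !big_cons !big_nil !addr0.
- move=> c s; rewrite /f mulr_sumr; apply: eq_bigr => p _.
  by rewrite mulr_sumr; apply: eq_bigr => q _; rewrite coZ rmorphM -mulrA.
- move=> s ss; have sym p q : co s p q = co s q p by rewrite -co_sigma ss.
  apply: (sc_inj char_K); rewrite [RHS](_ : _ = (iota (trd s))%:sc); last first.
    rewrite /= -rmorphM; congr (alg_map R _).
    by rewrite rmorphM half mulrCA divff // mulr1.
  rewrite rmorph_nat mulr_natl mulr2n co_trd rmorph_sum {2}/f exchange_big -big_split; apply: eq_bigr => p _ /=.
  rewrite rmorph_sum -big_split; apply: eq_bigr => q _ /=.
  by rewrite [co s q p]sym -mulrDr gamC rmorphM.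
- move=> u /co_sandwich sand.
  pose W p q v w : K := \sum_(st <- u) co st.1 p q * co st.2 v w.
  have W_sum (g : P -> P -> P -> P -> R) :
      \sum_(st <- u) \sum_p \sum_q \sum_v \sum_w
        (co st.1 p q * co st.2 v w)%:sc * g p q v w
      = \sum_p \sum_q \sum_v \sum_w (W p q v w)%:sc * g p q v w.
    do 4 (rewrite exchange_big; apply: eq_bigr => ? _ /=).
    by rewrite -mulr_suml -rmorph_sum.
  have fM s t : f s * f t = \sum_p \sum_q \sum_v \sum_w
      (co s p q * co t v w)%:sc * (gam p * gam q * (gam v * gam w)).
    rewrite mulr_suml; apply: eq_bigr => p _; rewrite mulr_suml; apply: eq_bigr => q _.
    rewrite mulr_sumr; apply: eq_bigr => v _; rewrite mulr_sumr; apply: eq_bigr => w _.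
    by rewrite -mulrA mulr_scCA scA.
  have f_mul s t : f (s * t) = \sum_p \sum_q \sum_v \sum_w (co s p q * co t v w)%:sc
      * (gam p * (gam q * gam v + gam v * gam q) * gam w).
    apply: eq_bigr => p _; transitivity (\sum_w \sum_q \sum_v
        (co s p q * co t v w)%:sc * (gam p * (gam q * gam v + gam v * gam q) * gam w)).
      apply: eq_bigr => w _; rewrite coM rmorph_sum mulr_suml; apply: eq_bigr => q _.
      rewrite rmorph_sum mulr_suml; apply: eq_bigr => v _.
      rewrite gamC mulr_scC -(mulrA _ (gam p)) scA; congr (alg_map R _ * _).
      by rewrite mulrAC.
    by rewrite exchange_big; apply: eq_bigr => q _; rewrite exchange_big.
  apply: (sc_inj char_K); rewrite mulrA /= -rmorphM half mulfV // rmorph1 mul1r.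
  rewrite f_sum; under [RHS]eq_bigr do rewrite f_mul.
  rewrite rmorph_nat mulr_natl mulr2n.
  have swap : \sum_(st <- u) f st.1 * f st.2 = \sum_p \sum_q \sum_v \sum_w
      (W p q v w)%:sc * (gam p * (gam v * gam q) * gam w).
    under eq_bigr do rewrite fM.
    rewrite W_sum; apply: eq_bigr => p _; rewrite exchange_big /=.
    apply: eq_bigr => q _; apply: eq_bigr => v _; apply: eq_bigr => w _.
    by rewrite /W sand !mulrA.
  rewrite {2}swap; under eq_bigr do rewrite fM.
  rewrite !W_sum -big_split; apply: eq_bigr => p _ /=.
  rewrite -big_split; apply: eq_bigr => q _ /=.
  rewrite -big_split; apply: eq_bigr => v _ /=.
  rewrite -big_split; apply: eq_bigr => w _ /=.
  by rewrite -[LHS]mulrDr; congr (_ * _); rewrite mulrDr mulrDl !mulrA.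
Qed.

End Splitting.

Section QuaternionSplitting.
Variables (k K : fieldType) (a b : k) (iota : {rmorphism k -> K}) (al : K).
Hypotheses (char_k : (2%:R : k) != 0) (a_neq0 : a != 0) (b_neq0 : b != 0)
  (al_sqr : al * al = iota a).
Local Notation Q := (quat a b).

(** With [J] the matrix with rows (0, 1) and (-1, 0), and [psi] the representation
   of the quaternion algebra on [K^2] for which i is diagonal, these are the
   matrices [psi(s) J] and [J^-1 psi(s)]. *)
Definition split_vec (s : Q) (p q : bool) : K :=
  match p, q with
  | false, false => - iota b * (iota (qj s) + al * iota (qij s))
  | false, true => iota (qre s) + al * iota (qi s)
  | true, false => al * iota (qi s) - iota (qre s)
  | true, true => iota (qj s) - al * iota (qij s)
  end.
Definition split_form (s : Q) (p q : bool) : K :=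
  match p, q with
  | false, false => al * iota (qij s) - iota (qj s)
  | false, true => al * iota (qi s) - iota (qre s)
  | true, false => iota (qre s) + al * iota (qi s)
  | true, true => iota b * (iota (qj s) + al * iota (qij s))
  end.

Lemma sum_bool (U : nmodType) (F : bool -> U) : \sum_p F p = F true + F false.
Proof. by rewrite big_bool. Qed.

Lemma split_vecD s t p q : split_vec (s + t) p q = split_vec s p q + split_vec t p q.
Proof. by case: p; case: q; rewrite /split_vec !quat_coordE !rmorphD; ring. Qed.
Lemma split_vecZ c s p q : split_vec (c *: s) p q = iota c * split_vec s p q.
Proof. by case: p; case: q; rewrite /split_vec !quat_coordE !rmorphM; ring. Qed.
Lemma split_vec0 p q : split_vec 0 p q = 0.
Proof. by rewrite -(scale0r (0 : Q)) split_vecZ rmorph0 mul0r. Qed.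
Lemma split_vecN s p q : split_vec (- s) p q = - split_vec s p q.
Proof. by rewrite -scaleN1r split_vecZ rmorphN1 mulN1r. Qed.
Lemma split_vec_conj s p q : split_vec (- qconj s) p q = split_vec s q p.
Proof. by case: p; case: q; rewrite /split_vec /= !rmorphN; ring. Qed.
Lemma split_form_conj s p q : split_form (qconj s) p q = - split_form s q p.
Proof. by case: p; case: q; rewrite /split_form /= ?rmorphN; ring. Qed.

Lemma split_vecM s t w p q : split_vec (s * t * w) p q =
  \sum_u \sum_v split_vec s p u * split_form t u v * split_vec w v q.
Proof.
rewrite !sum_bool /split_vec /split_form; case: p; case: q;
  rewrite !quat_coordE !(rmorphD, rmorphB, rmorphN, rmorphM) -al_sqr; ring.
Qed.

Lemma split_trd s t : qre t = 0 ->
  iota (qtrd (s * t)) = \sum_p \sum_q split_vec s p q * split_form t p q.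
Proof.
move=> t0; rewrite !sum_bool /split_vec /split_form /qtrd.
rewrite !quat_coordE t0 !(rmorphD, rmorphB, rmorphN, rmorphM, rmorph0) -al_sqr; ring.
Qed.

Lemma split_form_span (D : bool -> bool -> K) :
  (forall s, \sum_u \sum_v D u v * split_form s u v = 0) -> forall u v, D u v = 0.
Proof.
have two : (2%:R : K) != 0 by rewrite -(rmorph_nat iota) fmorph_eq0.
have al0 : al != 0.
  by apply: contraNneq a_neq0 => al0; rewrite -(fmorph_eq0 iota) -al_sqr al0 mulr0.
have b0 : iota b != 0 by rewrite fmorph_eq0.
have red (c x : K) : c != 0 -> c * x = 0 -> x = 0.
  by move=> c0 /eqP; rewrite mulf_eq0 (negPf c0) => /eqP.
move=> D0; have := (D0 (Quat a b 1 0 0 0), D0 (Quat a b 0 1 0 0),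
                    D0 (Quat a b 0 0 1 0), D0 (Quat a b 0 0 0 1)).
rewrite !sum_bool /split_form /= !rmorph0 !rmorph1 => -[[[e0 e1] e2] e3].
have {}e0 : D true false = D false true.
  by apply/eqP; rewrite -subr_eq0 -[X in _ == X]e0; apply/eqP; ring.
have {}e2 : D false false = iota b * D true true.
  by apply/esym/eqP; rewrite -subr_eq0 -[X in _ == X]e2; apply/eqP; ring.
have ft : D false true = 0.
  apply: (red (2%:R * al)); first exact: mulf_neq0.
  by rewrite -[RHS]e1 e0; ring.
have tt : D true true = 0.
  apply: (red (2%:R * al * iota b)); first by rewrite !mulf_neq0.
  by rewrite -[RHS]e3 e2; ring.
have ff : D false false = 0 by rewrite e2 tt mulr0.
have tf : D true false = 0 by rewrite e0.
by case; case.
Qed.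

(** The discriminant of this binary form is the square of [s], which is a square in
   [K]; so the form is a product of linear forms. *)
Lemma split_form_factor s (dl : K) : qre s = 0 -> dl * dl = iota (qre (s * s)) ->
  exists g g' : bool -> K, forall p q, split_form s p q = g p * g' q + g q * g' p.
Proof.
have two : (2%:R : K) != 0 by rewrite -(rmorph_nat iota) fmorph_eq0.
move=> s0; rewrite !quat_coordE s0 mulr0 add0r !(rmorphD, rmorphB, rmorphN, rmorphM) -al_sqr.
rewrite /split_form s0 rmorph0.
set x := iota (qi s); set y := iota (qj s); set w := iota (qij s); set be := iota b.
move=> disc; have [p0|p0] := eqVneq (al * w - y) 0.
  have -> : y = al * w by apply/eqP; rewrite eq_sym -subr_eq0 p0.
  exists (fun p => if p then be * al * w else al * x), (fun p => if p then 1 else 0).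
  by case; case; ring.
exists (fun p => if p then (al * x + dl) / (2%:R * (al * w - y)) else 2%:R^-1),
  (fun p => if p then al * x - dl else al * w - y).
case; case; rewrite /=; try by field; rewrite ?two ?p0.
have -> : be * (y + al * w) = ((al * x) * (al * x) - dl * dl) / (al * w - y).
  by rewrite disc; field.
by field; rewrite two p0.
Qed.

End QuaternionSplitting.

Section Independence.
Variables (k : fieldType) (a b : k).
Hypotheses (char_k : (2%:R : k) != 0) (a_neq0 : a != 0) (b_neq0 : b != 0).
Local Notation Q := (quat a b).
Variables (V : rmodType Q) (h : V -> V -> Q).
Hypotheses (h_antiherm : antihermitian h) (h_nondeg : nondegenerate_form h).
Variables (r : nat) (e : 'I_r -> V).
Hypothesis e_basis : rbasis e.
Variable z : 'I_r -> Q.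
Hypotheses (h_diag : forall i j, h (e i) (e j) = if i == j then z i else 0)
  (z_pure : forall i, qpure (z i)) (z_inv : forall i, qinvertible (z i)).
Variable sigma : endo_algebra V -> endo_algebra V.
Hypothesis sigma_adj : adjoint_involution h sigma.

Local Notation A := (endo_algebra V).
Local Notation gen := (cl_gen sigma (endo_trd e)).
Local Notation rk := (rank1 h_antiherm e).
Local Notation coef := (endo_coef e z).
Local Notation xi := (fun i => gen (rk i i 1)).
Local Notation d := (fun i => qre (z i * z i)).

Let c_symb : clifford_symbols z (fun i j s => gen (rk i j s)).
Proof. exact: clifford_symbolsP. Qed.

Section Split.
Variables (K : fieldType) (iota : {rmorphism k -> K}) (al : K).
Hypothesis al_sqr : al * al = iota a.

Local Notation P := ('I_r * bool)%type.
Let co (f : A) (p q : P) : K := split_vec iota al (coef f p.1 q.1) p.2 q.2.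
Let beta (p q : P) : K := if p.1 == q.1 then split_form iota al (z p.1) p.2 q.2 else 0.

Let sum_pair (F : P -> K) : \sum_p F p = \sum_i \sum_u F (i, u).
Proof. by rewrite pair_bigA; apply: eq_bigr => -[]. Qed.

Let co_sandwich (u : seq (A * A)) :
  (forall x, \sum_(st <- u) st.1 * sigma x * st.2 = \sum_(st <- u) st.1 * x * st.2) ->
  forall p q v w, \sum_(st <- u) co st.1 p q * co st.2 v w =
    \sum_(st <- u) co st.1 p v * co st.2 q w.
Proof.
move=> sand [i p] [j q] [m v] [l w]; apply/eqP; rewrite -subr_eq0; apply/eqP.
pose D q v : K := \sum_(st <- u) co st.1 (i, p) (j, q) * co st.2 (m, v) (l, w)
  - \sum_(st <- u) co st.1 (i, p) (m, v) * co st.2 (j, q) (l, w).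
move: q v; apply: (@split_form_span k K a b iota al char_k a_neq0 b_neq0 al_sqr D) => s.
have svM (F : A * A -> Q) : split_vec iota al (\sum_(st <- u) F st) p w =
    \sum_(st <- u) split_vec iota al (F st) p w.
  apply: (big_morph (fun x : Q => split_vec iota al x p w)); last exact: split_vec0.
  by move=> x y; exact: split_vecD.
have sum_form i' j' m' l' t : \sum_(st <- u) \sum_q \sum_v
    co st.1 (i', p) (j', q) * split_form iota al t q v * co st.2 (m', v) (l', w) =
    split_vec iota al (\sum_(st <- u) coef st.1 i' j' * t * coef st.2 m' l') p w.
  by rewrite svM; apply: eq_bigr => st _; rewrite split_vecM.
transitivity (split_vec iota al (\sum_(st <- u) coef st.1 i j * s * coef st.2 m l) p w
  + split_vec iota al (\sum_(st <- u) coef st.1 i m * qconj s * coef st.2 j l) p w).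
  have swap (F : A * A -> bool -> bool -> K) : \sum_(st <- u) \sum_q \sum_v F st q v
      = \sum_q \sum_v \sum_(st <- u) F st q v.
    by rewrite exchange_big; apply: eq_bigr => q _; rewrite exchange_big.
  rewrite -!sum_form !swap [X in _ + X]exchange_big -big_split; apply: eq_bigr => q _.
  rewrite -big_split; apply: eq_bigr => v _ /=.
  rewrite /D mulrBl !mulr_suml -sumrN -!big_split; apply: eq_bigr => st _ /=.
  by rewrite split_form_conj; ring.
by rewrite (endo_coef_sandwich char_k h_antiherm h_nondeg e_basis h_diag z_pure z_inv sigma_adj sand) split_vecN addNr.
Qed.

(** The coefficients of [rank1 i i 1] are the entries of [J], so that [xi i] becomes a
   commutator, which is twice the volume element of the [i]-th plane when the two
   vectors are orthogonal. *)
Lemma exists_splitting (R : algebra K) (gam : 'I_r -> bool -> R) :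
  (forall i j p q, gam i p * gam j q + gam j q * gam i p =
     (if i == j then split_form iota al (z i) p q else 0)%:sc) ->
  exists phi : {rmorphism clifford_algebra sigma (endo_trd e) -> R},
  (forall i, phi (xi i) = gam i false * gam i true - gam i true * gam i false) /\
  forall c : k, phi c%:sc = (iota c)%:sc.
Proof.
move=> gamC.
have coD s t p q : co (s + t) p q = co s p q + co t p q.
  by rewrite /co endo_coefD // split_vecD.
have coZ c s p q : co (c%:sc * s) p q = iota c * co s p q.
  by rewrite /co endo_coefZ // split_vecZ.
have co_sigma s p q : co (sigma s) p q = co s q p.
  rewrite /co (endo_coef_adjoint char_k h_antiherm e_basis h_diag z_pure z_inv sigma_adj).
  exact: split_vec_conj.
have coM s t p q : co (s * t) p q = \sum_u \sum_v co s p u * beta u v * co t v q.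
  rewrite /co endo_coefM // sum_pair.
  have sv (F : 'I_r -> Q) : split_vec iota al (\sum_l F l) p.2 q.2 =
      \sum_l split_vec iota al (F l) p.2 q.2.
    apply: (big_morph (fun x : Q => split_vec iota al x p.2 q.2)); last exact: split_vec0.
    by move=> x y; exact: split_vecD.
  rewrite sv; apply: eq_bigr => l _; rewrite split_vecM //; apply: eq_bigr => u _.
  rewrite sum_pair (bigD1 l) //= [X in _ = _ + X]big1 ?addr0 => [|l' l'l]; last first.
    by rewrite big1 // => v _; rewrite /beta /= eq_sym (negPf l'l) mulr0 mul0r.
  by apply: eq_bigr => v _; rewrite /beta /= eqxx.
have co_trd s : iota (endo_trd e s) = \sum_p \sum_q co s p q * beta p q.
  rewrite (endo_coef_trd char_k e z_pure z_inv) sum_pair.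
  have trd_sum (F : 'I_r -> Q) : iota (qtrd (\sum_l F l)) = \sum_l iota (qtrd (F l)).
    apply: (big_morph (fun x : Q => iota (qtrd x))) => [x y|].
      by rewrite qtrdD rmorphD.
    by rewrite /qtrd addr0 rmorph0.
  rewrite trd_sum; apply: eq_bigr => i _.
  rewrite (split_trd al_sqr) ?qpure_re //; apply: eq_bigr => u _.
  rewrite sum_pair (bigD1 i) //= [X in _ = _ + X]big1 ?addr0 => [|i' i'i]; last first.
    by rewrite big1 // => v _; rewrite /beta /= eq_sym (negPf i'i) mulr0.
  by apply: eq_bigr => v _; rewrite /beta /= eqxx.
have gamP p q : gam p.1 p.2 * gam q.1 q.2 + gam q.1 q.2 * gam p.1 p.2 = (beta p q)%:sc.
  exact: gamC.
have [phi [phi_gen phi_sc]] := @clifford_splitting k K iota char_k A sigma (endo_trd e)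
  _ co beta coD coZ co_sigma coM co_trd co_sandwich R (fun p => gam p.1 p.2) gamP.
exists phi; split=> // i; rewrite phi_gen.
have sum_pairR (F : P -> R) : \sum_p F p = \sum_i \sum_u F (i, u).
  by rewrite pair_bigA; apply: eq_bigr => -[].
rewrite sum_pairR (bigD1 i) //= [X in _ + X]big1 ?addr0 => [|i' i'i]; last first.
  rewrite big1 // => u _; rewrite big1 // => q _; rewrite /co endo_coef_rank1 //=.
  by rewrite (negPf i'i) split_vec0 rmorph0 mul0r.
have row u : \sum_q (co (rk i i 1) (i, u) q)%:sc * (gam i u * gam q.1 q.2) =
    \sum_v (split_vec iota al (1 : Q) u v)%:sc * (gam i u * gam i v).
  rewrite sum_pairR (bigD1 i) //= [X in _ + X]big1 ?addr0 => [|i' i'i]; last first.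
    rewrite big1 // => v _; rewrite /co endo_coef_rank1 //=.
    by rewrite (negPf i'i) andbF split_vec0 rmorph0 mul0r.
  by apply: eq_bigr => v _; rewrite /co endo_coef_rank1 //= !eqxx.
under eq_bigr do rewrite row.
have e00 : split_vec iota al (1 : Q) false false = 0 by rewrite /split_vec /= rmorph0; ring.
have e01 : split_vec iota al (1 : Q) false true = 1 by rewrite /split_vec /= rmorph0 rmorph1; ring.
have e10 : split_vec iota al (1 : Q) true false = -1 by rewrite /split_vec /= rmorph0 rmorph1; ring.
have e11 : split_vec iota al (1 : Q) true true = 0 by rewrite /split_vec /= rmorph0; ring.
rewrite !sum_bool e00 e01 e10 e11 !rmorph0 rmorphN1 rmorph1 !mul0r mulN1r mul1r.
by rewrite add0r addr0 addrC.
Qed.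

End Split.

Lemma xi_multiquadratic : multiquadratic xi d.
Proof.
have xiC i j : xi i * xi j = xi j * xi i by exact: (xi_comm char_k a_neq0 b_neq0 z_pure z_inv c_symb).
have xi2 i : xi i * xi i = (d i)%:sc by exact: (xi_sqr char_k z_pure z_inv c_symb).
have d0 i : d i != 0 by exact: qpure_sqr_neq0.
split=> // c sum0.
have [K [iota roots]] := sqrt_extension (a :: (map d (enum 'I_r))).
have [al al2] := roots a (mem_head _ _).
have rt i : exists y : K, y * y = iota (d i).
  by apply: roots; rewrite inE; apply/orP; right; apply: (map_f d); rewrite mem_enum.
have fac i : exists gg : (bool -> K) * (bool -> K), forall p q,
    split_form iota al (z i) p q = gg.1 p * gg.2 q + gg.1 q * gg.2 p.
  have [dl dl2] := rt i.
  have [g [g' gg']] := split_form_factor char_k al2 (qpure_re char_k (z_pure i)) dl2.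
  by exists (g, g').
have [gg ggP] := choice fac.
have [R [gam [eta [R1 gamC eta2 eta_gam]]]] := clifford_model (fun i => (gg i).1) (fun i => (gg i).2).
have gamP i j p q : gam i p * gam j q + gam j q * gam i p =
     (if i == j then split_form iota al (z i) p q else 0)%:sc.
  by rewrite gamC ggP.
have [phi [phi_xi phi_sc]] := exists_splitting al2 gamP.
apply: (@mon_indep k (restrict_scalars iota R) char_k _ (fun i => phi (xi i)) eta d) => //.
- by move=> i j; rewrite -!rmorphM xiC.
- by move=> i; rewrite -[RHS]phi_sc -xi2 rmorphM.
- by move=> i j; rewrite phi_xi; exact: eta_gam.
- by move=> i u ue; rewrite -[u]mulr1 -(eta2 i) mulrA ue mul0r.
have := congr1 phi sum0; rewrite rmorph0 rmorph_sum.
by under eq_bigr do rewrite rmorphM phi_sc rmorph_mon.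
Qed.

Lemma exists_sqrt_xi : exists (K : fieldType) (iota : {rmorphism k -> K}) (rt : 'I_r -> K),
  forall i, rt i * rt i = iota (d i).
Proof.
have [K [iota roots]] := sqrt_extension (map d (enum 'I_r)).
have /choice[rt rtP] i : exists y : K, y * y = iota (d i).
  by apply: roots; apply: (map_f d); rewrite mem_enum.
by exists K, iota, rt.
Qed.

End Independence.

(** * The Galois group *)

Lemma Z2_cases (x : 'Z_2) : x = 0 \/ x = 1.
Proof.
by case: x => [[|[|m]] lm] //; [left | right]; exact: val_inj.
Qed.

Section Signs.
Variable K : pzRingType.

Lemma signZ2D (x y : 'Z_2) : (-1) ^+ (x + y)%R = (-1) ^+ x * (-1) ^+ y :> K.
Proof.
by have [-> | ->] := Z2_cases x; have [-> | ->] := Z2_cases y;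
  rewrite /= ?expr0 ?expr1 ?mulr1 ?mul1r // mulrNN mulr1.
Qed.

Lemma signZ2_sum (I : finType) (F : I -> 'Z_2) :
  \prod_i (-1) ^+ (F i) = (-1) ^+ (\sum_i F i)%R :> K.
Proof.
symmetry; apply: (big_morph (fun x : 'Z_2 => (-1) ^+ x : K)) => // x y.
exact: signZ2D.
Qed.
End Signs.

Definition even_signs r : {set 'rV['Z_2]_r} :=
  finset (fun g : 'rV['Z_2]_r => \sum_i g 0 i == 0).

Lemma flip2_even r (p q : 'I_r) : p != q -> flip2 p q \in even_signs r.
Proof.
move=> pq; rewrite inE; under eq_bigr do rewrite mxE.
rewrite (bigD1 p) //= (bigD1 q) 1?eq_sym //= !eqxx orbT big1 ?addr0.
  by apply/eqP; apply: val_inj.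
by move=> i /andP[/negPf-> /negPf->].
Qed.

(** An even [g] is the product of the [flip2 0 j] for the nonzero components [g j] with
   [j] distinct from 0: the component of index 0 is then right as well. *)
Lemma even_signs_gen r :
  even_signs r = <<finset (fun g : 'rV['Z_2]_r => [exists p, exists q,
                       (p != q) && (g == flip2 p q)])>>%g.
Proof.
set S := finset _; apply/eqP; rewrite finset.eqEsubset; apply/andP; split; last first.
  have grp : group_set (even_signs r).
    apply/group_setP; split=> [|g g']; rewrite !inE.
      by rewrite big1 // => i _; rewrite mxE.
    move=> /eqP g0 /eqP g'0; under eq_bigr do rewrite mxE.
    by rewrite big_split /= g0 g'0 addr0.
  rewrite (gen_subG S (Group grp)); apply/fintype.subsetP => g; rewrite inE.
  by move=> /existsP[p /existsP[q /andP[pq /eqP ->]]]; exact: flip2_even.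
apply/fintype.subsetP; case: r @S => [|n] S g; rewrite inE => /eqP g0.
  by rewrite (_ : g = 1%g) ?group1 //; apply/rowP => -[].
have -> : g = (\prod_(j | g ord0 (lift ord0 j) != 0) flip2 ord0 (lift ord0 j))%g.
  have sumE (P : pred 'I_n) (i : 'I_n.+1) :
      (\prod_(j | P j) flip2 ord0 (lift ord0 j))%g ord0 i
      = (\sum_(j | P j) flip2 ord0 (lift ord0 j) ord0 i)%R.
    by elim/big_rec2: _ => [|j x y _ <-]; rewrite mxE.
  have ifZ2 (x : 'Z_2) : (if x != 0 then 1 else 0) = x by have [-> | ->] := Z2_cases x.
  apply/rowP => i; rewrite sumE; case: (unliftP ord0 i) => [i'|] ->.
    rewrite big_mkcond (bigD1 i') //= mxE eqxx orbT ifZ2 big1 ?addr0 // => j ji.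
    have l0 : (lift ord0 i' == ord0) = false by rewrite eq_sym (negPf (neq_lift _ _)).
    rewrite mxE (inj_eq lift_inj) l0 [i' == j]eq_sym (negPf ji).
    by case: ifP.
  rewrite big_mkcond; under eq_bigr do rewrite mxE eqxx ifZ2.
  move: g0; rewrite big_ord_recl => /eqP; rewrite addr_eq0 => /eqP ->.
  by have [-> | ->] := Z2_cases (\sum_(i0 < n) g 0 (lift ord0 i0)); apply: val_inj.
apply: group_prod => j _; apply: mem_gen; rewrite inE.
by apply/existsP; exists ord0; apply/existsP; exists (lift ord0 j); rewrite neq_lift eqxx.
Qed.

Section GaloisAction.
Variables (k : fieldType) (B : algebra k) (r : nat).
Hypothesis char_k : (2%:R : k) != 0.
Variables (xi : 'I_r -> B) (d : 'I_r -> k).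
Hypothesis xi_mq : multiquadratic xi d.
Local Notation L := (generated_subalgebra (range xi)).

Let L_alg : subalgebra L. Proof. exact: generated_is_subalgebra. Qed.
Let L_xi i : L (xi i). Proof. by apply: sub_generated; exists i. Qed.

Definition sign_of (g : 'rV['Z_2]_r) (i : 'I_r) : k := (-1) ^+ (g 0 i).
Definition sign_act (g : 'rV['Z_2]_r) : B -> B := twist xi (sign_of g).

Lemma sign_of_sqr g i : sign_of g i * sign_of g i = 1.
Proof. by rewrite -expr2 sqrr_sign. Qed.

Lemma sign_act_xi g i : sign_act g (xi i) = (-1) ^+ (g 0 i) * xi i.
Proof.
by rewrite /sign_act (twist_xi xi_mq (sign_of_sqr g)) /sign_of rmorphXn rmorphN1.
Qed.

Lemma sign_actM g g' x : L x -> sign_act (g * g')%g x = sign_act g (sign_act g' x).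
Proof.
move=> Lx; rewrite /sign_act (twist_twist xi_mq (sign_of_sqr g) (sign_of_sqr g')) //.
by congr (twist xi _ x); apply/funext => i; rewrite /sign_of mxE signZ2D.
Qed.

Lemma xi_neq0 i : xi i = 0 -> False.
Proof.
move=> xi0; have := mq_sqr xi_mq i; rewrite xi0 mulr0 => /esym d0.
have := mq_ind xi_mq (c := fun S => if S == finset.set0 then d i else 0).
move=> /(_ _ finset.set0); rewrite eqxx => dS.
have /eqP := mq_neq0 xi_mq i; apply; apply: dS.
rewrite (bigD1 finset.set0) //= eqxx mon0 mulr1 d0 big1 ?addr0 // => S /negPf ->.
by rewrite rmorph0 mul0r.
Qed.

Lemma multiquad_galois : galois_algebra L sign_act.
Proof.
have act1 x : L x -> sign_act 1%g x = x.
  move=> Lx; apply: (mqcoord_inj xi_mq) => [||S] //; first exact: twist_in.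
  rewrite (mqcoord_twist xi_mq) // big1 ?mul1r // => i _; by rewrite /sign_of mxE expr0.
have actK g x : L x -> sign_act g (sign_act g x) = x.
  move=> Lx; rewrite -sign_actM // (_ : (g * g)%g = 1%g) ?act1 //.
  by apply/rowP => i; rewrite !mxE; have [-> | ->] := Z2_cases (g 0 i); apply: val_inj.
split.
- move=> g; split.
  + split=> [x Lx|x y /set_mem Lx /set_mem Ly xy|x Lx]; first exact: twist_in.
      by rewrite -(actK g x) // xy actK.
    by exists (sign_act g x); [exact: twist_in | exact: actK].
  + by move=> c; exact: (twist_sc xi_mq).
  + by move=> x y; exact: (twistD xi_mq).
  + by move=> x y; exact: (twistM xi_mq (sign_of_sqr g)).
- by move=> g g' x; exact: sign_actM.
- move=> g fixg; apply/rowP => i; rewrite mxE.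
  have [//|g1] := Z2_cases (g 0 i).
  have := fixg _ (L_xi i); rewrite sign_act_xi g1 expr1 mulN1r => /esym/(eq_opp0 char_k).
  by move/xi_neq0.
- rewrite (_ : #|_| = #|{: {set 'I_r}}|).
    by exists (fun i => mon xi (enum_val i)); exact: (multiquad_kbasis xi_mq).
  by rewrite card_mx mul1n card_ord -cardsT -powersetT card_powerset cardsT card_ord.
apply/seteqP; split=> [x [Lx fx]|_ [c _ <-]]; last first.
  by split=> [|g]; [exact: subalg_sc | exact: (twist_sc xi_mq)].
exists (mqcoord xi x finset.set0) => //.
rewrite [RHS](mqcoordE xi_mq Lx) (bigD1 finset.set0) //= mon0 mulr1 big1 ?addr0 // => S /set0Pn[i iS].
rewrite (twist_fixed char_k xi_mq Lx (fx (delta_mx 0 i))) ?rmorph0 ?mul0r //.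
rewrite (bigD1 i) //= big1 => [|j /andP[_ /negPf ji]]; rewrite /sign_of mxE eqxx.
  by rewrite eqxx mulr1.
by rewrite ji.
Qed.

Lemma multiquad_conj (y : B) (g : 'rV['Z_2]_r) : (forall i, y * xi i = (-1) ^+ (g 0 i) * (xi i * y)) ->
  forall x, L x -> y * x = sign_act g x * y.
Proof.
move=> y_xi x Lx; apply: (twist_conj xi_mq (sign_of_sqr g)) => // i.
by rewrite y_xi rmorphXn rmorphN1.
Qed.

Lemma multiquad_anti (tau : B -> B) (g : 'rV['Z_2]_r) : (forall x y, tau (x + y) = tau x + tau y) ->
  (forall x y, tau (x * y) = tau y * tau x) -> (forall c : k, tau c%:sc = c%:sc) ->
  (forall i, tau (xi i) = (-1) ^+ (g 0 i) * xi i) ->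
  forall x, L x -> tau x = sign_act g x.
Proof.
move=> tauD tauM tau_sc tau_xi; apply: gen_ind => [c|_ [i _ <-]|x x' Lx Lx' xP x'P|x x' Lx Lx' xP x'P].
- by rewrite tau_sc /sign_act (twist_sc xi_mq).
- by rewrite tau_xi sign_act_xi.
- by rewrite tauD xP x'P /sign_act (twistD xi_mq).
- rewrite tauM xP x'P /sign_act (twistM xi_mq (sign_of_sqr g)) //.
  by apply: (multiquad_comm xi_mq); exact: twist_in.
Qed.

End GaloisAction.

(** * Structure of the Clifford algebra *)

Section Assembly.
Variables (k : fieldType) (a b : k).
Hypotheses (char_k : (2%:R : k) != 0) (a_neq0 : a != 0) (b_neq0 : b != 0).
Local Notation Q := (quat a b).
Variables (n : nat) (z : 'I_n.+1 -> Q).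
Hypotheses (z_pure : forall i, qpure (z i)) (z_inv : forall i, qinvertible (z i))
  (z_indep : forall p q, p != q -> forall s t : k,
     s *: z p + t *: z q = 0 -> s = 0 /\ t = 0).
Variables (B : algebra k) (c : 'I_n.+1 -> 'I_n.+1 -> Q -> B).
Hypothesis c_symb : clifford_symbols z c.
Local Notation xi := (fun i => c i i 1).
Local Notation d := (fun i => qre (z i * z i)).
Hypothesis xi_mq : multiquadratic xi d.
Local Notation L := (generated_subalgebra (range xi)).

Let L_alg : subalgebra L. Proof. exact: generated_is_subalgebra. Qed.
Let L_xi i : L (xi i). Proof. by apply: sub_generated; exists i. Qed.

Lemma symb_xi p q s i : p != q ->
  c p q s * xi i = (-1) ^+ (flip2 p q 0 i) * (xi i * c p q s).
Proof.
move=> pq; rewrite mxE; have [->|ip] := eqVneq i p.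
  by rewrite expr1 mulN1r (xi_symb_anticomml char_k z_pure z_inv c_symb) // opprK.
have [->|iq] := eqVneq i q.
  by rewrite expr1 mulN1r (xi_symb_anticommr char_k z_pure z_inv c_symb) // opprK.
by rewrite expr0 mul1r (xi_symb_comm char_k a_neq0 b_neq0 z_pure z_inv c_symb) // eq_sym.
Qed.

(** The condition says that the square of [c p q w], which lies in the quadratic algebra
   generated by [xi p xi q], has nonzero norm. *)
Lemma symb_unit p q w : p != q ->
  qtrd (z p * (w * z q * qconj w)) ^+ 2 - 4%:R * (qnrd w ^+ 2 * (d p * d q)) != 0 ->
  exists2 y, L y & c p q w * (c p q w * y) = 1 /\ c p q w * y * c p q w = 1.
Proof.
move=> pq N0; set v := c p q w; pose t := qre (z p * (w * z q * qconj w)).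
pose X := xi p * xi q.
have XX : X * X = (d p * d q)%:sc.
  rewrite /X -mulrA (mulrA (xi q)) (mq_comm xi_mq q p) -!mulrA (mq_sqr xi_mq q) mulrA.
  by rewrite (mq_sqr xi_mq p) rmorphM.
have {}N0 : t ^+ 2 - qnrd w ^+ 2 * (d p * d q) != 0.
  apply: contraNneq N0 => N0; apply/eqP.
  by rewrite -[RHS](mulr0 4%:R) -N0 /qtrd -/t; ring.
have vv : v * v = (2%:R^-1)%:sc * (t%:sc - (qnrd w)%:sc * X).
  exact: (symb_sqr_twist char_k a_neq0 b_neq0 z_pure c_symb).
have [y Ly vvy] : exists2 y, L y & v * v * y = 1.
  exists (2%:sc * (((t ^+ 2 - (qnrd w) ^+ 2 * (d p * d q))^-1)%:sc *
                    (t%:sc + (qnrd w)%:sc * X))).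
    do 2 (apply: (subalgM L_alg); first exact: subalg_sc).
    apply: (subalgD L_alg); first exact: subalg_sc.
    by apply: (subalgM L_alg); [exact: subalg_sc | exact: (subalgM L_alg)].
  rewrite vv mulr_scCA -!(mulrA (2^-1)%:sc) scA divff // rmorph1 mul1r.
  exact: quadratic_unit.
have Lvv : L (v * v) by exact: (symb_mul_same char_k z_pure c_symb).
have yvv : y * (v * v) = 1 by rewrite (multiquad_comm xi_mq).
exists y => //; split; first by rewrite mulrA.
have -> : v * y = y * v.
  by rewrite -[v * y]mul1r -yvv -(mulrA y) -(mulrA v) (mulrA v v y) vvy mulr1.
by rewrite -mulrA.
Qed.

Lemma symb_twist_unit p q : p != q -> exists w, exists2 y, L y &
  c p q w * (c p q w * y) = 1 /\ c p q w * y * c p q w = 1.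
Proof.
move=> pq; have [w N0] := gram_twist char_k a_neq0 b_neq0 (z_pure p) (z_inv p)
  (z_pure q) (z_inv q) (z_indep pq).
by exists w; exact: symb_unit.
Qed.

Let sign_flip (j : 'I_n) : sign_of k (flip2 ord0 (lift ord0 j)) = star_sign k j.
Proof.
apply/funext => i; rewrite /sign_of /star_sign mxE.
have [->|_] := eqVneq i ord0; first by rewrite (negPf (neq_lift _ _)).
by case: (i == _).
Qed.

(** Choosing invertible elements [v j = c 0 j (w j)] turns the algebra into a crossed
   product over [L]: the products [c 0 j s * v j] are in [L], so that
   [c 0 j s] is in [L v j], and the exchange of two indices compares [v i v j]
   with [v j v i]. *)
Lemma symb_crossed : exists v v' : 'I_n -> B,
  [/\ forall j i, v j * xi i = (star_sign k j i)%:sc * (xi i * v j),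
      forall j, v j * v' j = 1,
      forall j, L (v j * v j),
      forall i j, j != i -> exists2 l, L l & v i * v j = l * (v j * v i) &
      forall M : set B, subalgebra M -> (forall i, M (xi i)) ->
        (forall j, M (v j)) -> forall x, M x].
Proof.
have ex (j : 'I_n) : exists wy : Q * B, let v := c ord0 (lift ord0 j) wy.1 in
    [/\ L wy.2, v * (v * wy.2) = 1 & v * wy.2 * v = 1].
  by have [w [y Ly [vy yv]]] := symb_twist_unit (neq_lift ord0 j); exists (w, y).
have [wy wyP] := choice ex.
pose v j := c ord0 (lift ord0 j) (wy j).1; pose y j := (wy j).2.
have Ly j : L (y j) by case: (wyP j).
have vvy j : v j * (v j * y j) = 1 by case: (wyP j).
have vyv j : v j * y j * v j = 1 by case: (wyP j).
have c_v j s : exists2 l, L l & c ord0 (lift ord0 j) s = l * v j.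
  exists (c ord0 (lift ord0 j) s * v j * y j); last first.
    by rewrite -(mulrA _ (v j) (y j)) -mulrA vyv mulr1.
  apply: (subalgM L_alg) => //; apply: (symb_mul_same char_k z_pure c_symb) => //.
have vL j l : L l -> exists2 l', L l' & v j * l = l' * v j.
  move=> Ll; exists (sign_act xi (flip2 ord0 (lift ord0 j)) l); first exact: twist_in.
  by apply: (multiquad_conj xi_mq) => // i; exact: symb_xi.
exists v, (fun j => v j * y j); split=> //.
- by move=> j i; rewrite symb_xi // -sign_flip rmorphXn rmorphN1.
- by move=> j; apply: (symb_mul_same char_k z_pure c_symb).
- move=> i j ji.
  apply: (symb_exchange c_symb (M := [set x | exists2 l, L l & x = l * (v j * v i)])).
  + by rewrite (inj_eq lift_inj).
  + exact: neq_lift.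
  + exact: neq_lift.
  + move=> _ _ [l Ll ->] [l' Ll' ->]; exists (l + l'); last by rewrite mulrDl.
    exact: (subalgD L_alg).
  + by exists 0; [exact: subalg0 | rewrite mul0r].
  + move=> u _ [l Ll ->]; exists (u%:sc * l); last by rewrite mulrA.
    by apply: (subalgM L_alg) => //; exact: subalg_sc.
  + move=> s t /=; have [l Ll ->] := c_v j s; have [l' Ll' ->] := c_v i t.
    have [l2 Ll2 e2] := vL j l' Ll'.
    exists (l * l2); first exact: (subalgM L_alg).
    by rewrite -!mulrA (mulrA (v j)) e2 !mulrA.
- move=> M M_alg M_xi M_v; apply: (symb_gen_star char_k a_neq0 b_neq0 z_pure z_inv c_symb (l := ord0)) => //.
  move=> j s; case: (unliftP ord0 j) => [j'|] -> // _.
  have [l Ll ->] := c_v j' s; apply: (subalgM M_alg); last exact: M_v.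
  by apply: Ll => // _ [i _ <-]; exact: M_xi.
Qed.

Lemma symb_centre_generated : centre B = generated_subalgebra [set \prod_i xi i].
Proof.
have [v [v' [v_xi vV v_sqr v_comm v_gen]]] := symb_crossed.
exact: (centre_generated char_k xi_mq v_xi vV v_sqr v_comm v_gen).
Qed.

Lemma symb_strictly_maximal : strictly_maximal L.
Proof.
have [v [v' [v_xi vV v_sqr v_comm v_gen]]] := symb_crossed.
exact: (crossed_strictly_maximal char_k xi_mq v_xi vV v_sqr v_comm v_gen).
Qed.

Lemma symb_centre_fixed : centre B =
  [set x | L x /\ forall g, g \in even_signs n.+1 -> sign_act xi g x = x].
Proof.
have [v [v' [v_xi vV v_sqr v_comm v_gen]]] := symb_crossed.
have cP := centreP char_k xi_mq v_xi vV v_sqr v_comm v_gen.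
have L_mon : L (mon xi finset.setT).
  by apply: (subalg_prod L_alg) => // i _; case: ifP => // _; exact: subalg1.
apply/seteqP; split=> [x /cP[c0 [c1 ->]]|x [Lx fx]].
  split=> [|g].
    apply: (subalgD L_alg); first exact: subalg_sc.
    by apply: (subalgM L_alg) => //; exact: subalg_sc.
  rewrite inE => /eqP g0.
  rewrite /sign_act (twistD xi_mq); last first.
  - by apply: (subalgM L_alg) => //; exact: subalg_sc.
  - exact: subalg_sc.
  rewrite (twistM xi_mq (sign_of_sqr k g)) //; last exact: subalg_sc.
  rewrite !(twist_sc xi_mq) (twist_mon xi_mq) (eq_bigl xpredT) => [|i]; last by rewrite inE.
  by rewrite signZ2_sum g0 expr0 rmorph1 mul1r.
apply/cP; do 2 eexists; apply: (star_fixed char_k xi_mq Lx) => j.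
by rewrite -sign_flip; apply: fx; apply: flip2_even; exact: neq_lift.
Qed.

Let two : (2%:R : B) = (2%:R)%:sc. Proof. by rewrite rmorph_nat. Qed.

Lemma symb_conj p q : p != q -> forall x, L x ->
  2%:R * c p q 1 * x = sign_act xi (flip2 p q) x * (2%:R * c p q 1).
Proof.
move=> pq; apply: (multiquad_conj xi_mq) => i.
rewrite two mulr_scCA -!mulrA symb_xi // [in RHS]mulr_scCA; congr (_ * _).
Qed.

Lemma symb_conj_unit p q : p != q -> quat_basis (z p) (z q) ->
  exists v, inverse_of (2%:R * c p q 1) v /\
    forall x, L x -> 2%:R * c p q 1 * x * v = sign_act xi (flip2 p q) x.
Proof.
move=> pq bas.
have N0 : qtrd (z p * (1 * z q * qconj 1)) ^+ 2
    - 4%:R * (qnrd (1 : Q) ^+ 2 * (d p * d q)) != 0.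
  have -> : qnrd (1 : Q) = 1 by rewrite /qnrd /=; ring.
  by rewrite qconj1 mulr1 mul1r expr1n mul1r; exact: (quat_basis_gram char_k a_neq0 b_neq0).
have [y Ly [cy yc]] := symb_unit pq N0.
exists ((2%:R^-1)%:sc * (c p q 1 * y)).
have uv : 2%:R * c p q 1 * ((2%:R^-1)%:sc * (c p q 1 * y)) = 1.
  by rewrite two mulr_scCA -!mulrA cy mulr1 -rmorphM mulVf // rmorph1.
split; last by move=> x Lx; rewrite symb_conj // -mulrA uv mulr1.
by split=> //; rewrite two -mulrA mulr_scCA yc mulr1 -rmorphM mulVf // rmorph1.
Qed.

Lemma symb_double_comm i j p q : i != j -> p != q ->
  i != p -> i != q -> j != p -> j != q ->
  2%:R * c i j 1 * (2%:R * c p q 1) = 2%:R * c p q 1 * (2%:R * c i j 1).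
Proof.
move=> ij pq ip iq jp jq; rewrite two -!mulrA [c i j 1 * _]mulr_scCA [c p q 1 * _]mulr_scCA.
by rewrite (symb_comm char_k a_neq0 b_neq0 c_symb).
Qed.

Lemma symb_double_sqr p q : p != q ->
  2%:R * c p q 1 * (2%:R * c p q 1) = (qtrd (z p * z q))%:sc - 2%:R * (xi p * xi q).
Proof.
move=> pq; rewrite two -mulrA mulr_scCA (symb_sqr char_k a_neq0 b_neq0 z_pure c_symb) //.
rewrite scA mulrBr scA -rmorphM /qtrd.
by congr (alg_map B _ - alg_map B _ * _); field.
Qed.

Lemma symb_double_triple i p q (l0 lp lq lpq : k) : i != p -> i != q -> p != q ->
  z i = l0 *: 1 + lp *: z p + lq *: z q + lpq *: (z p * z q) ->
  2%:R * c i p 1 * (2%:R * c i q 1) =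
  (l0%:sc - xi i + lp%:sc * xi p - lq%:sc * xi q - lpq%:sc * (xi p * xi q))
    * (2%:R * c p q 1).
Proof.
move=> ip iq pq zi.
have xi_p s : xi p * c p q s = c p q (z p * s) by exact: (mul_xi_symb char_k z_pure z_inv c_symb).
have xi_q s : xi q * c p q s = - c p q (s * z q).
  rewrite (xi_symb_anticommr char_k z_pure z_inv c_symb) //.
  by rewrite (symb_mul_xi char_k z_pure z_inv c_symb).
rewrite two -mulrA [c i p 1 * _]mulr_scCA [RHS]mulr_scCA; congr (_ * _).
rewrite -two (symb_triple char_k a_neq0 b_neq0 z_pure c_symb) //.
rewrite !(mulrBl, mulrDl) -!mulrA xi_q mul1r !mulrN !xi_p mulr1 {1}zi.
rewrite !(symbD c_symb) !(symbZ c_symb) !opprK.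
by rewrite -!addrA; congr (_ + _); rewrite [RHS]addrC -!addrA.
Qed.

End Assembly.

Theorem mainTheorem16 (k : fieldType) (char_k : (2%:R : k) != 0)
    (a b : k) (a_neq0 : a != 0) (b_neq0 : b != 0)
    (V : rmodType (quat a b)) (h : V -> V -> quat a b)
    (h_antiherm : antihermitian h) (h_nondeg : nondegenerate_form h)
    (r : nat) (r_ge2 : (2 <= r)%N) (e : 'I_r -> V) (e_basis : rbasis e)
    (z : 'I_r -> quat a b)
    (h_diag : forall i j, h (e i) (e j) = if i == j then z i else 0)
    (z_pure : forall i, qpure (z i)) (z_inv : forall i, qinvertible (z i))
    (z_indep : forall p q, p != q -> forall s t : k,
       s *: z p + t *: z q = 0 -> s = 0 /\ t = 0)
    (sigma : endo_algebra V -> endo_algebra V)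
    (sigma_adj : adjoint_involution h sigma)
    (tau : clifford_algebra sigma (endo_trd e) ->
           clifford_algebra sigma (endo_trd e))
    (tau_canonical : clifford_involution tau) :
  let B : algebra k := clifford_algebra sigma (endo_trd e) in
  exists (xi : 'I_r -> B) (act : 'rV['Z_2]_r -> B -> B),
  let L : set B := generated_subalgebra (range xi) in
  let H : {set 'rV['Z_2]_r} := finset (fun g : 'rV['Z_2]_r => \sum_i g 0 i == 0) in
  [/\ etale_subalgebra L /\ strictly_maximal L,
      forall i, xi i * xi i = (qre (z i * z i))%:sc,
      centre B = generated_subalgebra [set \prod_i xi i],
      galois_algebra L act /\
        (forall g i, act g (xi i) = (-1) ^+ (g 0 i) * xi i) &
  [/\ forall x, L x -> tau x = act (const_mx 1) x,
      centre B = [set x | L x /\ forall g, g \in H -> act g x = x],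
      H = <<finset (fun g : 'rV['Z_2]_r => [exists p, exists q,
                       (p != q) && (g == flip2 p q)])>>%g &
  exists u : 'I_r -> 'I_r -> B,
  (forall p q, p != q -> u p q = u q p) /\
  [/\ (* (1) *)
      forall p q, p != q ->
        (forall x, L x -> u p q * x = act (flip2 p q) x * u p q) /\
        (quat_basis (z p) (z q) ->
         exists v, inverse_of (u p q) v /\
           forall x, L x -> u p q * x * v = act (flip2 p q) x),
      (* (2) *)
      forall p q, p != q -> tau (u p q) = - u p q,
      (* (3) *)
      forall i j p q, i != j -> p != q ->
        i != p -> i != q -> j != p -> j != q ->
        u i j * u p q = u p q * u i j,
      (* (4) *)
      forall p q, p != q ->
        u p q * u p q = (qtrd (z p * z q))%:sc - 2%:R * (xi p * xi q) &
      (* (5) *)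
      forall i p q, i != p -> i != q -> p != q ->
        forall l0 lp lq lpq : k,
        z i = l0 *: 1 + lp *: z p + lq *: z q + lpq *: (z p * z q) ->
        u i p * u i q =
          (l0%:sc - xi i + lp%:sc * xi p - lq%:sc * xi q
             - lpq%:sc * (xi p * xi q)) * u p q]]].
Proof.
case: r r_ge2 e e_basis z h_diag z_pure z_inv z_indep tau tau_canonical =>
  [//|n] _ {}e {}e_basis {}z {}h_diag {}z_pure {}z_inv {}z_indep {}tau {}tau_canonical B.
pose c i j s : B := cl_gen sigma (endo_trd e) (rank1 h_antiherm e i j s).
have c_symb : clifford_symbols z c.
  exact: (clifford_symbolsP char_k a_neq0 b_neq0 h_antiherm h_nondeg e_basis h_diag z_pure z_inv sigma_adj).
pose xi i := c i i 1.
have xi_mq : multiquadratic xi (fun i => qre (z i * z i)).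
  exact: (xi_multiquadratic char_k a_neq0 b_neq0 h_antiherm h_nondeg e_basis h_diag z_pure z_inv sigma_adj).
exists xi, (sign_act xi) => L H.
have [tauD tauM tau_sc _ tau_gen] := tau_canonical.
have tau_c i j : tau (c i j 1) = - c j i 1.
  by rewrite tau_gen (adjoint_rank1 h_antiherm h_nondeg e sigma_adj) cl_genN qconj1.
split.
- split; last exact: (symb_strictly_maximal char_k a_neq0 b_neq0 z_pure z_inv z_indep c_symb xi_mq).
  have [K [iota [rt rtP]]] := exists_sqrt_xi z.
  exact: (multiquad_etale char_k xi_mq rtP).
- by move=> i; exact: (mq_sqr xi_mq).
- exact: (symb_centre_generated char_k a_neq0 b_neq0 z_pure z_inv z_indep c_symb xi_mq).
- by split; [exact: (multiquad_galois char_k xi_mq) | exact: (sign_act_xi xi_mq)].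
split.
- apply: (multiquad_anti xi_mq) => // i; rewrite tau_c mxE /=.
  by rewrite mulN1r.
- exact: (symb_centre_fixed char_k a_neq0 b_neq0 z_pure z_inv z_indep c_symb xi_mq).
- exact: even_signs_gen.
exists (fun p q => 2%:R * c p q 1); split=> [p q pq|].
  by rewrite [c p q 1](symbC c_symb) // qconj1.
split.
- move=> p q pq; split.
    exact: (symb_conj char_k a_neq0 b_neq0 z_pure z_inv c_symb xi_mq).
  exact: (symb_conj_unit char_k a_neq0 b_neq0 z_pure z_inv c_symb xi_mq).
- move=> p q pq; rewrite tauM tau_c -[2%:R](rmorph_nat (@alg_map k B)) tau_sc.
  by rewrite [c q p 1](symbC c_symb) 1?eq_sym // qconj1 mulNr mulr_scC.
- exact: (symb_double_comm char_k a_neq0 b_neq0 c_symb).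
- exact: (symb_double_sqr char_k a_neq0 b_neq0 z_pure c_symb).
- by move=> i p q ip iq pq l0 lp lq lpq; exact: (symb_double_triple char_k a_neq0 b_neq0 z_pure z_inv c_symb).
Qed.
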